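(* Consider the (relaxed) joint inventory placement, assortment personalization and order fulfillment problem described in the context, with an arbitrary choice model $\phi$ satisfying the stated assumptions, and let $K^{\min}=\min_{\ell\in\mathcal L}K^\ell$ and $C_{\min}=\min_{i\in\mathcal N}C_i$. Suppose arrivals are stationary, i.e. $\lambda_{jt}=\lambda_j$ for all $t\in\mathcal T$, $j\in\mathcal M$. Then one can compute in polynomial time a $\beta$-approximation, where $$\beta=1-2\max\left(\sqrt{\frac{n}{K^{\min}}},\ \sqrt{\frac{L}{C_{\min}}}\right);$$ that is, a feasible inventory placement $\boldsymbol c$ and a (randomized) assortment and fulfillment policy whose expected total profit starting from $\boldsymbol c$ is at least $\beta\cdot\mathrm{OPT}^*$.
   Context: Setting. Products $\mathcal N=\{1,\dots,n\}$, customer types $\mathcal M=\{1,\dots,m\}$, warehouses $\mathcal L=\{1,\dots,L\}$, time periods $\mathcal T=\{1,\dots,T\}$. In each period $t$ at most one customer arrives; a type-$j$ customer arrives with probability $\lambda_{jt}\ge 0$ (with $\sum_{j}\lambda_{jt}\le 1$), independently across periods. If a type-$j$ customer is offered the assortment $S\subseteq\mathcal N$, she chooses product $i$ with probability $\phi_{ij}(S)$ and nothing with probability $1-\sum_{i}\phi_{ij}(S)\geq 0$; choices are independent across periods. Assumptions on $\phi$: $\phi_{kj}(S)=0$ if $k\notin S$; weak substitutability: $\phi_{ij}(S\cup\{k\})\le\phi_{ij}(S)$ for all $S$, $i\in S$, $k\notin S$. Serving product $i$ to a type-$j$ customer from warehouse $\ell$ gives profit $r_{ij}^\ell\in\mathbb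 R$ (possibly negative). Fixed-placement (relaxed) problem. A virtual warehouse $L+1$ with infinite stock of each product and profits $r_{ij}^{L+1}=0$ is added; $\mathcal L_+=\mathcal L\cup\{L+1\}$. Start with inventory $c_i^\ell$ of product $i$ at warehouse $\ell\in\mathcal L$. On the arrival of a type-$j$ customer in period $t$, the policy (knowing the type, the period and the history/current inventory $\boldsymbol x$, and possibly randomizing) offers an assortment $S\subseteq\mathcal N$ and decides, for each $i\in S$, a warehouse $f(i)\in\mathcal L_+$ from which $i$ is served if chosen, where $f(i)\in\mathcal L$ is allowed only if $x_i^{f(i)}>0$. If product $i$ is chosen, the profit $r_{ij}^{f(i)}$ is earned and, when $f(i)\in\mathcal L$, the stock $x_i^{f(i)}$ decreases by one. $J_1^*(\boldsymbol c)$ denotes the maximum expected total profit over the $T$ periods among all such policies. Joint problem. Warehouse $\ell$ has storage capacity $K^\ell$ (a positive integer) and product $i$ has total supply $C_i$ (a positive integer or $+\infty$). A placement $\boldsymbol c=(c_i^\ell)\in\mathbb Z_+^{nL}$ is feasible if $\sum_{i\in\mathcal N}c_i^\ell\le K^\ell$ for all $\ell\in\mathcal L$ and $\sum_{\ell\in\mathcal L}c_i^\ell\le C_i$ for all $i\in\mathcal N$. $\mathrm{OPT}^*$ is the maximum of $J_1^*(\boldsymbol c)$ over feasible placements $\boldsymbol c$. Computational model. There is a polynomial-time oracle which, given a customer type $j$ and per-product rewards $(\rho_i)_{i\in\mathcal N}$, returns $S\subseteq\mathcal N$ maximizing $\sum_{i\in S}\rho_i\phi_{ij}(S)$. Polynomial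 time is with respect to the input size (including $n,m,L,T$).
   Formalization: The arrival probabilities, choice probabilities and profits are rational, with the bit length of the choice probabilities counted in the input size, and besides the assortment-optimization oracle the algorithm may also query the choice probabilities of any given assortment. *)

(* Defs.v *)
From mathcomp Require Import all_boot all_order all_algebra.
From mathcomp Require Import classical_sets reals.

Set Implicit Arguments.
Unset Strict Implicit.
Unset Printing Implicit Defensive.

Import Order.TTheory GRing.Theory Num.Theory.
Local Open Scope ring_scope.

(* The data are rational because an algorithm has to read them.  A supply of
   [None] means +oo.  The choice model [choice_prob] is a table of exponential
   size, which the algorithm reads only through an oracle; [choice_bits] bounds
   the encoding length of its entries. *)
Record instance (n m L T : nat) := Instance {
  arrival : 'I_m -> 'I_T -> rat;
  choice_prob : 'I_n -> 'I_m -> {set 'I_n} -> rat;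
  profit : 'I_n -> 'I_m -> 'I_L -> rat;
  capacity : 'I_L -> nat;
  supply : 'I_n -> option nat;
  choice_bits : nat
}.

(* An assortment [d.1] and a warehouse [d.2 i] for each product, where [None]
   is the virtual warehouse L+1; the values of [d.2] outside [d.1] are
   irrelevant. *)
Definition decision (n L : nat) : finType :=
  ({set 'I_n} * {ffun 'I_n -> option 'I_L})%type.

(* [None]: no arrival; [Some (j, d, o)]: a type-j customer arrived, was offered
   d, and chose o ([None] meaning that nothing was chosen). *)
Definition event (n m L : nat) : Type :=
  option ('I_m * decision n L * option 'I_n).

(* Events in chronological order: the history h occurs at the start of the
   period of index [size h]. *)
Definition history (n m L : nat) : Type := seq (event n m L).

Definition placement (n L : nat) : Type := 'I_n -> 'I_L -> nat.

(* The probability of each decision, given the history and the type of the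
   arriving customer. *)
Definition policy (R : realType) (n m L : nat) : Type :=
  history n m L -> 'I_m -> decision n L -> R.

Definition serve n m L (x : placement n L) (e : event n m L) : placement n L :=
  if e is Some (_, d, Some i) then
    if d.2 i is Some l then
      fun i' l' => (x i' l' - ((i' == i) && (l' == l)))%N
    else x
  else x.

Definition inventory n m L (c : placement n L) (h : history n m L) :
  placement n L := foldl (@serve n m L) c h.

Definition admissible n L (x : placement n L) (d : decision n L) : Prop :=
  forall i l, i \in d.1 -> d.2 i = Some l -> (0 < x i l)%N.

Definition is_policy (R : realType) n m L (T : nat) (c : placement n L)
    (pi : policy R n m L) : Prop :=
  forall h j, (size h < T)%N ->
    [/\ forall d, 0 <= pi h j d,
        \sum_d pi h j d = 1
      & forall d, 0 < pi h j d -> admissible (inventory c h) d].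

Section Problem.
Variables (R : realType) (n m L T : nat) (I : instance n m L T).

Definition served_profit (i : 'I_n) (j : 'I_m) (w : option 'I_L) : R :=
  if w is Some l then ratr (profit I i j l) else 0.

Definition purchase_prob (j : 'I_m) (S : {set 'I_n}) (i : 'I_n) : R :=
  ratr (choice_prob I i j S).

(* Expected profit over the remaining periods [ts], after the history [h]. *)
Fixpoint expected_profit (pi : policy R n m L) (ts : seq 'I_T)
    (h : history n m L) : R :=
  if ts is t :: ts' then
    let next e := expected_profit pi ts' (rcons h e) in
    \sum_j ratr (arrival I j t) *
      \sum_d pi h j d *
        (\sum_(i in d.1) purchase_prob j d.1 i *
            (served_profit i j (d.2 i) + next (Some (j, d, Some i)))
         + (1 - \sum_(i in d.1) purchase_prob j d.1 i)
             * next (Some (j, d, None)))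
    + (1 - \sum_j ratr (arrival I j t)) * next None
  else 0.

Definition policy_value (pi : policy R n m L) : R :=
  expected_profit pi (enum 'I_T) [::].

Definition J1star (c : placement n L) : R :=
  sup [set v | exists2 pi, is_policy T c pi & v = policy_value pi]%classic.

Definition feasible (c : placement n L) : Prop :=
  (forall l, (\sum_i c i l <= capacity I l)%N) /\
  (forall i C, supply I i = Some C -> (\sum_l c i l <= C)%N).

Definition OPT : R :=
  sup [set v | exists2 c, feasible c & v = J1star c]%classic.

(* Minimum over the extended naturals, [None] being +oo. *)
Definition omin (a b : option nat) : option nat :=
  match a, b with
  | Some x, Some y => Some (minn x y)
  | Some x, None => Some x
  | None, _ => b
  end.

Definition Kmin : option nat := \big[omin/None]_(l < L) Some (capacity I l).
Definition Cmin : option nat := \big[omin/None]_(i < n) supply I i.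

(* a / +oo = 0 *)
Definition oratio (a : nat) (b : option nat) : R :=
  if b is Some k then a%:R / k%:R else 0.

Definition beta : R :=
  1 - 2 * Num.max (Num.sqrt (oratio n Kmin)) (Num.sqrt (oratio L Cmin)).

(* The policy that, after the history [h] and the arrival of type [j], draws
   [u] uniformly in {0, ..., N h j - 1} and decides [D h j u]. *)
Definition sampled_policy (N : history n m L -> 'I_m -> nat)
    (D : history n m L -> 'I_m -> nat -> decision n L) : policy R n m L :=
  fun h j d => (\sum_(u < N h j) (D h j u == d))%N%:R / (N h j)%:R.

End Problem.

Inductive data :=
  | DInt of int
  | DPair of data & data.

Fixpoint data_size (d : data) : nat :=
  match d with
  | DInt z => (trunc_log 2 `|z|%N).+2
  | DPair a b => (data_size a + data_size b).+1
  end.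

Inductive expr :=
  | EVar of nat
  | ELit of int
  | EPair of expr & expr
  | EFst of expr
  | ESnd of expr
  | EIsPair of expr
  | EAdd of expr & expr
  | ESub of expr & expr
  | EMul of expr & expr
  | EDiv of expr & expr
  | EMod of expr & expr
  | ELeq of expr & expr.

Definition store : Type := nat -> data.

Definition dnil : data := DInt 0.

Definition fst_data (d : data) : data := if d is DPair a _ then a else dnil.
Definition snd_data (d : data) : data := if d is DPair _ b then b else dnil.
Definition int_of_data (d : data) : int := if d is DInt z then z else 0.

Definition num2 (f : int -> int -> int) (a b : data) : data :=
  DInt (f (int_of_data a) (int_of_data b)).

Fixpoint eval (s : store) (e : expr) : data :=
  match e with
  | EVar x => s x
  | ELit z => DInt z
  | EPair a b => DPair (eval s a) (eval s b)
  | EFst a => fst_data (eval s a)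
  | ESnd a => snd_data (eval s a)
  | EIsPair a => DInt (if eval s a is DPair _ _ then 1 else 0)
  | EAdd a b => num2 (fun x y => x + y) (eval s a) (eval s b)
  | ESub a b => num2 (fun x y => x - y) (eval s a) (eval s b)
  | EMul a b => num2 (fun x y => x * y) (eval s a) (eval s b)
  | EDiv a b => num2 (fun x y => (x %/ y)%Z) (eval s a) (eval s b)
  | EMod a b => num2 (fun x y => (x %% y)%Z) (eval s a) (eval s b)
  | ELeq a b => num2 (fun x y => if x <= y then 1 else 0) (eval s a) (eval s b)
  end.

(* Logarithmic cost: the total size of all values produced, so that a run of
   cost k can be carried out by a Turing machine in time polynomial in k. *)
Fixpoint eval_cost (s : store) (e : expr) : nat :=
  (data_size (eval s e) +
   match e with
   | EVar _ | ELit _ => 0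
   | EFst a | ESnd a | EIsPair a => eval_cost s a
   | EPair a b | EAdd a b | ESub a b | EMul a b | EDiv a b | EMod a b
   | ELeq a b => eval_cost s a + eval_cost s b
   end)%N.

Inductive prog :=
  | Skip
  | Assign of nat & expr
  | Ask of nat & expr
  | Seq of prog & prog
  | If of expr & prog & prog
  | While of expr & prog.

Definition truth (d : data) : bool := if d is DInt z then z != 0 else true.

Definition update (s : store) (x : nat) (d : data) : store :=
  fun y => if y == x then d else s y.

(* [run O p s k s']: with the oracle [O], the program [p] started in the store
   [s] halts in the store [s'] at cost [k].  A call of the oracle is charged
   for the lengths of the query and of the answer. *)
Inductive run (O : data -> data) : prog -> store -> nat -> store -> Prop :=
  | RunSkip s : run O Skip s 1 s
  | RunAssign s x e :
      run O (Assign x e) s (eval_cost s e).+1 (update s x (eval s e))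
  | RunAsk s x e :
      run O (Ask x e) s (eval_cost s e + data_size (O (eval s e))).+1
        (update s x (O (eval s e)))
  | RunSeq p q s1 s2 s3 k1 k2 :
      run O p s1 k1 s2 -> run O q s2 k2 s3 -> run O (Seq p q) s1 (k1 + k2).+1 s3
  | RunIf e p q s s' k :
      run O (if truth (eval s e) then p else q) s k s' ->
      run O (If e p q) s (eval_cost s e + k).+1 s'
  | RunWhileEnd e p s :
      ~~ truth (eval s e) -> run O (While e p) s (eval_cost s e).+1 s
  | RunWhileLoop e p s1 s2 s3 k1 k2 :
      truth (eval s1 e) -> run O p s1 k1 s2 -> run O (While e p) s2 k2 s3 ->
      run O (While e p) s1 (eval_cost s1 e + k1 + k2).+1 s3.

Definition computes_within (O : data -> data) (p : prog) (x y : data)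
    (b : nat) : Prop :=
  exists k s, [/\ run O p (update (fun=> dnil) 0 x) k s, s 0%N = y
                & (k <= b)%N].

Definition enc_nat (k : nat) : data := DInt k%:Z.
Definition enc_rat (q : rat) : data := DPair (DInt (numq q)) (DInt (denq q)).
Definition enc_seq (s : seq data) : data := foldr DPair dnil s.
Definition enc_option (A : Type) (enc : A -> data) (o : option A) : data :=
  if o is Some a then DPair (enc a) dnil else dnil.
Definition enc_fun (n : nat) (A : Type) (enc : A -> data) (f : 'I_n -> A) :
  data := enc_seq [seq enc (f i) | i <- enum 'I_n].
Definition enc_ord (n : nat) (i : 'I_n) : data := enc_nat i.
Definition enc_set (n : nat) (S : {set 'I_n}) : data :=
  enc_fun (fun b : bool => enc_nat b) (fun i => i \in S).

Definition enc_placement n L (c : placement n L) : data :=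
  enc_fun (enc_fun enc_nat) c.

Definition enc_decision n L (d : decision n L) : data :=
  DPair (enc_set d.1) (enc_fun (enc_option (@enc_ord L)) d.2).

Definition enc_event n m L (e : event n m L) : data :=
  enc_option (fun a : 'I_m * decision n L * option 'I_n =>
    enc_seq [:: enc_ord a.1.1; enc_decision a.1.2;
                enc_option (@enc_ord n) a.2]) e.

Definition enc_history n m L (h : history n m L) : data :=
  enc_seq [seq enc_event e | e <- h].

Section Algorithm.
Variables (n m L T : nat) (I : instance n m L T).

Definition enc_instance : data :=
  enc_seq [:: enc_nat n; enc_nat m; enc_nat L; enc_nat T;
              enc_fun (enc_fun enc_rat) (arrival I);
              enc_fun (enc_fun (enc_fun enc_rat)) (profit I);
              enc_fun enc_nat (capacity I);
              enc_fun (enc_option enc_nat) (supply I);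
              enc_nat (choice_bits I)].

(* The last two summands make n, m, L, T and the length of the choice
   probabilities count in unary. *)
Definition input_size : nat :=
  (data_size enc_instance + (n + m + L + T) + choice_bits I)%N.

Definition valid : Prop :=
  [/\ [/\ (0 < n)%N, (0 < L)%N, forall l, (0 < capacity I l)%N
        & forall i C, supply I i = Some C -> (0 < C)%N],
      (forall j t, 0 <= arrival I j t) /\ (forall t, \sum_j arrival I j t <= 1),
      [/\ forall i j S, 0 <= choice_prob I i j S,
          forall j S, \sum_i choice_prob I i j S <= 1,
          forall k j (S : {set 'I_n}), k \notin S -> choice_prob I k j S = 0
        & forall i j (S : {set 'I_n}) k, i \in S -> k \notin S ->
            choice_prob I i j (k |: S) <= choice_prob I i j S]
    & forall i j S,
        (data_size (enc_rat (choice_prob I i j S)) <= choice_bits I)%N].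

Definition stationary : Prop :=
  forall j t t', arrival I j t = arrival I j t'.

Definition assortment_reward (j : 'I_m) (rho : 'I_n -> rat) (S : {set 'I_n}) :
  rat := \sum_(i in S) rho i * choice_prob I i j S.

(* Queries tagged 0 evaluate the choice model; queries tagged 1 ask for an
   optimal assortment.  On other data the oracle is arbitrary. *)
Definition oracle_for (O : data -> data) : Prop :=
  (forall j S,
     O (enc_seq [:: enc_nat 0; enc_ord j; enc_set S]) =
       enc_fun enc_rat (fun i => choice_prob I i j S)) /\
  (forall j rho, exists2 S : {set 'I_n},
     forall S', assortment_reward j rho S' <= assortment_reward j rho S
     & O (enc_seq [:: enc_nat 1; enc_ord j; enc_fun enc_rat rho]) = enc_set S).

(* The program [place] outputs a placement [c] and some advice for the policy.
   At each arrival, [range] outputs the number [N h j] of values of a uniform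
   random draw and, given the drawn value [u], [decide] outputs a decision. *)
Definition place_spec (O : data -> data) (place : prog) (b : nat)
    (c : placement n L) (advice : data) : Prop :=
  computes_within O place enc_instance (DPair (enc_placement c) advice) b.

Definition policy_input (c : placement n L) (advice : data)
    (h : history n m L) (j : 'I_m) : data :=
  enc_seq [:: enc_instance; enc_placement c; advice; enc_history h; enc_ord j].

Definition range_spec (O : data -> data) (range : prog) (b : nat)
    (c : placement n L) (advice : data)
    (N : history n m L -> 'I_m -> nat) : Prop :=
  forall h j, (size h < T)%N ->
    (0 < N h j)%N /\
    computes_within O range (policy_input c advice h j) (enc_nat (N h j)) b.

Definition decide_spec (O : data -> data) (decide : prog) (b : nat)
    (c : placement n L) (advice : data)
    (N : history n m L -> 'I_m -> nat)
    (D : history n m L -> 'I_m -> nat -> decision n L) : Prop :=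
  forall h j u, (size h < T)%N -> (u < N h j)%N ->
    computes_within O decide (DPair (policy_input c advice h j) (enc_nat u))
      (enc_decision (D h j u)) b.

End Algorithm.

(* Main.v *)
Require Import Defs.
From mathcomp Require Import all_boot all_order all_algebra.
From mathcomp Require Import boolp classical_sets reals.
From mathcomp Require Import zify ring lra.

Set Implicit Arguments.
Unset Strict Implicit.
Unset Printing Implicit Defensive.

Import Order.TTheory GRing.Theory Num.Theory.
Local Open Scope ring_scope.

(* The placement and the policy come from a drift-plus-penalty (dual subgradient)
   scheme for the fluid relaxation, run for polynomially many rounds in integer
   arithmetic.  Every warehouse and every product has a virtual queue, used as a
   price; in each round the oracle gives, for every customer type, an optimal
   assortment for the profits net of prices, and each queue grows by its expected
   load minus its capacity.  The capacities are first reduced by a safety stock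
   [g] per product and warehouse, where [g] is about the inverse of
   [eps = max (sqrt (n / Kmin)) (sqrt (L / Cmin))], so the reduction costs a
   factor [1 - eps].  Since the queues stay below half a unit per round, rounding
   the average load down and adding [g] gives a feasible placement.  The policy
   plays a uniformly random round and serves sold-out products from the virtual
   warehouse.  By stationarity, the demand for a product at a warehouse is binomial
   with mean at least [g - 1] below the stock, and
   [E (D - x)^+ <= Var D / (4 (x - E D))] bounds the lost sales by a fraction
   [1 / (4 (g - 1))].  If [eps] is so small that [g > T], no queue ever grows and no
   stock ever runs out, and the policy is optimal.  In the other case [eps > 1 / (T + 1)],
   so a polynomial number of rounds gives enough accuracy. *)

Local Open Scope nat_scope.

(** * Polynomial-time computations *)

(** The fluid relaxation has one variable per assortment, reachable only through the oracle, so it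
    is attacked through its dual, whose variables are prices. By weak duality each price vector
    bounds the optimum over all placements; the averaged rounds are compared with these bounds, and
    no optimal solution of the relaxation is needed.

    Errors must be relative to an optimum of unknown size. Prices are therefore scaled by the
    largest expected profit [W] of one period, and the target of the scheme is the maximum of the
    optimum and [W], which absorbs errors proportional to [W].

    The factor 2 splits as follows: the reserve costs [eps], the finite number of rounds at most
    [eps / 4], and the lost sales at most [3 eps / 4], the last because [g >= 2] and
    [eps (g + 1) > 1]; then [(1 - 5 eps / 4) (1 - 3 eps / 4) >= 1 - 2 eps].

    Running times concern programs of a concrete language. These are not written out: computability
    in polynomial time is shown to be closed under the operations used, with a size bound carried
    along. *)

Definition polybound (A : Type) (z f : A -> nat) : Prop :=
  exists d, forall a, f a <= (z a + 2) ^ d.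

Section PolyBound.
Variables (A : Type) (z : A -> nat).

Lemma polybound_leq (f g : A -> nat) :
  (forall a, f a <= g a) -> polybound z g -> polybound z f.
Proof. by move=> fg [d gd]; exists d => a; apply: leq_trans (gd a). Qed.

Lemma polybound_cst c : polybound z (fun=> c).
Proof.
exists c => a; case: c => // c; apply: leq_trans (ltnW (ltn_expl c.+1 (ltnSn 1))) _.
by rewrite leq_exp2r // leq_addl.
Qed.

Lemma polybound_id : polybound z z.
Proof. by exists 1 => a; rewrite expn1 leq_addr. Qed.

Lemma polyboundM (f g : A -> nat) :
  polybound z f -> polybound z g -> polybound z (fun a => f a * g a).
Proof. by move=> [d fd] [e ge]; exists (d + e) => a; rewrite expnD leq_mul. Qed.

(** Both bounds are at least 1 and the base is at least 2, so one extra factor turns their product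
    into a bound on the sum. *)
Lemma polyboundD (f g : A -> nat) :
  polybound z f -> polybound z g -> polybound z (fun a => f a + g a).
Proof.
move=> [d fd] [e ge]; exists (d + e).+1 => a.
have p1 k : 0 < (z a + 2) ^ k by rewrite expn_gt0 addn2.
have := leq_add (fd a) (ge a); rewrite expnS expnD.
have := p1 d; have := p1 e; nia.
Qed.

End PolyBound.

Lemma polybound_comp (A B : Type) (z : A -> nat) (z' : B -> nat) (h : B -> A)
    (f : A -> nat) :
  (forall b, z' b = z (h b)) -> polybound z f -> polybound z' (f \o h).
Proof. by move=> zh [d fd]; exists d => b; rewrite zh; apply: fd. Qed.

Lemma abs_int_of_data x : `|int_of_data x|%N < 2 ^ data_size x.
Proof.
case: x => [z|x y] /=; last by rewrite expn_gt0.
by apply: leq_trans (trunc_log_ltn _ (ltnSn 1)) _; rewrite leq_exp2l.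
Qed.

Lemma data_size_DInt z k : `|z|%N < 2 ^ k -> data_size (DInt z) <= k.+2.
Proof.
move=> zk /=; rewrite !ltnS; have [->|z0] := posnP `|z|%N; first by rewrite trunc_log0.
by rewrite -(leq_exp2l _ _ (ltnSn 1)) (leq_trans (trunc_logP _ z0)) // ltnW.
Qed.

Lemma data_size_nat k : data_size (enc_nat k) <= k.+2.
Proof. by apply: data_size_DInt; rewrite absz_nat; apply: ltn_expl. Qed.

(** A result below [(|a| + 1) (|b| + 1)] has no more bits than both operands together. This covers
    sums, differences, products and quotients. *)
Lemma data_size_num2 f x y :
  (forall a b : int, `|f a b|%N < (`|a|%N + 1) * (`|b|%N + 1)) ->
  data_size (num2 f x y) <= data_size x + data_size y + 2.
Proof.
move=> fab; rewrite addn2 [X in X <= _]/=; apply: (@data_size_DInt (f _ _)).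
apply: leq_trans (fab _ _) _; rewrite expnD !addn1.
by apply: leq_mul; apply: abs_int_of_data.
Qed.

(* A context lists the situations in which a program may be run: the oracle, the
   measure of time, and what is known of the store, of which only the variables
   below [height] matter; the program may overwrite all others. *)
Record context := Context {
  situation : Type;
  oracle : situation -> data -> data;
  measure : situation -> nat;
  height : nat;
  holds : situation -> store -> Prop;
  holds_local : forall a s s',
    (forall i, i < height -> s' i = s i) -> holds a s -> holds a s'
}.

(** The result may go into any variable [k] above the context, and all variables below [k] survive,
    so programs compose by moving to higher result variables. The size bound is included because the
    cost of every later use of the value depends on it. *)
Definition ptime (C : context) (f : situation C -> data) : Prop :=
  polybound (@measure C) (fun a => data_size (f a)) /\
  forall k, height C <= k -> exists p, exists2 t, polybound (@measure C) t &
    forall a s, holds a s -> exists c s',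
      [/\ run (oracle a) p s c s', s' k = f a,
          (forall i, i < k -> s' i = s i) & c <= t a].

(** [h] forgets what a situation of [C'] has in addition to one of [C], typically a loop index, so
    that whatever is computable in [C] stays computable in [C']. *)
Definition refines (C' C : context) (h : situation C' -> situation C) : Prop :=
  [/\ forall x, oracle x = oracle (h x), forall x, measure x = measure (h x),
      height C <= height C' & forall x s, holds x s -> holds (h x) s].

Lemma ptime_refines C C' h f :
  refines h -> @ptime C f -> @ptime C' (fun x => f (h x)).
Proof.
case=> ho hm hh hs [sf cf]; split; first exact: (polybound_comp hm sf).
move=> k hk; have [p [t tp pP]] := cf k (leq_trans hh hk).
exists p, (t \o h) => [|x s /hs /pP]; first exact: (polybound_comp hm tp).
by rewrite -ho.
Qed.

(** * Closure of polynomial time under expressions, conditionals and oracle calls *)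

Section Ptime.
Variable C : context.
Implicit Types f g : situation C -> data.

Lemma eq_ptime f g : (forall a, f a = g a) -> ptime f -> ptime g.
Proof.
move=> fg [sf cf]; split; first by apply: polybound_leq sf => a; rewrite fg.
move=> k /cf [p [t tp pP]]; exists p, t => // a s /pP [c [s' []]].
by rewrite fg => *; exists c, s'.
Qed.

Lemma ptime_size f : ptime f -> polybound (@measure C) (fun a => data_size (f a)).
Proof. by case. Qed.

Lemma ptime_var i f :
  i < height C -> polybound (@measure C) (fun a => data_size (f a)) ->
  (forall a s, holds a s -> s i = f a) -> ptime f.
Proof.
move=> iC sf fP; split=> // k _; exists (Assign k (EVar i)).
exists (fun a => data_size (f a) + 1); first exact/polyboundD/polybound_cst.
move=> a s /fP si; exists (eval_cost s (EVar i)).+1, (update s k (s i)); split.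
- exact: RunAssign.
- by rewrite /update eqxx.
- by move=> j jk; rewrite /update ltn_eqF.
- by rewrite /= si addn0 addn1.
Qed.

Lemma ptime_lit z : @ptime C (fun=> DInt z).
Proof.
split; first exact: polybound_cst; move=> k _; exists (Assign k (ELit z)).
exists (fun=> (data_size (DInt z)).+1) => [|a s _]; first exact: polybound_cst.
exists (eval_cost s (ELit z)).+1, (update s k (DInt z)); split.
- exact: RunAssign.
- by rewrite /update eqxx.
- by move=> j jk; rewrite /update ltn_eqF.
- by rewrite /= addn0.
Qed.

Lemma ptime_op1 (e : expr -> expr) (F : data -> data) f :
  (forall s x, eval s (e x) = F (eval s x)) ->
  (forall s x, eval_cost s (e x) = data_size (F (eval s x)) + eval_cost s x) ->
  (forall x, data_size (F x) <= data_size x + 2) ->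
  ptime f -> ptime (fun a => F (f a)).
Proof.
move=> eE eC eS [sf cf]; have sF : polybound (@measure C) (fun a => data_size (F (f a))).
  by apply: (polybound_leq (fun a => eS (f a))); apply/polyboundD/polybound_cst.
split=> // k /cf [p [t tp pP]].
exists (Seq p (Assign k (e (EVar k)))).
exists (fun a => t a + (data_size (F (f a)) + data_size (f a) + 2)).
  by do 2!apply/polyboundD=> //; [apply/polyboundD | apply: polybound_cst].
move=> a s /pP [c [s' [pr sk ss ct]]].
exists (c + (eval_cost s' (e (EVar k))).+1).+1, (update s' k (F (f a))); split.
- by apply: RunSeq pr _; rewrite -[f a]sk -[s' k]/(eval s' (EVar k)) -eE; apply: RunAssign.
- by rewrite /update eqxx.
- by move=> j jk; rewrite /update ltn_eqF // ss.
- by rewrite eC /= sk; lia.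
Qed.

Lemma ptime_op2 (e : expr -> expr -> expr) (F : data -> data -> data) f g :
  (forall s x y, eval s (e x y) = F (eval s x) (eval s y)) ->
  (forall s x y, eval_cost s (e x y) =
     data_size (F (eval s x) (eval s y)) + (eval_cost s x + eval_cost s y)) ->
  (forall x y, data_size (F x y) <= data_size x + data_size y + 2) ->
  ptime f -> ptime g -> ptime (fun a => F (f a) (g a)).
Proof.
move=> eE eC eS [sf cf] [sg cg].
have sF : polybound (@measure C) (fun a => data_size (F (f a) (g a))).
  apply: (polybound_leq (fun a => eS (f a) (g a))).
  exact/polyboundD/polybound_cst/polyboundD.
split=> // k kC; have [p [t tp pP]] := cf k kC.
(* The first operand waits in [k] while [q] computes the second one in [k.+1]. *)
have [q [t' tq qP]] := cg k.+1 (leqW kC).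
exists (Seq p (Seq q (Assign k (e (EVar k) (EVar k.+1))))).
exists (fun a => t a + (t' a + (data_size (F (f a) (g a)) + data_size (f a) + data_size (g a) + 3))).
  by do !(apply/polyboundD=> //); apply: polybound_cst.
move=> a s Hs; have [c [s1 [pr sk ss ct]]] := pP a s Hs.
have [|c' [s2 [qr sk' ss' ct']]] := qP a s1.
  by apply: holds_local Hs => i iC; apply: ss; apply: leq_trans iC kC.
have s2k : s2 k = f a by rewrite ss'.
exists (c + (c' + (eval_cost s2 (e (EVar k) (EVar k.+1))).+1).+1).+1.
exists (update s2 k (F (f a) (g a))); split.
- apply: RunSeq pr (RunSeq qr _); have -> : F (f a) (g a) = eval s2 (e (EVar k) (EVar k.+1)).
    by rewrite eE /= s2k sk'.
  exact: RunAssign.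
- by rewrite /update eqxx.
- by move=> j jk; rewrite /update ltn_eqF // ss' ?ss // ltnW.
- by rewrite eC /= s2k sk'; lia.
Qed.

Lemma ptime_pair f g : ptime f -> ptime g -> ptime (fun a => DPair (f a) (g a)).
Proof. by apply: (@ptime_op2 EPair) => // x y; rewrite /= addn2 ltnW. Qed.

Lemma ptime_fst f : ptime f -> @ptime C (fun a => fst_data (f a)).
Proof. by apply: (@ptime_op1 EFst) => // -[z|x y] //=; lia. Qed.

Lemma ptime_snd f : ptime f -> ptime (fun a => snd_data (f a)).
Proof. by apply: (@ptime_op1 ESnd) => // -[z|x y] //=; lia. Qed.

Definition is_pair (x : data) : bool := if x is DPair _ _ then true else false.

Lemma ptime_is_pair f : ptime f -> ptime (fun a => enc_nat (is_pair (f a))).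
Proof.
apply: (@ptime_op1 EIsPair (fun x => enc_nat (is_pair x))) => [s x|s x|x] /=.
- by case: (eval s x).
- by case: (eval s x).
- by case: x => [z|x y] /=; rewrite ?trunc_log0 ?trunc_log1; lia.
Qed.

Lemma ptime_if (b : situation C -> bool) g h :
  ptime (fun a => enc_nat (b a)) -> ptime g -> ptime h ->
  ptime (fun a => if b a then g a else h a).
Proof.
move=> [sb cb] [sg cg] [sh ch]; split.
  apply: (@polybound_leq _ _ _ (fun a => data_size (g a) + data_size (h a))).
    by move=> a; case: ifP; rewrite ?leq_addr ?leq_addl.
  exact: polyboundD.
move=> k kC; have [p [t tp pP]] := cb k kC.
have [q [t' tq qP]] := cg k kC; have [r [t'' tr rP]] := ch k kC.
exists (Seq p (If (EVar k) q r)), (fun a => t a + (t' a + (t'' a + 5))).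
  by do !(apply/polyboundD=> //); apply: polybound_cst.
move=> a s Hs; have [c [s1 [pr sk ss ct]]] := pP a s Hs.
have Hs1 : holds a s1 by apply: holds_local Hs => i iC; apply/ss/(leq_trans iC).
have [c' [s2 [qr sk' ss' ct']]] : exists c' s2,
    [/\ run (oracle a) (if truth (s1 k) then q else r) s1 c' s2,
       s2 k = (if b a then g a else h a), forall i, i < k -> s2 i = s1 i
     & c' <= t' a + t'' a].
  rewrite sk /=; case: (b a) => /=.
  - by have [c' [s2 [? ? ? ?]]] := qP a s1 Hs1; exists c', s2; split=> //; lia.
  - by have [c' [s2 [? ? ? ?]]] := rP a s1 Hs1; exists c', s2; split=> //; lia.
exists (c + (eval_cost s1 (EVar k) + c').+1).+1, s2; split=> //.
- by apply: RunSeq pr _; apply: RunIf.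
- by move=> i ik; rewrite ss' // ss.
- by rewrite /= sk; case: (b a) => /=; rewrite ?trunc_log1 ?trunc_log0; lia.
Qed.

(** An answer is charged for its length and the oracle is arbitrary outside its specification, so
    the length of the answers has to be bounded by the caller. *)
Lemma ptime_ask f :
  ptime f -> polybound (@measure C) (fun a => data_size (oracle a (f a))) ->
  ptime (fun a => oracle a (f a)).
Proof.
move=> [sf cf] so; split=> // k /cf [p [t tp pP]].
exists (Seq p (Ask k (EVar k))).
exists (fun a => t a + (data_size (f a) + data_size (oracle a (f a)) + 2)).
  by do !(apply/polyboundD=> //); apply: polybound_cst.
move=> a s /pP [c [s' [pr sk ss ct]]].
exists (c + (eval_cost s' (EVar k) + data_size (oracle a (eval s' (EVar k)))).+1).+1.
exists (update s' k (oracle a (eval s' (EVar k)))); split.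
- by apply: RunSeq pr _; apply: RunAsk.
- by rewrite /update eqxx /= sk.
- by move=> j jk; rewrite /update ltn_eqF // ss.
- by rewrite /= sk; lia.
Qed.

End Ptime.

(** * Loops with a polynomial number of iterations *)

Section Loop.
Variables (C : context) (N : situation C -> nat) (st : situation C -> nat -> data).

(** Variable [k] keeps the number of iterations, [k.+1] the index and [k.+2] the state; the body
    works from [k.+3] on. The index is part of the situation, so bounds obtained in this context are
    uniform over the iterations. *)
Definition loop_context (k : nat) (kC : height C <= k) : context.
Proof.
refine (@Context {x : situation C * nat | x.2 < N x.1}
  (fun x => oracle (sval x).1) (fun x => measure (sval x).1) k.+3
  (fun x s => [/\ holds (sval x).1 s, s k.+1 = enc_nat (sval x).2
                & s k.+2 = st (sval x).1 (sval x).2]) _).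
move=> a s s1 ss [Hs e1 e2]; split; rewrite ?ss //.
by apply: holds_local Hs => i iC; apply: ss; lia.
Defined.

Lemma loop_refines k (kC : height C <= k) :
  @refines (loop_context kC) C (fun x => (sval x).1).
Proof. by split=> //= [|x s []//]; lia. Qed.

Hypothesis ptimeN : ptime (fun a => enc_nat (N a)).
Hypothesis boundN : polybound (@measure C) N.
Hypothesis ptime0 : ptime (fun a => st a 0).
Hypothesis bound_st : exists2 t, polybound (@measure C) t &
  forall a i, i <= N a -> data_size (st a i) <= t a.
Hypothesis ptimeS : forall C' h (i : situation C' -> nat),
  @refines C' C h -> (forall x, i x < N (h x)) ->
  ptime (fun x => enc_nat (i x)) -> ptime (fun x => st (h x) (i x)) ->
  ptime (fun x => st (h x) (i x).+1).

Let incr k := EAdd (EVar k.+1) (ELit 1).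
(** The language only compares by [<=], so [i < N] is tested as [i + 1 <= N]. *)
Let guard k := ELeq (incr k) (EVar k).
Let body k q := Seq q (Seq (Assign k.+2 (EVar k.+3)) (Assign k.+1 (incr k))).

Lemma loop_body k (kC : height C <= k) : exists q, exists2 t,
  polybound (@measure C) t & forall a i s, i < N a -> holds a s ->
    s k = enc_nat (N a) -> s k.+1 = enc_nat i -> s k.+2 = st a i ->
    exists c s', [/\ run (oracle a) (body k q) s c s', s' k.+1 = enc_nat i.+1,
      s' k.+2 = st a i.+1, forall i, i <= k -> s' i = s i & c <= t a].
Proof.
have [ts tsp tsP] := bound_st.
have := @ptimeS (loop_context kC) _ (fun x => (sval x).2) (loop_refines kC)
  (fun x => svalP x).
case=> [||_ /(_ k.+3 (leqnn _)) [q [t [d td] qP]]].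
- apply: (@ptime_var _ k.+1) => //= [|a s []//].
  apply: (@polybound_leq _ _ _ (fun x => N (sval x).1 + 2)) => [[[a i] /= iN]|].
    by apply: leq_trans (data_size_nat i) _; lia.
  apply: (@polybound_comp _ _ _ _ (fun x => (sval x).1) (fun a => N a + 2) (fun=> erefl)).
  exact/polyboundD/polybound_cst.
- apply: (@ptime_var _ k.+2) => //= [|a s []//].
  apply: (@polybound_leq _ _ _ (fun x => ts (sval x).1)) => [[[a i] /= iN]|].
    by apply: tsP; apply: ltnW.
  exact: (@polybound_comp _ _ _ _ (fun x => (sval x).1) ts (fun=> erefl)).
exists q, (fun a => (measure a + 2) ^ d + (ts a + (2 * N a + 20))).
  apply: polyboundD; first by exists d.
  apply: polyboundD => //; apply: polyboundD; last exact: polybound_cst.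
  by apply: polyboundM => //; apply: polybound_cst.
move=> a i s iN Hs sk sk1 sk2.
have [c [s1 [qr s1k ss ct]]] := qP (exist _ (a, i) iN) s (And3 Hs sk1 sk2).
set s2 := update s1 k.+2 (eval s1 (EVar k.+3)).
exists (c + ((eval_cost s1 (EVar k.+3)).+1 + (eval_cost s2 (incr k)).+1).+1).+1.
have s2k1 : s2 k.+1 = enc_nat i.
  by rewrite /s2 /update ltn_eqF // ss //; lia.
have ev : eval s2 (incr k) = enc_nat i.+1.
  by rewrite /= s2k1 /num2 /= /enc_nat; congr DInt; lia.
exists (update s2 k.+1 (eval s2 (incr k))); split.
- by apply: RunSeq qr (RunSeq (s2 := s2) _ _); apply: RunAssign.
- by rewrite -ev {1}/update eqxx.
- rewrite {1}/update gtn_eqF // /s2 /update eqxx /= s1k //.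
- move=> j jk; rewrite {1}/update ltn_eqF ?ltnS // /s2 /update ltn_eqF ?ss //; lia.
- have ts' := tsP a i.+1 iN.
  have tc : t (exist _ (a, i) iN) <= (measure a + 2) ^ d := td (exist _ (a, i) iN).
  have -> : eval_cost s2 (incr k) =
    data_size (enc_nat i.+1) + (data_size (enc_nat i) + data_size (DInt 1)).
    by rewrite -ev /= s2k1 !addn0.
  have -> : eval_cost s1 (EVar k.+3) = data_size (st a i.+1) by rewrite /= s1k addn0.
  have := data_size_nat i.+1; have := data_size_nat i; have := data_size_nat 1.
  rewrite -[DInt 1]/(enc_nat 1); lia.
Qed.

(** A polynomial-time step alone would not do: repeated squaring doubles the length of its state
    each time. Hence the hypothesis that all states share a polynomial bound. It makes every
    iteration cost at most a fixed polynomial. *)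
Lemma ptime_iter : ptime (fun a => st a (N a)).
Proof.
have [ts tsp tsP] := bound_st.
split; first by apply: polybound_leq tsp => a; apply: tsP.
move=> k kC; have [q [t tp qP]] := loop_body kC.
have [_ /(_ k kC) [pN [tN tNp pNP]]] := ptimeN.
have [_ /(_ k.+2 (leqW (leqW kC))) [p0 [t0 t0p p0P]]] := ptime0.
pose w := While (guard k) (body k q).
pose cw a := 3 * N a + 20.
have cwp : polybound (@measure C) cw.
  by apply/polyboundD/polybound_cst/polyboundM => //; apply: polybound_cst.
exists (Seq pN (Seq (Assign k.+1 (ELit 0)) (Seq p0 (Seq w (Assign k (EVar k.+2)))))).
exists (fun a => tN a + (t0 a + (N a * (t a + cw a) + (cw a + (ts a + 10))))).
  by do !(apply: polyboundD => //); last exact: polybound_cst;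
     apply: polyboundM => //; apply: polyboundD.
move=> a s Hs.
have loc s1 s2 : holds a s1 -> (forall i, i < k -> s2 i = s1 i) -> holds a s2.
  by move=> Hs1 ss; apply: holds_local Hs1 => i iC; apply: ss; lia.
have guardP i s1 : i <= N a -> s1 k = enc_nat (N a) -> s1 k.+1 = enc_nat i ->
    eval s1 (guard k) = enc_nat (i < N a) /\ (eval_cost s1 (guard k)).+1 <= cw a.
  move=> iN s1k s1k1.
  have ev : eval s1 (guard k) = enc_nat (i < N a).
    by rewrite /= s1k s1k1 /num2 /=; congr DInt; case: ifP; lia.
  have ei : eval s1 (incr k) = enc_nat i.+1.
    by rewrite /= s1k1 /num2 /enc_nat /=; congr DInt; lia.
  split=> //; have -> : eval_cost s1 (guard k) = data_size (enc_nat (i < N a)) +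
    ((data_size (enc_nat i.+1) + (data_size (enc_nat i) + data_size (enc_nat 1)))
      + data_size (enc_nat (N a))) by rewrite -ev -ei /= s1k s1k1 !addn0.
  have := data_size_nat (i < N a); have := data_size_nat i.
  have := data_size_nat 1; have := data_size_nat (N a).
  by have := data_size_nat i.+1; rewrite /cw; lia.
have loop r : forall i s1, i + r = N a -> holds a s1 -> s1 k = enc_nat (N a) ->
    s1 k.+1 = enc_nat i -> s1 k.+2 = st a i -> exists c s2,
    [/\ run (oracle a) w s1 c s2, s2 k.+2 = st a (N a),
        forall i, i < k -> s2 i = s1 i & c <= r * (t a + cw a) + cw a].
  elim: r => [|r IHr] i s1 irN Hs1 s1k s1k1 s1k2.
    have [|ev cost] := guardP i s1 _ s1k s1k1; first lia.
    exists (eval_cost s1 (guard k)).+1, s1; split=> //.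
    - by apply: RunWhileEnd; rewrite ev -irN addn0 ltnn.
    - by rewrite s1k2; congr st; lia.
  have iN : i < N a by lia.
  have [ev cost] := guardP i s1 (ltnW iN) s1k s1k1.
  have [c [s2 [br s2k1 s2k2 ss ct]]] := qP a i s1 iN Hs1 s1k s1k1 s1k2.
  have [|||c' [s3 [wr s3k2 ss' ct']]] := IHr i.+1 s2 _ _ _ s2k1 s2k2; first by lia.
  - by apply: loc Hs1 _ => j jk; apply: ss; apply: ltnW.
  - by rewrite ss.
  exists (eval_cost s1 (guard k) + c + c').+1, s3; split=> //.
  - by apply: RunWhileLoop br wr; rewrite ev iN.
  - by move=> j jk; rewrite ss' // ss // ltnW.
  - by rewrite mulSn; lia.
have [cN [s1 [r1 s1k ss1 ct1]]] := pNP a s Hs.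
set s1' := update s1 k.+1 (DInt 0).
have H1' : holds a s1'.
  apply: loc Hs _ => i ik; rewrite /s1' /update ltn_eqF ?ss1 //; lia.
have [c0 [s2 [r2 s2k ss2 ct2]]] := p0P a s1' H1'.
have [|||c3 [s3 [r3 s3k ss3 ct3]]] := loop (N a) 0 s2 (add0n _) _ _ _ s2k.
- by apply: loc H1' _ => i ik; apply: ss2; lia.
- by rewrite ss2 // /s1' /update ltn_eqF.
- by rewrite ss2 // /s1' /update eqxx.
exists (cN + ((eval_cost s1 (ELit 0)).+1 + (c0 + (c3 + (eval_cost s3 (EVar k.+2)).+1).+1).+1).+1).+1.
exists (update s3 k (eval s3 (EVar k.+2))); split.
- by apply: RunSeq r1 (RunSeq _ (RunSeq r2 (RunSeq r3 _))); apply: RunAssign.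
- by rewrite /update eqxx.
- move=> i ik; rewrite /update ltn_eqF // ss3 // ss2; last lia.
  by rewrite /s1' /update ltn_eqF ?ss1 //; lia.
- by have := tsP a (N a) (leqnn _); rewrite /= s3k addn0 trunc_log0; lia.
Qed.

End Loop.

(** * Arithmetic and comparisons *)

Section Arithmetic.
Variable C : context.
Implicit Types x y : situation C -> int.

Lemma ptime_addz x y :
  @ptime C (fun a => DInt (x a)) -> @ptime C (fun a => DInt (y a)) ->
  @ptime C (fun a => DInt (x a + y a)%R).
Proof.
apply: (@ptime_op2 C EAdd (num2 (fun u v => u + v)%R)) => // a b; apply: data_size_num2 => u v.
lia.
Qed.

Lemma ptime_subz x y :
  @ptime C (fun a => DInt (x a)) -> @ptime C (fun a => DInt (y a)) ->
  @ptime C (fun a => DInt (x a - y a)%R).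
Proof. by apply: (@ptime_op2 C ESub (num2 (fun u v => u - v)%R)) => // a b; apply: data_size_num2; lia. Qed.

Lemma ptime_mulz x y :
  @ptime C (fun a => DInt (x a)) -> @ptime C (fun a => DInt (y a)) ->
  @ptime C (fun a => DInt (x a * y a)%R).
Proof.
by apply: (@ptime_op2 C EMul (num2 (fun u v => u * v)%R)) => // a b; apply: data_size_num2 => u v;
  rewrite abszM; nia.
Qed.

Lemma ptime_divz x y :
  @ptime C (fun a => DInt (x a)) -> @ptime C (fun a => DInt (y a)) ->
  @ptime C (fun a => DInt (x a %/ y a)%Z).
Proof.
apply: (@ptime_op2 C EDiv (num2 (fun u v => u %/ v)%Z)) => // a b; apply: data_size_num2 => u v.
by have := lez_div u v; nia.
Qed.

Lemma ptime_leqz x y :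
  @ptime C (fun a => DInt (x a)) -> @ptime C (fun a => DInt (y a)) ->
  @ptime C (fun a => enc_nat (x a <= y a)%R).
Proof.
move=> px py; pose F (a b : int) : int := if (a <= b)%R then 1%R else 0%R.
apply: (@eq_ptime _ (fun a => num2 F (DInt (x a)) (DInt (y a)))).
  by move=> a; rewrite /num2 /F /=; case: ifP.
apply: (@ptime_op2 C ELeq (num2 F) _ _ _ _ _ px py) => [s a b|s a b|a b].
- by [].
- by [].
- by rewrite /num2 /F; case: ifP => _ /=; rewrite ?trunc_log0 ?trunc_log1; lia.
Qed.

(** Adding the literal 0 performs the conversion, since arithmetic reads a pair as 0. *)
Lemma ptime_int_of_data f :
  @ptime C f -> @ptime C (fun a => DInt (int_of_data (f a))).
Proof.
move=> pf; apply: eq_ptime (ptime_op2 (e := EAdd) (F := num2 (fun a b => a + b)%R) _ _ _ pf (ptime_lit C 0)).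
- by move=> a; rewrite /num2 /= addr0.
- by [].
- by [].
- by move=> a b; apply: data_size_num2 => u v; lia.
Qed.

Lemma ptime_nat k : @ptime C (fun=> enc_nat k).
Proof. exact: ptime_lit. Qed.

Implicit Types i j : situation C -> nat.

Lemma ptime_addn i j :
  @ptime C (fun a => enc_nat (i a)) -> @ptime C (fun a => enc_nat (j a)) ->
  @ptime C (fun a => enc_nat (i a + j a)).
Proof. by move=> pi pj; apply: eq_ptime (ptime_addz pi pj) => a; rewrite -PoszD. Qed.

Lemma ptime_muln i j :
  @ptime C (fun a => enc_nat (i a)) -> @ptime C (fun a => enc_nat (j a)) ->
  @ptime C (fun a => enc_nat (i a * j a)).
Proof. by move=> pi pj; apply: eq_ptime (ptime_mulz pi pj) => a; rewrite -PoszM. Qed.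

Lemma ptime_leq i j :
  @ptime C (fun a => enc_nat (i a)) -> @ptime C (fun a => enc_nat (j a)) ->
  @ptime C (fun a => enc_nat (i a <= j a)).
Proof. by move=> pi pj; apply: eq_ptime (ptime_leqz pi pj) => a; rewrite lez_nat. Qed.

Lemma ptime_and (b c : situation C -> bool) :
  @ptime C (fun a => enc_nat (b a)) -> @ptime C (fun a => enc_nat (c a)) ->
  @ptime C (fun a => enc_nat (b a && c a)).
Proof.
by move=> pb pc; apply: eq_ptime (ptime_muln pb pc) => a; case: (b a); case: (c a).
Qed.

Lemma ptime_neg (b : situation C -> bool) :
  @ptime C (fun a => enc_nat (b a)) -> @ptime C (fun a => enc_nat (~~ b a)).
Proof.
by move=> pb; apply: eq_ptime (ptime_leq pb (ptime_nat 0)) => a; case: (b a).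
Qed.

Lemma ptime_eqz x y :
  @ptime C (fun a => DInt (x a)) -> @ptime C (fun a => DInt (y a)) ->
  @ptime C (fun a => enc_nat (x a == y a)).
Proof.
move=> px py; apply: eq_ptime (ptime_and (ptime_leqz px py) (ptime_leqz py px)).
by move=> a; rewrite -eq_le.
Qed.

Lemma ptime_maxz x y :
  @ptime C (fun a => DInt (x a)) -> @ptime C (fun a => DInt (y a)) ->
  @ptime C (fun a => DInt (Num.max (x a) (y a))).
Proof.
move=> px py; apply: eq_ptime (ptime_if (ptime_leqz px py) py px) => a.
by rewrite maxEle; case: ifP.
Qed.

End Arithmetic.

(** * Encoded sequences and tables *)

Lemma data_size_snd x : data_size (snd_data x) <= data_size x.
Proof. by case: x => //= x y; rewrite leqW // leq_addl. Qed.

Lemma enc_seq_size (s : seq data) t :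
  (forall x, List.In x s -> data_size x <= t) ->
  data_size (enc_seq s) <= size s * t.+1 + 2.
Proof.
elim: s => //= x s IH st; have := st x (or_introl erefl).
have := IH (fun y ys => st y (or_intror ys)); rewrite mulSn; lia.
Qed.

Lemma iter_snd_enc_seq (s : seq data) i :
  iter i snd_data (enc_seq s) = enc_seq (drop i s).
Proof.
elim: i s => [|i IH] s; first by rewrite drop0.
by rewrite iterSr; case: s => [|x s]; [apply: (IH [::]) | apply: IH].
Qed.

Lemma fst_enc_seq s : fst_data (enc_seq s) = head dnil s.
Proof. by case: s. Qed.

Definition data_nth (x : data) i := fst_data (iter i snd_data x).

Lemma data_nth_enc_seq s i : data_nth (enc_seq s) i = nth dnil s i.
Proof. by rewrite /data_nth iter_snd_enc_seq fst_enc_seq -nth0 nth_drop addn0. Qed.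

Lemma data_nth_enc_fun n (A : Type) (enc : A -> data) (f : 'I_n -> A) (i : 'I_n) :
  data_nth (enc_fun enc f) i = enc (f i).
Proof.
by rewrite data_nth_enc_seq (nth_map i) ?nth_ord_enum // size_enum_ord.
Qed.

(** The entry is reached by a loop of [i] steps, so the value of the index, and not only its length,
    must be polynomial. *)
Lemma ptime_data_nth C x i :
  @ptime C x -> @ptime C (fun a => enc_nat (i a)) -> polybound (@measure C) i ->
  @ptime C (fun a => data_nth (x a) (i a)).
Proof.
move=> px pi bi; apply: ptime_fst.
apply: (@ptime_iter C i (fun a k => iter k snd_data (x a))) => //.
- exists (fun a => data_size (x a)); first exact: ptime_size.
  move=> a k _; elim: k => //= k IH; exact: leq_trans (data_size_snd _) IH.
- by move=> C' h k _ _ _; apply: ptime_snd.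
Qed.

Lemma rev_ord_enum n : rev [seq rev_ord i | i <- enum 'I_n] = enum 'I_n.
Proof.
have [n0|n0] := posnP n.
  by subst n; rewrite (size0nil (size_enum_ord 0)).
apply: (@eq_from_nth _ (Ordinal n0)) => [|i]; rewrite size_rev size_map size_enum_ord // => iN.
apply: val_inj; rewrite nth_rev size_map size_enum_ord //.
rewrite (nth_map (Ordinal n0)) ?size_enum_ord /= ?nth_enum_ord; lia.
Qed.

(* Higher-order syntax for loop bodies: the body is computed in any context that
   refines [C] and provides an index. *)
Definition ptime_family (C : context) (n : situation C -> nat)
    (f : forall a, 'I_(n a) -> data) : Prop :=
  forall C' h (i : forall x, 'I_(n (h x))), @refines C' C h ->
    ptime (fun x => enc_ord (i x)) -> ptime (fun x => f (h x) (i x)).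

(** * Sums, products, quantifiers and tables over index ranges *)

Section Enumeration.
Variables (C : context) (n : situation C -> nat).
Hypotheses (pn : @ptime C (fun a => enc_nat (n a))) (bn : polybound (@measure C) n).

(** Instantiated in a loop context, whose situations are pairs of a situation and an index, the
    family has a size bound that is uniform in the index. *)
Lemma family_size f : @ptime_family C n f -> exists2 t, polybound (@measure C) t &
  forall a i, data_size (f a i) <= t a.
Proof.
move=> pf; pose C' := loop_context n (fun _ _ => dnil) (leqnn (height C)).
have := pf C' (fun x => (sval x).1) (fun x => Ordinal (svalP x)) (loop_refines _ _ _).
case=> [|[d dP] _].
  apply: (@ptime_var C' (height C).+1) => //= [|a s []//].
  apply: (@polybound_leq _ _ _ (fun x => n (sval x).1 + 2)) => [[[a i] /= iN]|].
    by apply: leq_trans (data_size_nat i) _; lia.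
  apply: (@polybound_comp _ _ _ _ (fun x => (sval x).1) (fun a => n a + 2) (fun=> erefl)).
  exact/polyboundD/polybound_cst.
exists (fun a => (measure a + 2) ^ d) => [|a i]; first by exists d.
have := dP (exist _ (a, val i) (ltn_ord i)); rewrite /= (_ : Ordinal _ = i) //.
exact: val_inj.
Qed.

Lemma ptime_enum (G : forall a, seq 'I_(n a) -> data) :
  ptime (fun a => G a [::]) ->
  (exists2 t, polybound (@measure C) t &
     forall a s, size s <= n a -> data_size (G a s) <= t a) ->
  (forall C' h (i : forall x, 'I_(n (h x))) (s : forall x, seq 'I_(n (h x))),
     @refines C' C h -> ptime (fun x => enc_ord (i x)) ->
     ptime (fun x => G (h x) (s x)) ->
     ptime (fun x => G (h x) (rcons (s x) (i x)))) ->
  ptime (fun a => G a (enum 'I_(n a))).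
Proof.
move=> p0 [t tp tP] pS.
apply: (@eq_ptime _ (fun a => G a (take (n a) (enum 'I_(n a))))).
  by move=> a; rewrite take_oversize // size_enum_ord.
apply: (@ptime_iter C n (fun a i => G a (take i (enum 'I_(n a))))) => //.
- by apply: eq_ptime p0 => a; rewrite take0.
- by exists t => // a i ia; apply: tP; rewrite size_take_min size_enum_ord geq_minr.
move=> C' h i hC ilt pi pG.
pose j x := Ordinal (ilt x).
apply: eq_ptime (pS C' h j (fun x => take (i x) (enum 'I_(n (h x)))) hC pi pG) => x.
rewrite (take_nth (j x)) ?size_enum_ord //; congr (G _ (rcons _ _)).
exact/esym/(nth_ord_enum (j x) (j x)).
Qed.

Lemma abs_lt_data_size z : `|z|%N < 2 ^ data_size (DInt z).
Proof. exact: (abs_int_of_data (DInt z)). Qed.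

Lemma ptime_sumz (F : forall a, 'I_(n a) -> int) :
  @ptime_family C n (fun a i => DInt (F a i)) ->
  @ptime C (fun a => DInt (\sum_(i < n a) F a i)%R).
Proof.
move=> pF; have [t tp tP] := family_size pF.
apply: (@eq_ptime _ (fun a => DInt (\sum_(i <- enum 'I_(n a)) F a i)%R)) => [a|].
  by rewrite big_enum.
apply: (@ptime_enum (fun a s => DInt (\sum_(i <- s) F a i)%R)).
- by apply: eq_ptime (ptime_lit C 0) => a; rewrite big_nil.
- exists (fun a => n a + t a + 2).
    by do !(apply: polyboundD => //); apply: polybound_cst.
  move=> a s sn; rewrite addn2; apply: data_size_DInt.
  apply: (@leq_ltn_trans (size s * 2 ^ t a)); last first.
    rewrite expnD ltn_pmul2r ?expn_gt0 //.
    by apply: leq_ltn_trans sn _; apply: ltn_expl.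
  elim: s {sn} => [|i s IH]; first by rewrite big_nil.
  rewrite big_cons /= mulSn; have := abs_lt_data_size (F a i).
  have : 2 ^ data_size (DInt (F a i)) <= 2 ^ t a by rewrite leq_exp2l.
  set p := 2 ^ data_size _; set q := 2 ^ t a in IH *; set r := size s * q in IH *.
  by set y := (\sum_(j <- s) _)%R in IH *; lia.
- move=> C' h i s hC pi pG.
  apply: eq_ptime (ptime_addz pG (pF C' h i hC pi)) => x.
  by rewrite big_rcons.
Qed.

(** Lengths of factors add up, so common denominators formed by multiplying all denominators stay of
    polynomial length. *)
Lemma ptime_prodz (F : forall a, 'I_(n a) -> int) :
  @ptime_family C n (fun a i => DInt (F a i)) ->
  @ptime C (fun a => DInt (\prod_(i < n a) F a i)%R).
Proof.
move=> pF; have [t tp tP] := family_size pF.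
apply: (@eq_ptime _ (fun a => DInt (\prod_(i <- enum 'I_(n a)) F a i)%R)) => [a|].
  by rewrite big_enum.
apply: (@ptime_enum (fun a s => DInt (\prod_(i <- s) F a i)%R)).
- by apply: eq_ptime (ptime_lit C 1) => a; rewrite big_nil.
- exists (fun a => n a * t a + 1 + 2).
    by do !(apply: polyboundD); try exact: polybound_cst; apply: polyboundM.
  move=> a s sn; rewrite addn2; apply: data_size_DInt.
  apply: (@leq_ltn_trans (2 ^ (size s * t a))); last first.
    by rewrite ltn_exp2l // addn1 ltnS leq_mul2r sn orbT.
  elim: s {sn} => [|i s IH]; first by rewrite big_nil.
  rewrite big_cons /= mulSn expnD abszM leq_mul //.
  by apply: leq_trans (ltnW (abs_lt_data_size _)) _; rewrite leq_exp2l.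
- move=> C' h i s hC pi pG.
  apply: eq_ptime (ptime_mulz pG (pF C' h i hC pi)) => x.
  by rewrite big_rcons.
Qed.

Lemma ptime_sumn (F : forall a, 'I_(n a) -> nat) :
  @ptime_family C n (fun a i => enc_nat (F a i)) ->
  @ptime C (fun a => enc_nat (\sum_(i < n a) F a i)).
Proof. by move=> /ptime_sumz; apply: eq_ptime => a; rewrite /enc_nat (big_morph Posz PoszD (erefl _)). Qed.

Lemma ptime_exists (P : forall a, pred 'I_(n a)) :
  @ptime_family C n (fun a i => enc_nat (P a i)) ->
  @ptime C (fun a => enc_nat [exists i, P a i]).
Proof.
move=> pP; apply: eq_ptime (ptime_leq (ptime_nat C 1) (ptime_sumn pP)) => a.
congr (enc_nat (nat_of_bool _)); rewrite lt0n sum_nat_eq0 negb_forall.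
by apply: eq_existsb => i; rewrite /= eqb0 negbK.
Qed.

Lemma ptime_forall (P : forall a, pred 'I_(n a)) :
  @ptime_family C n (fun a i => enc_nat (P a i)) ->
  @ptime C (fun a => enc_nat [forall i, P a i]).
Proof.
move=> pP; have pN : @ptime_family C n (fun a i => enc_nat (~~ P a i)).
  by move=> C' h i hC pi; apply/ptime_neg/pP.
apply: eq_ptime (ptime_neg (@ptime_exists (fun a i => ~~ P a i) pN)) => a.
by rewrite negb_exists; congr (enc_nat (nat_of_bool _)); apply: eq_forallb => i; rewrite negbK.
Qed.

(** Entries can only be put in front of a list, so the table is built from its last entry; [rev_ord]
    turns the increasing loop index into a decreasing one. *)
Lemma ptime_enc_fun (A : situation C -> Type) (enc : forall a, A a -> data)
    (f : forall a, 'I_(n a) -> A a) :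
  @ptime_family C n (fun a i => enc a (f a i)) ->
  @ptime C (fun a => enc_fun (enc a) (f a)).
Proof.
move=> pF; have [t tp tP] := family_size pF.
pose G a (s : seq 'I_(n a)) := enc_seq (rev [seq enc a (f a (rev_ord i)) | i <- s]).
apply: (@eq_ptime _ (fun a => G a (enum 'I_(n a)))) => [a|].
  rewrite /G /enc_fun; congr enc_seq.
  by rewrite (map_comp (fun i => enc a (f a i)) (@rev_ord (n a))) -map_rev rev_ord_enum.
apply: (@ptime_enum G).
- exact: ptime_lit.
- exists (fun a => n a * (t a + 1) + 2).
    by apply: polyboundD; last exact: polybound_cst; apply: polyboundM => //;
       apply/polyboundD/polybound_cst.
  move=> a s sn; apply: leq_trans (@enc_seq_size _ (t a) _) _.
    move=> x; rewrite -map_rev; elim: (rev s) => //= i r IH [<-|/IH//]; exact: tP.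
  by rewrite size_rev size_map leq_add2r addn1 leq_mul2r sn orbT.
- move=> C' h i s hC pi pG.
  apply: eq_ptime (ptime_pair (pF C' h (fun x => rev_ord (i x)) hC _) pG) => [x|].
    by rewrite /G map_rcons rev_rcons.
  apply: eq_ptime (ptime_subz (ptime_refines hC pn) (ptime_addn pi (ptime_nat C' 1))) => x.
  by rewrite /enc_ord /enc_nat /=; congr DInt; have := ltn_ord (i x); lia.
Qed.

Lemma ptime_enc_fun_app (A : situation C -> Type) (enc : forall a, A a -> data)
    (f : forall a, 'I_(n a) -> A a) (i : forall a, 'I_(n a)) :
  @ptime C (fun a => enc_fun (enc a) (f a)) -> @ptime C (fun a => enc_ord (i a)) ->
  @ptime C (fun a => enc a (f a (i a))).
Proof.
move=> pf pi; apply: eq_ptime (ptime_data_nth pf pi _) => [a|].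
  exact: data_nth_enc_fun.
by apply: polybound_leq bn => a; apply: ltnW.
Qed.

End Enumeration.

Local Open Scope ring_scope.

(** * The algorithm *)

Section Algorithm.
Variables (n m L T : nat) (I : instance n m L T) (O : data -> data).

(* Stationarity allows reading the rates in the first period; they are 0 if there
   is none. *)
Definition rate (j : 'I_m) : rat :=
  if (insub 0%N : option 'I_T) is Some t then arrival I j t else 0.

Definition common_den : int :=
  \prod_(i < n) \prod_(j < m) \prod_(l < L) denq (profit I i j l).

Definition int_profit i j l : int :=
  numq (profit I i j l) * (common_den %/ denq (profit I i j l))%Z.

(* [(0, None)] is the virtual warehouse, with its value. *)
Definition source (val : 'I_L -> int) : int * option 'I_L :=
  foldl (fun s l => if s.1 < val l then (val l, Some l) else s) (0, None)
    (enum 'I_L).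

Definition prices : Type := ('I_L -> int) * ('I_n -> int).

(** A unit is priced by its warehouse and by its product. The integers [v] and [p] stand for the
    price scale [p / v], which keeps the rewards sent to the oracle integral. *)
Definition net (v p : int) (q : prices) j i l : int :=
  v * int_profit i j l - p * (q.1 l + q.2 i).

Definition reward v p q j i : int := (source (net v p q j i)).1.

Definition query (j : 'I_m) (rho : 'I_n -> int) : data :=
  enc_seq [:: enc_nat 1; enc_ord j; enc_fun enc_rat (fun i => (rho i)%:~R)].

(** Several assortments may be optimal; this names the one that the oracle returns, as the optimal
    set whose encoding is its answer. *)
Definition best j (rho : 'I_n -> int) : {set 'I_n} :=
  xget finset.set0 [set S : {set 'I_n} |
    (forall S', assortment_reward I j (fun i => (rho i)%:~R) S' <=
                assortment_reward I j (fun i => (rho i)%:~R) S) /\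
    O (query j rho) = enc_set S]%classic.

Definition offer v p q j : decision n L :=
  (best j (reward v p q j), [ffun i => (source (net v p q j i)).2]).

Definition price0 : prices := (fun=> 0, fun=> 0).
Definition reward0 := reward 1 0 price0.
Definition base j : {set 'I_n} := best j (reward0 j).

(* [base_num / base_den] is the largest expected profit of one period when stocks
   are ignored, in units of [1 / common_den]; it sets the scale of the prices. *)
Definition base_den : int :=
  \prod_(j < m) (denq (rate j) * \prod_(i < n) denq (choice_prob I i j (base j))).

Definition base_num : int :=
  \sum_(j < m) \sum_(i < n)
    numq (rate j) * numq (choice_prob I i j (base j)) * reward0 j i *
    (base_den %/ (denq (rate j) * denq (choice_prob I i j (base j))))%Z.

(** It says [g <= sqrt (K / n)] for every capacity and [g <= sqrt (C / L)] for every finite supply,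
    that is, [g <= 1 / eps]. Reserving [g] units per product and warehouse then uses at most a
    fraction [eps] of each of them. *)
Definition roomy (g : nat) : bool :=
  [forall l, n * (g * g) <= capacity I l]%N &&
  [forall i, if supply I i is Some C then L * (g * g) <= C else true]%N.

Fixpoint largest_roomy (k : nat) : nat :=
  if k is k'.+1 then if roomy k then k else largest_roomy k' else 0.

(** The search stops at [T + 1]: this value makes all reduced capacities at least
    [n (T + 1)^2 - n (T + 1) >= T], and likewise for supplies, so that no queue ever grows. *)
Definition stock : nat := largest_roomy T.+1.

Definition warehouse_cap l : int := (capacity I l)%:Z - (n * stock)%:Z.
(** An unlimited supply counts as [T], which no expected load exceeds, so the queue of such a
    product stays at 0. *)
Definition product_cap i : int :=
  if supply I i is Some C then C%:Z - (L * stock)%:Z else T%:Z.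

(* Loads are rounded to multiples of [1 / grid]; [sqwidth] bounds the growth per
   round of the sum of the squared queues, [weight] makes the resulting loss of
   profit at most [1 / (4 (T + 1))] of the optimum, and [rounds] exceeds
   [4 (2 weight T + sqwidth)] so that the final queues, divided by [rounds], stay
   below [1 / 2]. *)
Definition sqwidth : nat := (n + L) * (T * T).
Definition weight : nat := 2 * T.+1 * sqwidth + 1.
Definition grid : nat := 2 * m.+1 * (n + L).
Definition rounds : nat := 8 * weight * T + 4 * sqwidth + 1.

Definition load (d : 'I_m -> decision n L) i l : int :=
  \sum_(j < m) if (d j).2 i == Some l then
    ((grid * T)%:Z * (numq (rate j) * numq (choice_prob I i j (d j).1)) %/
     (denq (rate j) * denq (choice_prob I i j (d j).1)))%Z
  else 0.

(** If [base_num] is 0, the optimum is 0 and any positive scale will do. *)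
Definition price_den : int := if base_num == 0 then 1 else base_num.

Definition plan (q : prices) : 'I_m -> decision n L :=
  offer ((grid * weight)%:Z * base_den) price_den q.

Definition step (q : prices) : prices :=
  (fun l => Num.max 0
     (q.1 l + (\sum_(i < n) load (plan q) i l - grid%:Z * warehouse_cap l)),
   fun i => Num.max 0
     (q.2 i + (\sum_(l < L) load (plan q) i l - grid%:Z * product_cap i))).

Definition queue (k : nat) : prices := iter k step price0.

(** The term [m * rounds] makes up for the rounding of the loads, which costs at most [m] grid units
    per round, so the quotient falls short of the true average load by at most 1. *)
Definition stocking : placement n L := fun i l =>
  (`|(((m * rounds)%:Z + \sum_(k < rounds) load (plan (queue k)) i l) %/
      (rounds * grid)%:Z)%Z| + stock)%N.

Definition sells i l (e : event n m L) : bool :=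
  if e is Some (_, d, Some i') then (i' == i) && (d.2 i == Some l) else false.

Definition sold (h : history n m L) i l : nat := count (sells i l) h.

Definition in_stock (c : placement n L) h i (w : option 'I_L) : option 'I_L :=
  if [exists l, (w == Some l) && (sold h i l < c i l)%N] then w else None.

Definition restrict (c : placement n L) h (d : decision n L) : decision n L :=
  (d.1, [ffun i => in_stock c h i (d.2 i)]).

(** A fresh round is drawn at every arrival. The probability that a pair is demanded is therefore
    the average over the rounds, whatever happened before. *)
Definition decide_rule (h : history n m L) (j : 'I_m) (u : nat) : decision n L :=
  restrict stocking h (plan (queue u) j).

End Algorithm.

(** * The value of policies *)

Lemma serveE n m L (x : placement n L) (e : event n m L) i l :
  serve x e i l = (x i l - sells i l e)%N.
Proof.
case: e => [[[j d] [i0|]]|] //=; rewrite ?subn0 //.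
have [->|ne] := eqVneq i0 i.
  case: (d.2 i) => [l0|]; rewrite ?eqxx ?subn0 //=.
  by rewrite (inj_eq Some_inj) eq_sym.
case: (d.2 i0) => [l0|]; rewrite ?subn0 //.
by rewrite eq_sym (negPf ne) subn0.
Qed.

Lemma inventoryE n m L (c : placement n L) (h : history n m L) i l :
  inventory c h i l = (c i l - sold h i l)%N.
Proof.
elim/last_ind: h => [|h e IH]; first by rewrite subn0.
rewrite /inventory foldl_rcons serveE -/(inventory c h) IH /sold.
by rewrite -cats1 count_cat /= addn0 subnDA.
Qed.

Lemma inventory_rcons n m L (c : placement n L) (h : history n m L) e i l :
  inventory c (rcons h e) i l = (inventory c h i l - sells i l e)%N.
Proof. by rewrite /inventory foldl_rcons serveE. Qed.

Definition price_at (R : realType) n L (p : 'I_n -> 'I_L -> R) i (w : option 'I_L) : R :=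
  if w is Some l then p i l else 0.

(** The supremum of the empty set is 0, hence the condition [0 <= b]. *)
Lemma sup_le0 (R : realType) (A : set R) b :
  0 <= b -> (forall x, A x -> x <= b) -> sup A <= b.
Proof.
move=> b0 Ab; have [->|/set0P A0] := eqVneq A set0; first by rewrite sup0.
exact: ge_sup.
Qed.

Section Policies.
Variables (R : realType) (n m L T : nat) (I : instance n m L T).
Hypothesis Iv : valid I.
Local Notation lam j t := (ratr (arrival I j t) : R).
Local Notation phi := (purchase_prob R I).
Local Notation profit_at := (served_profit R I).

Lemma lam_ge0 j t : 0 <= lam j t.
Proof. by case: Iv => _ [l0 _] _ _; rewrite ler0q. Qed.

Lemma sum_lam_le1 t : \sum_j lam j t <= 1.
Proof.
by case: Iv => _ [_ l1] _ _; rewrite -raddf_sum -[leRHS](rmorph1 (@ratr R)) ler_rat.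
Qed.

Lemma phi_ge0 j S i : 0 <= phi j S i.
Proof. by case: Iv => _ _ [p0 _ _ _] _; rewrite ler0q. Qed.

Lemma phi_notin j (S : {set 'I_n}) i : i \notin S -> phi j S i = 0.
Proof. by case: Iv => _ _ [_ _ pS _] _ /pS; rewrite /phi => ->; rewrite rmorph0. Qed.

Lemma sum_phi_in j (S : {set 'I_n}) (F : 'I_n -> R) :
  \sum_(i in S) phi j S i * F i = \sum_i phi j S i * F i.
Proof.
rewrite [RHS](bigID (mem S)) /= [X in _ = _ + X]big1 ?addr0 // => i iS.
by rewrite phi_notin ?mul0r.
Qed.

Lemma sum_phi_le1 j S : \sum_i phi j S i <= 1.
Proof.
by case: Iv => _ _ [_ p1 _ _] _; rewrite -raddf_sum -[leRHS](rmorph1 (@ratr R)) ler_rat.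
Qed.

Lemma sum_phi_in_le1 j (S : {set 'I_n}) : \sum_(i in S) phi j S i <= 1.
Proof.
have := sum_phi_in j S (fun=> 1); under eq_bigr do rewrite mulr1; move=> ->.
by under eq_bigr do rewrite mulr1; apply: sum_phi_le1.
Qed.

(* Weak duality: with prices [p] on the stock, each unit of stock is worth at
   most its price, and each period brings at most the net profit [g]. *)
Lemma expected_profit_le (c : placement n L) (pi : policy R n m L)
    (p : 'I_n -> 'I_L -> R) (g : 'I_m -> R) (ts : seq 'I_T) h :
  (forall i l, 0 <= p i l) -> (forall j, 0 <= g j) ->
  (forall j (d : decision n L),
    \sum_(i in d.1) phi j d.1 i * (profit_at i j (d.2 i) - price_at p i (d.2 i)) <= g j) ->
  is_policy T c pi -> (size h + size ts <= T)%N ->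
  expected_profit I pi ts h <=
    \sum_i \sum_l p i l * (inventory c h i l)%:R + \sum_(t <- ts) \sum_j lam j t * g j.
Proof.
move=> p0 g0 gP piP; elim: ts h => [|t ts IH] h hT /=.
  by rewrite big_nil addr0; do 2![apply: sumr_ge0 => ? _]; rewrite mulr_ge0.
rewrite big_cons; set P := \sum_i \sum_l p i l * _; set G := \sum_(t' <- ts) _.
have {}IH e : expected_profit I pi ts (rcons h e) <=
    \sum_i \sum_l p i l * (inventory c (rcons h e) i l)%:R + G.
  by apply: IH; rewrite size_rcons addSnnS.
have nextP e : expected_profit I pi ts (rcons h e) <= P + G.
  apply: le_trans (IH e) _; rewrite lerD2r /P. do 2![apply: ler_sum => ? _].
  by rewrite ler_wpM2l // ler_nat inventory_rcons leq_subr.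
(* A sale lowers the value of the stock by the price; admissibility makes the truncated subtraction
   exact. *)
have nextS j (d : decision n L) i : i \in d.1 -> admissible (inventory c h) d ->
    expected_profit I pi ts (rcons h (Some (j, d, Some i))) <=
    P - price_at p i (d.2 i) + G.
  move=> iS ad; case dE : (d.2 i) => [l|] /=; last by rewrite subr0.
  apply: le_trans (IH _) _; rewrite lerD2r /P.
  rewrite (bigD1 i) // (bigD1 l) // [in leRHS](bigD1 i) // [in leRHS](bigD1 l) //=.
  rewrite inventory_rcons /= eqxx dE eqxx /= natrB ?ad //.
  set A := \sum_(l' | _) _; set B := \sum_(i' | _) _.
  set A' := \sum_(l' | _) _; set B' := \sum_(i' | _) _.
  have -> : A = A'.
    apply: eq_bigr => l' l'l; rewrite inventory_rcons /= eqxx dE.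
    by rewrite (inj_eq Some_inj) eq_sym (negPf l'l) subn0.
  have -> : B = B'.
    apply: eq_bigr => i' i'i; apply: eq_bigr => l' _; rewrite inventory_rcons /=.
    by rewrite eq_sym (negPf i'i) subn0.
  by lra.
have [pi0 pi1 piA] : [/\ forall j d, 0 <= pi h j d, forall j, \sum_d pi h j d = 1
    & forall j d, 0 < pi h j d -> admissible (inventory c h) d].
  have hT' : (size h < T)%N by rewrite /= in hT; lia.
  by split=> j; have [] := piP h j hT'.
have inner j (d : decision n L) : admissible (inventory c h) d ->
    \sum_(i in d.1) phi j d.1 i * (profit_at i j (d.2 i) +
      expected_profit I pi ts (rcons h (Some (j, d, Some i)))) +
    (1 - \sum_(i in d.1) phi j d.1 i) *
      expected_profit I pi ts (rcons h (Some (j, d, None))) <= g j + P + G.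
  move=> ad; set s := \sum_(i in d.1) phi j d.1 i.
  have s1 : s <= 1 := sum_phi_in_le1 j d.1.
  have /(ler_wpM2l (x := 1 - s)) : 0 <= 1 - s by rewrite subr_ge0.
  move=> /(_ _ _ (nextP (Some (j, d, None)))) hN.
  have hS : \sum_(i in d.1) phi j d.1 i * (profit_at i j (d.2 i) +
      expected_profit I pi ts (rcons h (Some (j, d, Some i)))) <=
    \sum_(i in d.1) (phi j d.1 i * (profit_at i j (d.2 i) - price_at p i (d.2 i))
                     + phi j d.1 i * (P + G)).
    apply: ler_sum => i iS; rewrite -mulrDr; apply: ler_wpM2l; first exact: phi_ge0.
    by have := nextS j d i iS ad; lra.
  rewrite big_split /= -mulr_suml -/s in hS.
  by have := gP j d; lra.
have outer j : \sum_d pi h j d * (\sum_(i in d.1) phi j d.1 i * (profit_at i j (d.2 i) +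
      expected_profit I pi ts (rcons h (Some (j, d, Some i)))) +
    (1 - \sum_(i in d.1) phi j d.1 i) *
      expected_profit I pi ts (rcons h (Some (j, d, None)))) <= g j + P + G.
  rewrite -[leRHS]mul1r.
  have -> : 1 * (g j + P + G) = \sum_d pi h j d * (g j + P + G).
    by rewrite -mulr_suml pi1.
  apply: ler_sum => d _.
  (* Only decisions of positive probability are known to be admissible; the others contribute 0. *)
  have := pi0 j d; rewrite le_eqVlt => /orP[/eqP<-|pid]; first by rewrite !mul0r.
  by apply: ler_wpM2l; [apply: ltW | apply/inner/(piA j)].
set s := \sum_j lam j t; have s1 : s <= 1 := sum_lam_le1 t.
have /(ler_wpM2l (x := 1 - s)) : 0 <= 1 - s by rewrite subr_ge0.
move=> /(_ _ _ (nextP None)) hN.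
have hS : \sum_j lam j t * (\sum_d pi h j d *
    (\sum_(i in d.1) phi j d.1 i * (profit_at i j (d.2 i) +
      expected_profit I pi ts (rcons h (Some (j, d, Some i)))) +
    (1 - \sum_(i in d.1) phi j d.1 i) *
      expected_profit I pi ts (rcons h (Some (j, d, None))))) <=
   \sum_j (lam j t * g j + lam j t * (P + G)).
  apply: ler_sum => j _; rewrite -mulrDr addrA ler_wpM2l ?lam_ge0 //.
rewrite big_split /= -mulr_suml -/s in hS.
apply: le_trans (lerD hS hN) _; lra.
Qed.

Lemma OPT_le (p : 'I_n -> 'I_L -> R) (g : 'I_m -> R) (b : R) :
  (forall i l, 0 <= p i l) -> (forall j, 0 <= g j) ->
  (forall j (d : decision n L),
    \sum_(i in d.1) phi j d.1 i * (profit_at i j (d.2 i) - price_at p i (d.2 i)) <= g j) ->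
  0 <= b ->
  (forall c, feasible I c -> \sum_i \sum_l p i l * (c i l)%:R +
     \sum_(t <- enum 'I_T) \sum_j lam j t * g j <= b) ->
  OPT R I <= b.
Proof.
move=> p0 g0 gP b0 cb; apply: sup_le0 => // _ [c cf ->].
apply: sup_le0 => // _ [pi piP ->]; apply: le_trans (cb c cf).
by apply: (expected_profit_le (h := [::]) p0 g0 gP piP); rewrite size_enum_ord.
Qed.

End Policies.

(** * Sampled policies with stocks *)

(** The dummy product in ['I_1] lets [price_at] read a value at an optional warehouse. *)
Lemma sum_eq_Some (R : realType) L (w : option 'I_L) (F : 'I_L -> R) :
  \sum_l (if w == Some l then F l else 0) = price_at (fun (_ : 'I_1) l => F l) ord0 w.
Proof.
case: w => [l0|] /=; last by rewrite big1.
rewrite (bigD1 l0) //= eqxx big1 ?addr0 // => l ne.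
by rewrite (inj_eq Some_inj) eq_sym (negPf ne).
Qed.

(* The value of [x] units of a good when, in each of [k] periods, one unit is
   demanded with probability [p], for an expected income [r]. *)
Fixpoint stock_value (R : realType) (p r : R) (x k : nat) : R :=
  if k is k'.+1 then
    if x is x'.+1 then
      r + p * stock_value p r x' k' + (1 - p) * stock_value p r x k'
    else 0
  else 0.

Section StockValue.
Variables (R : realType) (p r : R).

Lemma stock_value0 k : stock_value p r 0 k = 0.
Proof. by case: k. Qed.

Lemma stock_valueS x k :
  stock_value p r x k.+1 = stock_value p r x k +
    (if (0 < x)%N then r + p * (stock_value p r x.-1 k - stock_value p r x k) else 0).
Proof. by case: x => [|x] /=; rewrite ?stock_value0 ?addr0 //; ring. Qed.

Lemma stock_value_ample x k : (k <= x)%N -> stock_value p r x k = k%:R * r.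
Proof.
elim: k x => [|k IH] x; first by rewrite mul0r.
case: x => //= x; rewrite ltnS => kx; rewrite !IH ?leqW // -natr1; ring.
Qed.

(* [E (D - x)^+ <= E (D - x + de)^2 / (4 de)] for a binomial demand [D]. *)
Lemma stock_value_ge rho de x k : 0 <= p <= 1 -> r = rho * p -> 0 <= rho -> 0 < de ->
  rho * (k%:R * p - (k%:R * p * (1 - p) + (k%:R * p - x%:R + de) ^+ 2) / (4 * de))
    <= stock_value p r x k.
Proof.
move=> /andP[p0 p1] -> rho0 de0; elim: k x => [|k IH] x /=.
  rewrite !mul0r !add0r mulr_ge0_le0 // oppr_le0 divr_ge0 ?sqr_ge0 //; lra.
case: x => [|x].
  rewrite mulr_ge0_le0 // subr_le0 ler_pdivlMr; last lra.
  have k0 : 0 <= k.+1%:R * p by rewrite mulr_ge0.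
  (* For an empty stock the bound is at most 0 by [(a + b)^2 >= 4 a b], with [a] the mean demand and
     [b = de]. *)
  have := sqr_ge0 (k.+1%:R * p - de); have : 0 <= k.+1%:R * p * (1 - p).
    by rewrite mulr_ge0 // subr_ge0.
  by rewrite !expr2; nra.
have h1 := ler_wpM2l p0 (IH x); have p1' : 0 <= 1 - p by rewrite subr_ge0.
have h2 := ler_wpM2l p1' (IH x.+1).
(* With stock left, the bound satisfies the recursion with equality: the variance of the demand
   grows by [p (1 - p)]. *)
apply: le_trans (lerD (lerD (lexx (rho * p)) h1) h2); rewrite le_eqVlt; apply/orP; left.
apply/eqP; rewrite -!natr1; field; lra.
Qed.

End StockValue.

Section SampledPolicy.
Variables (R : realType) (n m L T : nat) (I : instance n m L T).
Hypothesis Iv : valid I.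
Variables (lam : 'I_m -> R) (N : nat) (plans : nat -> 'I_m -> decision n L).
Variable (c : placement n L).
Hypothesis lamE : forall j t, ratr (arrival I j t) = lam j.
Hypothesis N0 : (0 < N)%N.
Local Notation phi := (purchase_prob R I).
Local Notation profit_at := (served_profit R I).

Definition plan_policy : policy R n m L :=
  sampled_policy R (fun _ _ => N) (fun h j u => restrict c h (plans u j)).

Lemma plan_policyE h j (F : decision n L -> R) :
  \sum_d plan_policy h j d * F d =
  (\sum_(u < N) F (restrict c h (plans u j))) / N%:R.
Proof.
transitivity (\sum_d \sum_(u < N) (restrict c h (plans u j) == d)%:R * F d / N%:R).
  by apply: eq_bigr => d _; rewrite -mulr_suml -mulr_suml -natr_sum mulrAC.
rewrite exchange_big mulr_suml; apply: eq_bigr => u _.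
rewrite (bigD1 (restrict c h (plans u j))) //= eqxx mul1r big1 ?addr0 // => d.
by rewrite eq_sym => /negPf ->; rewrite !mul0r.
Qed.

Lemma in_stockP (h : history n m L) i w l :
  in_stock c h i w = Some l -> (0 < inventory c h i l)%N.
Proof.
rewrite /in_stock; case: ifP => // /existsP[l' /andP[/eqP -> ltc]] [<-].
by rewrite inventoryE subn_gt0.
Qed.

Lemma plan_policyP : is_policy T c plan_policy.
Proof.
move=> h j _; split=> [d||d].
- by rewrite divr_ge0.
- have := plan_policyE h j (fun=> 1); under eq_bigr do rewrite mulr1.
  by move=> ->; rewrite big_const_ord iter_addr_0 divff ?pnatr_eq0 -?lt0n.
- rewrite /plan_policy /sampled_policy => pd.
  have : (0 < \sum_(u < N) (restrict c h (plans u j) == d))%N.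
    by rewrite lt0n; apply: contraTneq pd => ->; rewrite mul0r ltxx.
  rewrite lt0n sum_nat_eq0 negb_forall => /existsP[u].
  rewrite eqb0 negbK => /eqP <- i l _ /=; rewrite ffunE; exact: in_stockP.
Qed.

Definition demand i l : R :=
  (\sum_j lam j * \sum_(u < N)
     if (plans u j).2 i == Some l then phi j (plans u j).1 i else 0) / N%:R.

Definition income i l : R :=
  (\sum_j lam j * \sum_(u < N)
     if (plans u j).2 i == Some l then
       phi j (plans u j).1 i * ratr (profit I i j l) else 0) / N%:R.

(** Stocks of different pairs are correlated, as a customer buys at most one unit. But a sold-out
    product goes to the virtual warehouse without changing the assortment, so the sales of a pair
    depend on no stock but its own, and by linearity of expectation the pairs may be evaluated
    separately. *)
Lemma expected_profit_plan (ts : seq 'I_T) h :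
  expected_profit I plan_policy ts h =
  \sum_i \sum_l stock_value (demand i l) (income i l) (inventory c h i l) (size ts).
Proof.
elim: ts h => [|t ts IH] h.
  by rewrite /= big1 // => i _; rewrite big1.
rewrite [LHS]/= [size _]/=; set k := size ts in IH *.
pose V i l x := stock_value (demand i l) (income i l) x k.
set x := inventory c h.
pose P := \sum_i \sum_l V i l (x i l).
(* This is the change of the later value when one unit is taken. It is 0 at an empty stock, in
   agreement with the truncated inventory. *)
pose D i l := V i l (x i l).-1 - V i l (x i l).
have nextN e : (forall i l, sells i l e = false) -> expected_profit I plan_policy ts (rcons h e) = P.
  move=> se; rewrite IH; do 2![apply: eq_bigr => ? _].
  by rewrite inventory_rcons se subn0.
have nextS j d i : expected_profit I plan_policy ts (rcons h (Some (j, d, Some i))) =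
    P + price_at D i (d.2 i).
  case dE : (d.2 i) => [l|] /=.
    rewrite IH /P (bigD1 i) // (bigD1 l) // [in RHS](bigD1 i) // [in RHS](bigD1 l) //=.
    rewrite inventory_rcons /= eqxx dE eqxx /= subn1.
    rewrite [X in _ + X + _ = _](eq_bigr (fun l' => V i l' (x i l'))); last first.
      move=> l' l'l; rewrite inventory_rcons /= eqxx dE (inj_eq Some_inj).
      by rewrite eq_sym (negPf l'l) subn0.
    rewrite [X in _ + X = _](eq_bigr (fun i' => \sum_l V i' l (x i' l))); last first.
      move=> i' i'i; apply: eq_bigr => l' _; rewrite inventory_rcons /=.
      by rewrite eq_sym (negPf i'i) subn0.
    by rewrite /D /V; lra.
  rewrite IH addr0; do 2![apply: eq_bigr => ? _].
  rewrite inventory_rcons /=; case: eqP => [<-|_]; by rewrite ?dE subn0.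
have inner j (d : decision n L) : \sum_(i in d.1) phi j d.1 i * (profit_at i j (d.2 i) +
      expected_profit I plan_policy ts (rcons h (Some (j, d, Some i)))) +
    (1 - \sum_(i in d.1) phi j d.1 i) *
      expected_profit I plan_policy ts (rcons h (Some (j, d, None))) =
    P + \sum_i phi j d.1 i * (profit_at i j (d.2 i) + price_at D i (d.2 i)).
  rewrite [in LHS]nextN // -(sum_phi_in Iv).
  under eq_bigr do rewrite nextS addrCA mulrDr.
  by rewrite big_split /= -mulr_suml; lra.
have val j i w : profit_at i j (in_stock c h i w) + price_at D i (in_stock c h i w) =
    \sum_l if w == Some l then (if (0 < x i l)%N then ratr (profit I i j l) + D i l else 0) else 0.
  rewrite sum_eq_Some /in_stock; case: w => [l|] /=; last by case: ifP; rewrite addr0.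
  rewrite /x inventoryE subn_gt0; case: ifPn => [/existsP[l' /andP[/eqP[->] ->]]//|].
  rewrite negb_exists => /forallP/(_ l); rewrite eqxx /= => /negPf ->.
  by rewrite addr0.
under eq_bigr => j _ do under eq_bigr => d _ do rewrite inner.
under eq_bigr => j _ do rewrite plan_policyE lamE.
rewrite nextN //.
pose F j u i l := lam j * (if (plans u j).2 i == Some l then phi j (plans u j).1 i *
  (if (0 < x i l)%N then ratr (profit I i j l) + D i l else 0) else 0) / N%:R.
have lhsE j : lam j * ((\sum_(u < N) (P + \sum_i phi j (restrict c h (plans u j)).1 i *
    (profit_at i j ((restrict c h (plans u j)).2 i) +
     price_at D i ((restrict c h (plans u j)).2 i)))) / N%:R) =
    lam j * P + \sum_(u < N) \sum_i \sum_l F j u i l.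
  rewrite big_split /= big_const_ord iter_addr_0 mulrDl -[P *+ N]mulr_natr mulfK; last first.
    by rewrite pnatr_eq0 -lt0n.
  rewrite mulrDr; congr (_ + _); rewrite mulr_suml mulr_sumr; apply: eq_bigr => u _.
  rewrite mulr_suml mulr_sumr; apply: eq_bigr => i _; rewrite ffunE val.
  rewrite mulr_sumr mulr_suml mulr_sumr; apply: eq_bigr => l _; rewrite /F mulrA.
  by case: ifP => // _; rewrite ?mulr0.
have rhsE i l : stock_value (demand i l) (income i l) (x i l) k.+1 =
    V i l (x i l) + \sum_j \sum_(u < N) F j u i l.
  rewrite stock_valueS -/(V i l (x i l)) -/(V i l (x i l).-1) -/(D i l); congr (_ + _).
  rewrite /F; case: (0 < x i l)%N; last first.
    by rewrite big1 // => j _; rewrite big1 // => u _; case: ifP; rewrite !(mulr0, mul0r).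
  rewrite /income /demand !mulr_suml -big_split; apply: eq_bigr => j _.
  rewrite /= !mulr_sumr !mulr_suml -big_split /=.
  by apply: eq_bigr => u _; case: ifP => _; ring.
transitivity (P + \sum_j \sum_(u < N) \sum_i \sum_l F j u i l); last first.
  under [RHS]eq_bigr do under eq_bigr do rewrite rhsE.
  under [RHS]eq_bigr do rewrite big_split /=.
  rewrite big_split /=; congr (_ + _).
  under eq_bigr do rewrite exchange_big /=.
  rewrite exchange_big /=; apply: eq_bigr => i _.
  under eq_bigr do rewrite exchange_big /=.
  by rewrite exchange_big.
under eq_bigr do rewrite lhsE.
rewrite big_split /= -mulr_suml.
have -> : \sum_j ratr (arrival I j t) = \sum_j lam j by apply: eq_bigr => j _; rewrite lamE.
by lra.
Qed.


End SampledPolicy.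

(** * Integer data of the algorithm *)

Lemma divz_le_ratio (R : realFieldType) (x y : int) : 0 < y ->
  (x %/ y)%Z%:~R <= x%:~R / y%:~R :> R /\ x%:~R / y%:~R - 1 <= (x %/ y)%Z%:~R :> R.
Proof.
move=> y0; have yR : 0 < y%:~R :> R by rewrite ltr0z.
have h1 := modz_ge0 x (lt0r_neq0 y0); have h2 := ltz_pmod x y0.
have h := divz_eq x y; split.
  by rewrite ler_pdivlMr // -intrM ler_int; lia.
by rewrite lerBlDr ler_pdivrMr // mulrDl mul1r -intrM -intrD ler_int; lia.
Qed.

Lemma divz_exact (R : realFieldType) (x y : int) : y != 0 -> (y %| x)%Z ->
  (x %/ y)%Z%:~R = x%:~R / y%:~R :> R.
Proof. by move=> y0 /divzK {2}<-; rewrite intrM mulfK // intr_eq0. Qed.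

Lemma ratrE (R : realFieldType) (x : rat) :
  ratr x = (numq x)%:~R / (denq x)%:~R :> R.
Proof. by []. Qed.

Section Source.
Variables (L : nat) (val : 'I_L -> int).

Definition value_at (w : option 'I_L) : int := if w is Some l then val l else 0.

Lemma sourceP : [/\ 0 <= (source val).1, forall l, val l <= (source val).1
  & (source val).1 = value_at (source val).2].
Proof.
suff /(_ (enum 'I_L)) [h0 h1 h2] : forall (r : seq 'I_L),
    let s := foldl (fun s l => if s.1 < val l then (val l, Some l) else s)
      (0, None : option 'I_L) r in
    [/\ 0 <= s.1, forall l, l \in r -> val l <= s.1 & s.1 = value_at s.2].
  by split=> // l; apply: h1; rewrite mem_enum.
elim/last_ind => [|r l IH] s; first by [].
rewrite /s foldl_rcons; move: IH => /=; set s' := foldl _ _ _ => -[h0 h1 h2].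
case: ltP => /= hl; split=> //.
- exact: le_trans h0 (ltW hl).
- move=> l'; rewrite mem_rcons inE => /orP[/eqP->//|/h1 h].
  exact: le_trans h (ltW hl).
- by move=> l'; rewrite mem_rcons inE => /orP[/eqP->//|/h1].
Qed.

Lemma value_at_le w : value_at w <= (source val).1.
Proof. by case: w => [l|] /=; have [] := sourceP. Qed.

End Source.

(** * Scaled data, optimality of the offers and the dual bound *)

Section Data.
Variables (R : realType) (n m L T : nat) (I : instance n m L T) (O : data -> data).
Hypotheses (Iv : valid I) (Is : stationary I) (IO : oracle_for I O).
Local Notation phi := (purchase_prob R I).
Local Notation profit_at := (served_profit R I).
Local Notation lam j := (ratr (rate I j) : R).
Local Notation Den := ((common_den I)%:~R : R).

Lemma rateE j t : arrival I j t = rate I j.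
Proof.
rewrite /rate; case: insubP => [t' _ _|]; first exact: Is.
by move=> /negP; case; apply: leq_ltn_trans (ltn_ord t).
Qed.

Lemma rate_ge0 j : 0 <= lam j.
Proof.
rewrite /rate; case: insubP => [t' _ _|_]; first exact: (lam_ge0 R Iv).
by rewrite rmorph0.
Qed.

Lemma sum_rate_le1 : \sum_j lam j <= 1.
Proof.
rewrite /rate; case: insubP => [t' _ _|_]; first exact: (sum_lam_le1 R Iv).
by rewrite big1 // => j _; rewrite rmorph0.
Qed.

Lemma common_den_gt0 : 0 < common_den I.
Proof. by rewrite /common_den; do 3![apply: prodr_gt0 => ? _]; apply: denq_gt0. Qed.

Lemma int_profitE i j l : (int_profit I i j l)%:~R = Den * ratr (profit I i j l) :> R.
Proof.
rewrite /int_profit intrM (@divz_exact R) ?denq_neq0 //; last first.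
  by rewrite /common_den (bigD1 i) // (bigD1 j) // (bigD1 l) //= -!mulrA dvdz_mulr.
by rewrite ratrE; ring.
Qed.

Lemma bestP j (rho : 'I_n -> int) :
  O (query j rho) = enc_set (best I O j rho) /\
  forall S, \sum_i phi j S i * (rho i)%:~R <=
    \sum_i phi j (best I O j rho) i * (rho i)%:~R.
Proof.
have rewardE S : \sum_i phi j S i * (rho i)%:~R =
    ratr (assortment_reward I j (fun i => (rho i)%:~R) S).
  rewrite -(sum_phi_in Iv) rmorph_sum; apply: eq_bigr => i _.
  by rewrite rmorphM /= ratr_int mulrC.
have [_ /(_ j (fun i => (rho i)%:~R)) [S Sopt SO]] := IO.
pose P S := (forall S', assortment_reward I j (fun i => (rho i)%:~R) S' <=
  assortment_reward I j (fun i => (rho i)%:~R) S) /\ O (query j rho) = enc_set S.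
have [opt ->] := @xgetPex _ finset.set0 P (ex_intro _ S (conj Sopt SO)).
by split=> // S'; rewrite !rewardE ler_rat opt.
Qed.

Lemma reward_ge0 v p q j i : 0 <= reward I v p q j i.
Proof. by have [] := sourceP (net I v p q j i). Qed.

Definition queue_price (q : prices n L) : 'I_n -> 'I_L -> R :=
  fun i l => (q.1 l)%:~R + (q.2 i)%:~R.

Lemma netE v p q j i (w : option 'I_L) :
  (value_at (net I v p q j i) w)%:~R =
  v%:~R * Den * profit_at i j w - p%:~R * price_at (queue_price q) i w :> R.
Proof.
case: w => [l|] /=; last by rewrite !mulr0 subr0.
by rewrite /net intrB intrM int_profitE intrM intrD mulrA.
Qed.

Definition gain v p q j : R :=
  \sum_i phi j (offer I O v p q j).1 i * (reward I v p q j i)%:~R.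

Lemma gainE v p q j : let d := offer I O v p q j in
  gain v p q j = v%:~R * Den * (\sum_i phi j d.1 i * profit_at i j (d.2 i)) -
    p%:~R * \sum_i phi j d.1 i * price_at (queue_price q) i (d.2 i).
Proof.
rewrite /gain /= !mulr_sumr -sumrB; apply: eq_bigr => i _.
rewrite ffunE /reward; have [_ _ ->] := sourceP (net I v p q j i).
by rewrite netE; ring.
Qed.

Lemma gain_ge0 v p q j : 0 <= gain v p q j.
Proof.
by apply: sumr_ge0 => i _; rewrite mulr_ge0 ?(phi_ge0 R Iv) // ler0z reward_ge0.
Qed.

(** The best source of a product does not depend on the assortment, so the joint choice of
    assortment and routes reduces to one assortment problem with the best net values as rewards. The
    virtual warehouse makes these nonnegative. *)
Lemma gain_opt v p q j (d : decision n L) :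
  v%:~R * Den * (\sum_i phi j d.1 i * profit_at i j (d.2 i)) -
    p%:~R * (\sum_i phi j d.1 i * price_at (queue_price q) i (d.2 i)) <= gain v p q j.
Proof.
have [_ /(_ d.1)] := bestP j (reward I v p q j); apply: le_trans.
rewrite !mulr_sumr -sumrB; apply: ler_sum => i _.
rewrite (_ : _ - _ = phi j d.1 i * (v%:~R * Den * profit_at i j (d.2 i) -
  p%:~R * price_at (queue_price q) i (d.2 i))); last by ring.
apply: ler_wpM2l; first exact: (phi_ge0 R Iv).
by rewrite -netE ler_int value_at_le.
Qed.

Definition rload (d : 'I_m -> decision n L) i l : R :=
  \sum_j lam j * (if (d j).2 i == Some l then phi j (d j).1 i else 0).

Lemma rload_ge0 (d : 'I_m -> decision n L) i l : 0 <= rload d i l.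
Proof.
apply: sumr_ge0 => j _; rewrite mulr_ge0 ?rate_ge0 //.
by case: ifP => // _; apply: (phi_ge0 R Iv).
Qed.

Lemma sum_rload_le1 (d : 'I_m -> decision n L) : \sum_i \sum_l rload d i l <= 1.
Proof.
apply: le_trans sum_rate_le1.
rewrite /rload; under eq_bigr do rewrite exchange_big /=.
rewrite exchange_big /=; apply: ler_sum => j _.
under eq_bigr do rewrite -mulr_sumr sum_eq_Some.
rewrite -mulr_sumr ler_piMr ?rate_ge0 //.
apply: le_trans (sum_phi_le1 R Iv j (d j).1); apply: ler_sum => i _.
by case: ((d j).2 i) => [l|] //=; apply: (phi_ge0 R Iv).
Qed.

Lemma sum_rload_warehouse (d : 'I_m -> decision n L) l : \sum_i rload d i l <= 1.
Proof.
apply: le_trans (sum_rload_le1 d); apply: ler_sum => i _.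
by rewrite (bigD1 l) //= lerDl sumr_ge0 // => l' _; apply: rload_ge0.
Qed.

Lemma sum_rload_product (d : 'I_m -> decision n L) i : \sum_l rload d i l <= 1.
Proof.
apply: le_trans (sum_rload_le1 d); rewrite [leRHS](bigD1 i) //= lerDl.
by do 2![apply: sumr_ge0 => ? _]; apply: rload_ge0.
Qed.

Lemma sum_rload_price (d : 'I_m -> decision n L) (p : 'I_n -> 'I_L -> R) :
  \sum_j lam j * \sum_i phi j (d j).1 i * price_at p i ((d j).2 i) =
  \sum_i \sum_l p i l * rload d i l.
Proof.
rewrite /rload; under [RHS]eq_bigr do under eq_bigr do rewrite mulr_sumr.
under [RHS]eq_bigr do rewrite exchange_big /=.
rewrite [RHS]exchange_big /=; apply: eq_bigr => j _.
rewrite mulr_sumr; apply: eq_bigr => i _.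
case E : ((d j).2 i) => [l|] /=; last by rewrite !mulr0 big1 // => l _; rewrite !mulr0.
rewrite (bigD1 l) //= eqxx big1 ?addr0; first by ring.
by move=> l' l'l; rewrite (inj_eq Some_inj) eq_sym (negPf l'l) !mulr0.
Qed.

(** Each of the [m] customer types contributes one quotient rounded down, which loses at most 1. *)
Lemma load_bounds (d : 'I_m -> decision n L) i l :
  [/\ 0 <= load I d i l, (load I d i l)%:~R <= (grid n m L * T)%:R * rload d i l
  & (grid n m L * T)%:R * rload d i l - m%:R <= (load I d i l)%:~R].
Proof.
pose x j := (grid n m L * T)%:Z *
  (numq (rate I j) * numq (choice_prob I i j (d j).1)).
pose y j := denq (rate I j) * denq (choice_prob I i j (d j).1).
have y0 j : 0 < y j by rewrite mulr_gt0 ?denq_gt0.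
have x0 j : 0 <= x j.
  rewrite !mulr_ge0 // numq_ge0; first by have := rate_ge0 j; rewrite ler0q.
  by have := phi_ge0 R Iv j (d j).1 i; rewrite ler0q.
have xy j : (x j)%:~R / (y j)%:~R = (grid n m L * T)%:R * (lam j * phi j (d j).1 i) :> R.
  rewrite /x /y !intrM /purchase_prob !ratrE invfM pmulrn; ring.
rewrite /load; split.
- apply: sumr_ge0 => j _; case: ifP => // _.
  by rewrite divz_ge0 ?y0 ?x0.
- rewrite rmorph_sum mulr_sumr; apply: ler_sum => j _; case: ifP => _; last by rewrite !mulr0.
  by rewrite -xy; have [] := divz_le_ratio R (x j) (y0 j).
- have -> : m%:R = \sum_(j < m) 1 :> R by rewrite sumr_const card_ord.
  rewrite lerBlDr rmorph_sum mulr_sumr -big_split /=.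
  apply: ler_sum => j _; case: ifP => _; last by rewrite !mulr0 add0r ler01.
  by rewrite -xy -lerBlDr; have [] := divz_le_ratio R (x j) (y0 j).
Qed.

(** The value 0 for an unlimited supply stands for the product of an infinite supply with its price
    0. *)
Definition supply_cap i : R := if supply I i is Some C then C%:R else 0.

(** Weak duality with the price [p (q.1 l + q.2 i) / (v Den)] for a unit of [i] at [l]: the stock of
    any feasible placement costs at most the priced capacities and supplies. Multiplying by [v Den]
    removes the fractions. *)
Lemma OPT_dual v p q : 0 < v -> 0 <= p -> (forall l, 0 <= q.1 l) ->
  (forall i, 0 <= q.2 i) -> (forall i, supply I i = None -> q.2 i = 0) ->
  v%:~R * Den * OPT R I <=
  p%:~R * (\sum_l (q.1 l)%:~R * (capacity I l)%:R +
           \sum_i (q.2 i)%:~R * supply_cap i) +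
  T%:R * \sum_j lam j * gain v p q j.
Proof.
move=> v0 p0 a0 b0 bN; set X := \sum_l _; set Y := \sum_i _; set S := \sum_j _.
have vD : 0 < v%:~R * Den :> R by rewrite mulr_gt0 // ltr0z ?common_den_gt0.
have pR : 0 <= p%:~R :> R by rewrite ler0z.
have X0 : 0 <= X by apply: sumr_ge0 => l _; rewrite mulr_ge0 // ler0z.
have Y0 : 0 <= Y.
  apply: sumr_ge0 => i _; rewrite mulr_ge0 ?ler0z // /supply_cap.
  by case: (supply I i).
have S0 : 0 <= S by apply: sumr_ge0 => j _; rewrite mulr_ge0 ?rate_ge0 ?gain_ge0.
rewrite mulrC -ler_pdivlMr //.
apply: (@OPT_le R n m L T I Iv (fun i l => p%:~R / (v%:~R * Den) * queue_price q i l)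
  (fun j => gain v p q j / (v%:~R * Den))).
- by move=> i l; rewrite mulr_ge0 ?divr_ge0 ?(ltW vD) // addr_ge0 ?ler0z.
- by move=> j; rewrite divr_ge0 ?gain_ge0 // ltW.
- move=> j d; rewrite (sum_phi_in Iv) ler_pdivlMr //; apply: le_trans (gain_opt v p q j d).
  rewrite le_eqVlt; apply/orP; left; apply/eqP.
  rewrite mulr_suml !mulr_sumr -sumrB; apply: eq_bigr => i _.
  have /lt0r_neq0 vD0 := vD.
  case: (d.2 i) => [l|] /=; [field|ring].
  by move: vD0; rewrite mulf_eq0 negb_or => /andP[-> ->].
- by rewrite divr_ge0 ?(ltW vD) // addr_ge0 // mulr_ge0 // addr_ge0.
move=> c [cK cC].
have -> : \sum_(t <- enum 'I_T) \sum_j ratr (arrival I j t) * (gain v p q j / (v%:~R * Den)) =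
    T%:R * S / (v%:~R * Den).
  rewrite big_enum /= (eq_bigr (fun=> S / (v%:~R * Den))).
    by rewrite sumr_const card_ord -[LHS]mulr_natl mulrA.
  by move=> t _; rewrite mulr_suml; apply: eq_bigr => j _; rewrite rateE mulrA.
rewrite mulrDl lerD2r.
have -> : \sum_i \sum_l p%:~R / (v%:~R * Den) * queue_price q i l * (c i l)%:R =
    p%:~R / (v%:~R * Den) * (\sum_l (q.1 l)%:~R * \sum_i (c i l)%:R +
                             \sum_i (q.2 i)%:~R * \sum_l (c i l)%:R).
  under [X in _ = _ * (X + _)]eq_bigr do rewrite mulr_sumr.
  under [X in _ = _ * (_ + X)]eq_bigr do rewrite mulr_sumr.
  rewrite [X in _ = _ * (X + _)]exchange_big -big_split /= mulr_sumr.
  apply: eq_bigr => i _; rewrite -big_split /= mulr_sumr; apply: eq_bigr => l _.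
  by rewrite /queue_price; ring.
rewrite mulrAC ler_wpM2r ?invr_ge0 ?(ltW vD) // ler_wpM2l //; apply: lerD.
- by apply: ler_sum => l _; rewrite ler_wpM2l ?ler0z // -natr_sum ler_nat.
- apply: ler_sum => i _; rewrite /supply_cap; case E : (supply I i) => [C|].
    by rewrite ler_wpM2l ?ler0z // -natr_sum ler_nat cC.
  by rewrite bN // !mul0r.
Qed.

Definition rprofit (d : 'I_m -> decision n L) : R :=
  \sum_j lam j * \sum_i phi j (d j).1 i * profit_at i j ((d j).2 i).

Lemma sum_gainE v p q : \sum_j lam j * gain v p q j =
  v%:~R * Den * rprofit (offer I O v p q) -
  p%:~R * \sum_i \sum_l queue_price q i l * rload (offer I O v p q) i l.
Proof.
rewrite /rprofit -sum_rload_price !mulr_sumr -sumrB; apply: eq_bigr => j _.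
by rewrite gainE; ring.
Qed.

Lemma sum_gain_opt v p q (d : 'I_m -> decision n L) :
  v%:~R * Den * rprofit d - p%:~R * \sum_i \sum_l queue_price q i l * rload d i l <=
  \sum_j lam j * gain v p q j.
Proof.
rewrite /rprofit -sum_rload_price !mulr_sumr -sumrB; apply: ler_sum => j _.
by apply: le_trans (ler_wpM2l (rate_ge0 j) (gain_opt v p q j (d j))); lra.
Qed.

Lemma base_den_gt0 : 0 < base_den I O.
Proof.
apply: prodr_gt0 => j _; rewrite mulr_gt0 ?denq_gt0 //.
by apply: prodr_gt0 => i _; apply: denq_gt0.
Qed.

Local Notation bden := ((base_den I O)%:~R : R).
Local Notation bnum := ((base_num I O)%:~R : R).

Lemma base_numE : bnum = bden * \sum_j lam j * gain 1 0 (@price0 n L) j.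
Proof.
rewrite /base_num rmorph_sum mulr_sumr; apply: eq_bigr => j _.
rewrite rmorph_sum !mulr_sumr; apply: eq_bigr => i _.
rewrite /= !intrM (@divz_exact R); last 2 first.
- by rewrite mulf_neq0 ?denq_neq0.
- rewrite /base_den (bigD1 j) // (bigD1 i) //= mulrA.
  exact/dvdz_mulr/dvdz_mulr.
rewrite -/(reward0 I j) /purchase_prob !ratrE intrM invfM; ring.
Qed.

Lemma base_num_ge0 : 0 <= base_num I O.
Proof.
rewrite -(ler0z R) base_numE mulr_ge0 ?ler0z ?(ltW base_den_gt0) //.
by apply: sumr_ge0 => j _; rewrite mulr_ge0 ?rate_ge0 ?gain_ge0.
Qed.

Lemma base_num_offer : bnum = bden * (Den * rprofit (offer I O 1 0 (@price0 n L))).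
Proof. by rewrite base_numE sum_gainE mul0r subr0 mul1r. Qed.

Lemma rprofit_le d : bden * Den * rprofit d <= bnum.
Proof.
rewrite base_numE -mulrA ler_wpM2l ?ler0z ?(ltW base_den_gt0) //.
by have := sum_gain_opt 1 0 (@price0 n L) d; rewrite mul0r subr0 mul1r.
Qed.

Lemma price_den_gt0 : 0 < price_den I O.
Proof.
rewrite /price_den; case: eqP => // /eqP u0.
by rewrite lt_neqAle eq_sym u0 base_num_ge0.
Qed.

(** * The virtual queues and their potential *)

Local Notation G := (grid n m L).
Local Notation N := (rounds n L T).
Local Notation q k := (queue I O k).

Lemma n_gt0 : (0 < n)%N. Proof. by case: Iv => -[]. Qed.
Lemma L_gt0 : (0 < L)%N. Proof. by case: Iv => -[]. Qed.

Lemma grid_gt0 : (0 < G)%N.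
Proof. by have := n_gt0; rewrite /grid; nia. Qed.

Lemma rounds_gt0 : (0 < N)%N.
Proof. by rewrite /rounds addn1. Qed.

Lemma sum_load_le (A : finType) (ld : A -> int) (x : A -> R) :
  (forall a, (ld a)%:~R <= (G * T)%:R * x a) -> \sum_a x a <= 1 ->
  \sum_a ld a <= (G * T)%:Z.
Proof.
move=> ldx x1; rewrite -(ler_int R) rmorph_sum /=.
apply: le_trans (ler_sum _ (fun a _ => ldx a)) _.
by rewrite -mulr_sumr ler_piMr.
Qed.

Lemma sum_load_warehouse (d : 'I_m -> decision n L) l :
  0 <= \sum_i load I d i l <= (G * T)%:Z.
Proof.
rewrite sumr_ge0 /=; last by move=> i _; have [] := load_bounds d i l.
apply: (sum_load_le (x := fun i => rload d i l)) (sum_rload_warehouse d l) => i.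
by have [] := load_bounds d i l.
Qed.

Lemma sum_load_product (d : 'I_m -> decision n L) i :
  0 <= \sum_l load I d i l <= (G * T)%:Z.
Proof.
rewrite sumr_ge0 /=; last by move=> l _; have [] := load_bounds d i l.
apply: (sum_load_le (x := fun l => rload d i l)) (sum_rload_product d i) => l.
by have [] := load_bounds d i l.
Qed.

Lemma largest_roomyP k : roomy I (largest_roomy I k) /\
  forall x, (largest_roomy I k < x <= k)%N -> ~~ roomy I x.
Proof.
elim: k => [|k [IH1 IH2]] /=.
  split=> [|x]; last by lia.
  apply/andP; split; apply/forallP => i; first by rewrite !muln0.
  by case: (supply I i) => // C; rewrite !muln0.
case: ifPn => [r|nr]; split=> // x; first by lia.
move=> /andP[h]; rewrite leq_eqVlt => /orP[/eqP->//|xk].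
by apply: IH2; rewrite h.
Qed.

Lemma roomy_stock : roomy I (stock I).
Proof. by have [] := largest_roomyP T.+1. Qed.

Lemma stock_capacity l : (n * (stock I * stock I) <= capacity I l)%N.
Proof. by have /andP[/forallP/(_ l)] := roomy_stock. Qed.

Lemma stock_supply i C : supply I i = Some C -> (L * (stock I * stock I) <= C)%N.
Proof. by have /andP[_ /forallP/(_ i)] := roomy_stock => + E; rewrite E. Qed.

Lemma warehouse_cap_ge0 l : 0 <= warehouse_cap I l.
Proof.
by have := stock_capacity l; rewrite /warehouse_cap; case: (stock I) => [|k]; nia.
Qed.

Lemma product_cap_ge0 i : 0 <= product_cap I i.
Proof.
rewrite /product_cap; case E : (supply I i) => [C|//].
by have := stock_supply E; case: (stock I) => [|k]; nia.
Qed.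

Lemma queueS k : q k.+1 = step I O (q k).
Proof. by []. Qed.

Lemma queue_ge0 k : (forall l, 0 <= (q k).1 l) /\ (forall i, 0 <= (q k).2 i).
Proof.
by case: k => [|k]; rewrite ?queueS /step /=; split=> x; rewrite ?le_max ?lexx.
Qed.

(** At most one customer arrives per period, so the expected load over the horizon is at most
    [T]. *)
Lemma queue1_idle k l : T%:Z <= warehouse_cap I l -> (q k).1 l = 0.
Proof.
move=> Tc; elim: k => // k IH.
rewrite queueS /step /= IH; apply/max_idPl.
have /andP[_] := sum_load_warehouse (plan I O (q k)) l; rewrite PoszM.
by have := grid_gt0; set S := \sum_i _; nia.
Qed.

Lemma queue2_idle k i : T%:Z <= product_cap I i -> (q k).2 i = 0.
Proof.
move=> Tc; elim: k => // k IH.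
rewrite queueS /step /= IH; apply/max_idPl.
have /andP[_] := sum_load_product (plan I O (q k)) i; rewrite PoszM.
by have := grid_gt0; set S := \sum_i _; nia.
Qed.

Lemma queue2_unlimited k i : supply I i = None -> (q k).2 i = 0.
Proof. by move=> sN; apply: queue2_idle; rewrite /product_cap sN. Qed.

Definition excess1 k l : int :=
  \sum_i load I (plan I O (q k)) i l - G%:Z * warehouse_cap I l.
Definition excess2 k i : int :=
  \sum_l load I (plan I O (q k)) i l - G%:Z * product_cap I i.

(** Cutting off at 0 only lowers the square. The second alternative is for capacities above [T]:
    there [w] can be far below [- X], but the queue is always 0. *)
Lemma drift (a w X : int) : 0 <= a -> 0 <= X ->
  (`|w| <= X) || ((a == 0) && (w <= 0)) ->
  Num.max 0 (a + w) ^+ 2 <= a ^+ 2 + 2 * (a * w) + X ^+ 2.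
Proof.
move=> a0 X0 /orP[wX|/andP[/eqP-> w0]]; last first.
  by rewrite add0r (max_idPl w0) expr0n /=; nia.
have w2 : w ^+ 2 <= X ^+ 2 by move: wX; rewrite ler_norml !expr2 => /andP[? ?]; nia.
have : Num.max 0 (a + w) ^+ 2 <= (a + w) ^+ 2.
  by rewrite maxEle; case: ifP => _ //; rewrite expr0n sqr_ge0.
by move: w2; rewrite !expr2; nia.
Qed.

Lemma queue1_drift k l : (q k.+1).1 l ^+ 2 <=
  (q k).1 l ^+ 2 + 2 * ((q k).1 l * excess1 k l) + (G * T)%:Z ^+ 2.
Proof.
rewrite queueS /step /=; apply: drift => //; first by have [] := queue_ge0 k.
have [Tc|cT] := leP T%:Z (warehouse_cap I l).
  rewrite queue1_idle // eqxx /=; apply/orP; right.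
  have /andP[_] := sum_load_warehouse (plan I O (q k)) l; rewrite PoszM.
  by have := grid_gt0; rewrite /excess1; set S := \sum_i _; nia.
have /andP[] := sum_load_warehouse (plan I O (q k)) l; rewrite PoszM.
have := warehouse_cap_ge0 l; have := grid_gt0; rewrite /excess1; set S := \sum_i _.
by rewrite ler_norml => *; apply/orP; left; apply/andP; split; nia.
Qed.

Lemma queue2_drift k i : (q k.+1).2 i ^+ 2 <=
  (q k).2 i ^+ 2 + 2 * ((q k).2 i * excess2 k i) + (G * T)%:Z ^+ 2.
Proof.
rewrite queueS /step /=; apply: drift => //; first by have [] := queue_ge0 k.
have [Tc|cT] := leP T%:Z (product_cap I i).
  rewrite queue2_idle // eqxx /=; apply/orP; right.
  have /andP[_] := sum_load_product (plan I O (q k)) i; rewrite PoszM.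
  by have := grid_gt0; rewrite /excess2; set S := \sum_i _; nia.
have /andP[] := sum_load_product (plan I O (q k)) i; rewrite PoszM.
have := product_cap_ge0 i; have := grid_gt0; rewrite /excess2; set S := \sum_i _.
by rewrite ler_norml => *; apply/orP; left; apply/andP; split; nia.
Qed.

Definition potential k : int := \sum_l (q k).1 l ^+ 2 + \sum_i (q k).2 i ^+ 2.
Definition cross k : int :=
  \sum_l (q k).1 l * excess1 k l + \sum_i (q k).2 i * excess2 k i.

Lemma potential_drift k :
  potential k <= 2 * \sum_(t < k) cross t + (k * (n + L))%:Z * (G * T)%:Z ^+ 2.
Proof.
elim: k => [|k IH].
  rewrite /potential big_ord0 mulr0 mul0n mul0r addr0 /queue /=.
  by rewrite !big1 // => i _; rewrite expr0n.
apply: (@le_trans _ _ (potential k + 2 * cross k + (n + L)%:Z * (G * T)%:Z ^+ 2)).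
  rewrite /potential /cross.
  have h1 := ler_sum (index_enum _) (P := xpredT) (fun l _ => queue1_drift k l).
  have h2 := ler_sum (index_enum _) (P := xpredT) (fun i _ => queue2_drift k i).
  apply: le_trans (lerD h1 h2) _.
  have cst p (c : int) : \sum_(i < p) c = p%:Z * c.
    by rewrite sumr_const card_ord -[LHS]mulr_natl natz.
  rewrite !big_split /= !cst -!mulr_sumr PoszD.
  by rewrite le_eqVlt; apply/orP; left; apply/eqP; ring.
rewrite big_ord_recr /= mulSn PoszD; move: IH; nra.
Qed.

Definition plan_gain k : R :=
  \sum_j lam j * gain ((G * weight n L T)%:Z * base_den I O) (price_den I O) (q k) j.

Definition cap_value k : int :=
  \sum_l (q k).1 l * warehouse_cap I l + \sum_i (q k).2 i * product_cap I i.

Local Notation V := (((G * weight n L T)%:Z * base_den I O)%:~R : R).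
Local Notation U := ((price_den I O)%:~R : R).

Lemma plan_gain_ge0 k : 0 <= plan_gain k.
Proof. by apply: sumr_ge0 => j _; rewrite mulr_ge0 ?rate_ge0 ?gain_ge0. Qed.

Lemma cap_value_ge0 k : 0 <= cap_value k.
Proof.
have [a0 b0] := queue_ge0 k; apply: addr_ge0; apply: sumr_ge0 => x _.
  by rewrite mulr_ge0 ?warehouse_cap_ge0.
by rewrite mulr_ge0 ?product_cap_ge0.
Qed.

Lemma plan_gainE k : plan_gain k = V * Den * rprofit (plan I O (q k)) -
  U * \sum_i \sum_l queue_price (q k) i l * rload (plan I O (q k)) i l.
Proof. exact: sum_gainE. Qed.

Lemma sum_queue_price k (x : 'I_n -> 'I_L -> R) :
  \sum_i \sum_l queue_price (q k) i l * x i l =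
  \sum_l ((q k).1 l)%:~R * \sum_i x i l + \sum_i ((q k).2 i)%:~R * \sum_l x i l.
Proof.
under [X in _ = X + _]eq_bigr do rewrite mulr_sumr.
under [X in _ = _ + X]eq_bigr do rewrite mulr_sumr.
rewrite [X in _ = X + _]exchange_big -big_split /=.
apply: eq_bigr => i _; rewrite -big_split /=; apply: eq_bigr => l _.
by rewrite mulrDl.
Qed.

(** Loads are rounded down and queues are nonnegative, so the true loads give an upper bound; their
    price is the scaled profit of the plan minus its net gain. *)
Lemma cross_le k : U * (cross k)%:~R <=
  G%:R * (T%:R * (V * Den * rprofit (plan I O (q k)) - plan_gain k) -
          U * (cap_value k)%:~R).
Proof.
have U0 : 0 <= U by rewrite ler0z ltW // price_den_gt0.
have [a0 b0] := queue_ge0 k.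
suff h : (cross k)%:~R <= G%:R * (T%:R * (\sum_i \sum_l queue_price (q k) i l *
    rload (plan I O (q k)) i l) - (cap_value k)%:~R).
  apply: le_trans (ler_wpM2l U0 h) _; rewrite plan_gainE le_eqVlt; apply/orP; left.
  by apply/eqP; ring.
have e (A : finType) (a x y : A -> R) :
    \sum_z a z * ((G * T)%:R * x z - G%:R * y z) =
    G%:R * (T%:R * (\sum_z a z * x z) - \sum_z a z * y z).
  by rewrite mulrBr !mulr_sumr -sumrB; apply: eq_bigr => z _; rewrite natrM; ring.
apply: (@le_trans _ _
  (\sum_l ((q k).1 l)%:~R * ((G * T)%:R * (\sum_i rload (plan I O (q k)) i l) -
    G%:R * (warehouse_cap I l)%:~R) +
  \sum_i ((q k).2 i)%:~R * ((G * T)%:R * (\sum_l rload (plan I O (q k)) i l) -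
    G%:R * (product_cap I i)%:~R))); last first.
  rewrite !e sum_queue_price /cap_value intrD !rmorph_sum /= le_eqVlt; apply/orP; left.
  by under [X in _ == _ * (_ - (X + _))]eq_bigr do rewrite intrM;
     under [X in _ == _ * (_ - (_ + X))]eq_bigr do rewrite intrM; apply/eqP; ring.
rewrite /cross intrD !rmorph_sum /=.
apply: lerD; apply: ler_sum => x _; rewrite intrM ler_wpM2l ?ler0z //.
- rewrite /excess1 intrB intrM rmorph_sum /= lerD2r mulr_sumr; apply: ler_sum => i _.
  by have [] := load_bounds (plan I O (q k)) i x.
- rewrite /excess2 intrB intrM rmorph_sum /= lerD2r mulr_sumr; apply: ler_sum => l _.
  by have [] := load_bounds (plan I O (q k)) x l.
Qed.

(** The hypothesis says that the dual value with reduced capacities is at least [X] in every round.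
    A total profit short of [X] would then push the potential below what its growth allows. With
    [X = 0] this bounds the queues, with [X] near the optimum it bounds the profit from below. *)
Lemma potential_le X K :
  (forall k, V * Den * X <= T%:R * plan_gain k + U * (cap_value k)%:~R) ->
  U * (potential K)%:~R <=
  2 * G%:R * V * Den * (\sum_(k < K) (T%:R * rprofit (plan I O (q k)) - X)) +
  U * (K * (n + L))%:R * (G * T)%:R ^+ 2.
Proof.
move=> hX; have U0 : 0 <= U by rewrite ler0z ltW // price_den_gt0.
have h : (potential K)%:~R <= 2 * (\sum_(k < K) (cross k)%:~R) +
    (K * (n + L))%:R * (G * T)%:R ^+ 2 :> R.
  have := potential_drift K; move: (potential K) => P; rewrite -(ler_int R) intrD !intrM rmorph_sum /=.
  by rewrite expr2.
apply: le_trans (ler_wpM2l U0 h) _.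
rewrite mulrDr mulrA lerD //; last by rewrite mulrA.
rewrite [leRHS]mulr_sumr mulr_sumr; apply: ler_sum => k _.
rewrite (_ : U * 2 = 2 * U); last by ring.
rewrite -!mulrA ler_wpM2l //.
apply: le_trans (cross_le k) _; rewrite -!mulrA ler_wpM2l //.
by have := hX k; rewrite !mulrA; nra.
Qed.

(** The bound with [X = 0] is linear in the number of rounds [N], the right-hand side is quadratic,
    and [N] exceeds the ratio of the coefficients. *)
Lemma potential_lt : 4 * potential N < (G * N)%:Z ^+ 2.
Proof.
have U0 : 0 < U by rewrite ltr0z price_den_gt0.
have h0 k : V * Den * 0 <= T%:R * plan_gain k + U * (cap_value k)%:~R.
  rewrite mulr0 addr_ge0 // mulr_ge0 ?plan_gain_ge0 ?(ltW U0) //.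
  by rewrite ler0z cap_value_ge0.
have := potential_le N h0.
have -> : \sum_(k < N) (T%:R * rprofit (plan I O (q k)) - 0) =
    T%:R * \sum_(k < N) rprofit (plan I O (q k)).
  by rewrite mulr_sumr; apply: eq_bigr => k _; rewrite subr0.
(* Here the scale of the prices matters: in these units no round earns more than [U] per period. *)
have hs : bden * Den * (\sum_(k < N) rprofit (plan I O (q k))) <= N%:R * U.
  have -> : N%:R * U = \sum_(k < N) U by rewrite sumr_const card_ord mulr_natl.
  rewrite mulr_sumr; apply: ler_sum => k _.
  apply: le_trans (rprofit_le _) _; rewrite ler_int /price_den.
  by case: eqP => [->|].
move=> h; have : U * (potential N)%:~R <= U *
    ((G * G)%:R * N%:R * (2 * (weight n L T)%:R * T%:R + (sqwidth n L T)%:R)).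
  apply: le_trans h _.
  have -> : V = G%:R * (weight n L T)%:R * bden by rewrite intrM -pmulrn natrM.
  have e1 : (N * (n + L))%:R = N%:R * (n + L)%:R :> R := natrM _ _ _.
  have e2 : (G * T)%:R = G%:R * T%:R :> R := natrM _ _ _.
  have e3 : (G * G)%:R = G%:R * G%:R :> R := natrM _ _ _.
  have e4 : (sqwidth n L T)%:R = (n + L)%:R * (T%:R * T%:R) :> R.
    by rewrite -!natrM.
  rewrite {}e1 {}e2 {}e3 {}e4 !mulrDr; apply: lerD; last first.
    by rewrite le_eqVlt; apply/orP; left; apply/eqP; ring.
  have : 0 <= 2 * (G%:R * G%:R) * (weight n L T)%:R * T%:R :> R by rewrite !mulr_ge0.
  by move=> /ler_wpM2l /(_ _ _ hs); set S := \sum_(k < _) _; lra.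
rewrite ler_pM2l // => hp.
have hN : 4 * (2 * (weight n L T)%:R * T%:R + (sqwidth n L T)%:R) < N%:R :> R.
  rewrite /rounds; move: (weight n L T) (sqwidth n L T) => w s.
  by rewrite !natrD !natrM; lra.
rewrite -(ltr_int R) intrM.
have G0 : 0 < (G * G)%:R * N%:R :> R.
  by rewrite mulr_gt0 ?ltr0n ?rounds_gt0 // muln_gt0 grid_gt0.
rewrite -(ltr_pM2l G0) in hN; rewrite expr2 -PoszM -pmulrn.
have -> : (G * N * (G * N))%:R = (G * G)%:R * N%:R * N%:R :> R by rewrite !natrM; ring.
apply: le_lt_trans hN; have {}hp := ler_wpM2l (ler0n R 4) hp.
by apply: le_trans hp _; rewrite le_eqVlt; apply/orP; left; apply/eqP; ring.
Qed.

Lemma queue_small : (forall l, 2 * (q N).1 l < (G * N)%:Z) /\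
  (forall i, 2 * (q N).2 i < (G * N)%:Z).
Proof.
have [a0 b0] := queue_ge0 N; have := potential_lt; rewrite /potential => pot.
have sq0 (A : finType) (x : A -> int) z : x z ^+ 2 <= \sum_y x y ^+ 2.
  by rewrite (bigD1 z) //= lerDl sumr_ge0 // => y _; apply: sqr_ge0.
have s0 (A : finType) (x : A -> int) : 0 <= \sum_y x y ^+ 2.
  by apply: sumr_ge0 => y _; apply: sqr_ge0.
split=> [l|i].
- have := sq0 _ (q N).1 l; have := s0 _ (q N).2; have := a0 l.
  by rewrite !expr2 in pot *; move: (\sum_y _) (\sum_y _) pot => x y; nia.
- have := sq0 _ (q N).2 i; have := s0 _ (q N).1; have := b0 i.
  by rewrite !expr2 in pot *; move: (\sum_y _) (\sum_y _) pot => x y; nia.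
Qed.

(** The cut at 0 only raises a queue, which therefore dominates the accumulated excess. *)
Lemma sum_excess K : (forall l, \sum_(k < K) excess1 k l <= (q K).1 l) /\
  (forall i, \sum_(k < K) excess2 k i <= (q K).2 i).
Proof.
elim: K => [|K [IH1 IH2]]; first by split=> x; rewrite big_ord0.
split=> x; rewrite big_ord_recr queueS /step /= le_max; apply/orP; right.
  by rewrite lerD.
by rewrite lerD.
Qed.

(** The corrections [m / G] of all entries add up to at most 1/2 by the size of the grid, and the
    final queue contributes [a / (G N) < 1/2]. The sum of the floors is thus an integer below
    [cap + 1]. *)
Lemma sum_floor_le (A : finType) (acc : A -> int) (cap a : int) :
  (#|A| * (2 * m) <= G)%N -> \sum_z acc z <= a + (N * G)%:Z * cap ->
  2 * a < (G * N)%:Z ->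
  \sum_z (((m * N)%:Z + acc z) %/ (N * G)%:Z)%Z <= cap.
Proof.
have D0 : 0 < (N * G)%:Z by rewrite ltz_nat muln_gt0 rounds_gt0 grid_gt0.
move=> AG h a2; have : (N * G)%:Z * \sum_z (((m * N)%:Z + acc z) %/ (N * G)%:Z)%Z <=
    \sum_z ((m * N)%:Z + acc z).
  rewrite mulr_sumr; apply: ler_sum => z _; rewrite mulrC.
  by apply: lez_floor; rewrite gt_eqF.
have -> : \sum_z ((m * N)%:Z + acc z) = (#|A| * (m * N))%:Z + \sum_z acc z.
  by rewrite big_split sumr_const /= -[_ *+ #|A|]mulr_natl natz.
set S := \sum_z _; move=> hS; rewrite -ltzD1 -(ltr_pM2l D0) mulrDr mulr1.
have : (#|A| * (m * N))%:Z * 2 <= (N * G)%:Z by rewrite -PoszM lez_nat; nia.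
have -> : (N * G)%:Z = (G * N)%:Z by rewrite mulnC.
move: hS h; have -> : (N * G)%:Z = (G * N)%:Z by rewrite mulnC.
by move: (\sum_z acc z) => Y; lra.
Qed.

Definition rounds_load i l : int := \sum_(k < N) load I (plan I O (q k)) i l.

Lemma stockingE i l : (stocking I O i l)%:Z =
  (((m * N)%:Z + rounds_load i l) %/ (N * G)%:Z)%Z + (stock I)%:Z.
Proof.
have D0 : 0 < (N * G)%:Z by rewrite ltz_nat muln_gt0 rounds_gt0 grid_gt0.
rewrite /stocking PoszD gez0_abs // divz_ge0 //.
by rewrite addr_ge0 // sumr_ge0 // => k _; have [] := load_bounds (plan I O (q k)) i l.
Qed.

Lemma stocking_feasible : feasible I (stocking I O).
Proof.
have [a2 b2] := queue_small; have [ea eb] := sum_excess N; split=> [l|i C iC].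
- rewrite -lez_nat (big_morph Posz PoszD (erefl _)); under eq_bigr do rewrite stockingE.
  rewrite big_split sumr_const card_ord /= -[_ *+ n]mulr_natl natz -PoszM.
  rewrite -lerBrDr -/(warehouse_cap I l).
  apply: (sum_floor_le (a := (q N).1 l)); rewrite ?card_ord //; first by rewrite /grid; nia.
  rewrite /rounds_load exchange_big /= -lerBlDr; apply: le_trans (ea l).
  rewrite /excess1 big_split /= sumr_const card_ord -[(- _) *+ N]mulr_natl natz.
  by rewrite lerD2l PoszM; lra.
- rewrite -lez_nat (big_morph Posz PoszD (erefl _)); under eq_bigr do rewrite stockingE.
  rewrite big_split sumr_const card_ord /= -[_ *+ L]mulr_natl natz -PoszM -lerBrDr.
  have -> : C%:Z - (L * stock I)%:Z = product_cap I i by rewrite /product_cap iC.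
  apply: (sum_floor_le (a := (q N).2 i)); rewrite ?card_ord //; first by rewrite /grid; nia.
  rewrite /rounds_load exchange_big /= -lerBlDr; apply: le_trans (eb i).
  rewrite /excess2 big_split /= sumr_const card_ord -[(- _) *+ N]mulr_natl natz.
  by rewrite lerD2l PoszM; lra.
Qed.

End Data.

(** * Performance guarantee *)

(** By convention [sup] is 0 where no supremum exists, so a single nonnegative member suffices. *)
Lemma sup_ge0 (R : realType) (A : set R) x : A x -> 0 <= x -> 0 <= sup A.
Proof.
move=> Ax x0; have [hA|nA] := pselect (has_sup A); last by rewrite sup_out.
exact: le_trans x0 (sup_upper_bound hA Ax).
Qed.

Lemma big_omin (A : finType) (f : A -> option nat) a x :
  (forall a x, f a = Some x -> (0 < x)%N) -> f a = Some x ->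
  exists2 k, \big[omin/None]_a f a = Some k & (0 < k <= x)%N.
Proof.
move=> f0 fa; have : a \in index_enum A by rewrite mem_index_enum.
have pos r k : \big[omin/None]_(a <- r) f a = Some k -> (0 < k)%N.
  elim: r k => [|b r IH] k; first by rewrite big_nil.
  rewrite big_cons; case E : (f b) => [y|//]; last exact: IH.
  have y0 := f0 _ _ E; case F : (\big[omin/None]_(a <- r) f a) => [z|] /= [<-] //.
  by rewrite leq_min y0 IH.
elim: (index_enum A) => //= b r IH; rewrite inE => /orP[/eqP<-|/IH [k kE /andP[k0 kx]]].
  rewrite big_cons fa; case F : (\big[omin/None]_(a <- r) f a) => [z|] /=.
    by exists (minn x z); rewrite // leq_min (f0 _ _ fa) (pos _ _ F) geq_minl.
  by exists x; rewrite // (f0 _ _ fa) leqnn.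
rewrite big_cons kE; case E : (f b) => [y|] /=; last by exists k; rewrite ?k0.
by exists (minn y k); rewrite // leq_min (f0 _ _ E) k0 geq_min kx orbT.
Qed.

Lemma stock_value_ge0 (R : realType) (p r : R) x k :
  0 <= p <= 1 -> 0 <= r -> 0 <= stock_value p r x k.
Proof.
move=> /andP[p0 p1] r0; elim: k x => [|k IH] [|x] //=.
by rewrite !addr_ge0 // mulr_ge0 // subr_ge0.
Qed.

Section Guarantee.
Variables (R : realType) (n m L T : nat) (I : instance n m L T) (O : data -> data).
Hypotheses (Iv : valid I) (Is : stationary I) (IO : oracle_for I O).
Local Notation phi := (purchase_prob R I).
Local Notation lam j := (ratr (rate I j) : R).
Local Notation N := (rounds n L T).
Local Notation G := (grid n m L).
Local Notation plans := (fun u => plan I O (queue I O u)).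
Local Notation c := (stocking I O).
Local Notation g := (stock I).

Let dem := demand I (fun j => lam j) N plans.
Let inc := income I (fun j => lam j) N plans.

Definition total_profit : R := T%:R * (\sum_(k < N) rprofit R I (plans k)) / N%:R.

Let N0 : 0 < N%:R :> R.
Proof. by rewrite ltr0n rounds_gt0. Qed.

Lemma value_stocking :
  policy_value I (plan_policy R N plans c) = \sum_i \sum_l stock_value (dem i l) (inc i l) (c i l) T.
Proof.
rewrite /policy_value (expected_profit_plan (lam := fun j => lam j) Iv) //.
- by rewrite size_enum_ord.
- by move=> j t; rewrite (rateE Is).
- exact: rounds_gt0.
Qed.

Lemma demE i l : dem i l = (\sum_(k < N) rload R I (plans k) i l) / N%:R.
Proof.
rewrite /dem /demand /rload; congr (_ / _).
under eq_bigr do rewrite mulr_sumr.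
by rewrite exchange_big.
Qed.

Lemma dem_bounds i l : 0 <= dem i l <= 1.
Proof.
rewrite demE divr_ge0 ?(ltW N0) ?sumr_ge0 //=; last first.
  by move=> k _; apply: rload_ge0.
rewrite ler_pdivrMr // mul1r.
have -> : N%:R = \sum_(k < N) 1 :> R by rewrite sumr_const card_ord.
apply: ler_sum => k _; apply: le_trans (sum_rload_warehouse R Iv (plans k) l).
by rewrite (bigD1 i) //= lerDl sumr_ge0 // => i' _; apply: rload_ge0.
Qed.

(** A source has to beat the virtual warehouse, worth 0, after paying a nonnegative price. *)
Lemma routed_profit_ge0 k j i l : (plans k j).2 i = Some l -> 0 <= profit I i j l.
Proof.
rewrite /plan /offer /= ffunE => E.
set w := (_%:Z * _) in E; set q := queue I O k in E.
have [s0 _] := sourceP (net I w (price_den I O) q j i).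
rewrite E /= /net => s1; rewrite s1 in s0.
have w0 : 0 < w.
  by rewrite mulr_gt0 ?(base_den_gt0 I O) // ltz_nat muln_gt0 (grid_gt0 Iv) /weight addn1.
have [a0 b0] := queue_ge0 I O k.
have p0 := price_den_gt0 R O Iv.
have : 0 <= int_profit I i j l.
  have : 0 <= price_den I O * (q.1 l + q.2 i) by rewrite mulr_ge0 ?(ltW p0) ?addr_ge0.
  by move=> h; rewrite -(pmulr_rge0 _ w0); lra.
rewrite -(ler0z R) int_profitE pmulr_rge0 ?ltr0z ?common_den_gt0 //.
by rewrite ler0q.
Qed.

Lemma inc_ge0 i l : 0 <= inc i l.
Proof.
rewrite divr_ge0 ?(ltW N0) // sumr_ge0 // => j _.
rewrite mulr_ge0 ?(rate_ge0 R Iv) // sumr_ge0 // => k _; case: eqP => // E.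
by rewrite mulr_ge0 ?(phi_ge0 R Iv) // ler0q (routed_profit_ge0 E).
Qed.

(** This gives income as a rate per demanded unit, the form in which lost sales are bounded. If the
    demand is 0, so is the income, because profits are bounded. *)
Lemma inc_dem i l : inc i l = inc i l / dem i l * dem i l.
Proof.
have [d0|d0] := eqVneq (dem i l) 0; last by rewrite divfK.
rewrite d0 mulr0; apply/eqP; rewrite eq_le inc_ge0 andbT.
pose M : R := \sum_j `|ratr (profit I i j l)|.
suff : inc i l <= M * dem i l by rewrite d0 mulr0.
rewrite /inc /dem /income /demand mulrA ler_wpM2r ?invr_ge0 ?(ltW N0) // mulr_sumr.
apply: ler_sum => j _; rewrite mulrCA ler_wpM2l ?(rate_ge0 R Iv) // mulr_sumr.
apply: ler_sum => k _; case: ifP => _; last by rewrite mulr0.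
rewrite mulrC ler_wpM2r ?(phi_ge0 R Iv) // (le_trans (ler_norm _)) //.
by rewrite /M (bigD1 j) //= lerDl sumr_ge0.
Qed.

Lemma sum_inc : T%:R * (\sum_i \sum_l inc i l) = total_profit.
Proof.
rewrite /total_profit -mulrA; congr (_ * _).
rewrite /inc /income; under eq_bigr do rewrite -mulr_suml.
rewrite -mulr_suml; congr (_ / _).
under eq_bigr do under eq_bigr do under eq_bigr do rewrite mulr_sumr.
under eq_bigr do under eq_bigr do rewrite exchange_big /=.
under eq_bigr do rewrite exchange_big /=.
rewrite exchange_big /=; apply: eq_bigr => k _; rewrite /rprofit.
under eq_bigr do rewrite exchange_big /=.
rewrite exchange_big /=; apply: eq_bigr => j _; rewrite mulr_sumr; apply: eq_bigr => i _.
rewrite -mulr_sumr; congr (_ * _).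
rewrite (eq_bigr (fun l => if (plans k j).2 i == Some l then
  phi j (plans k j).1 i * ratr (profit I i j l) else 0)) // sum_eq_Some.
by case: ((plans k j).2 i) => [l|] /=; rewrite ?mulr0.
Qed.

Lemma value_ge0 : 0 <= policy_value I (plan_policy R N plans c).
Proof.
rewrite value_stocking; do 2![apply: sumr_ge0 => ? _].
by apply: stock_value_ge0; rewrite ?dem_bounds ?inc_ge0.
Qed.

(** Only the final rounding down costs something, at most one unit; the rounding of the loads is
    compensated in the placement. *)
Lemma stocking_margin i l : T%:R * dem i l + g%:R - 1 <= (c i l)%:R.
Proof.
have G0 : 0 < G%:R :> R by rewrite ltr0n (grid_gt0 Iv).
have D0 : 0 < (N * G)%:Z by rewrite ltz_nat muln_gt0 rounds_gt0 (grid_gt0 Iv).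
have -> : (c i l)%:R = (c i l)%:Z%:~R :> R by [].
rewrite (stockingE R O Iv) intrD -[g%:Z%:~R]/(g%:R).
have [_ h] := divz_le_ratio R ((m * N)%:Z + rounds_load I O i l) D0.
suff : T%:R * dem i l <= ((m * N)%:Z + rounds_load I O i l)%:~R / (N * G)%:Z%:~R by lra.
have D0R : 0 < (N * G)%:Z%:~R :> R by rewrite ltr0z.
rewrite ler_pdivlMr // -[(N * G)%:Z%:~R]/((N * G)%:R).
rewrite demE intrD -[(m * N)%:Z%:~R]/((m * N)%:R) /rounds_load rmorph_sum /=.
rewrite [(N * G)%:R]natrM [leLHS](_ : _ = (G%:R * T%:R) * \sum_(k < N) rload R I (plans k) i l); last first.
  by field; rewrite gt_eqF.
rewrite mulr_sumr -lerBlDl.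
have -> : (m * N)%:R = \sum_(k < N) m%:R :> R by rewrite sumr_const card_ord natrM mulr_natr.
rewrite -sumrB; apply: ler_sum => k _.
by have [_ _] := load_bounds R Iv (plans k) i l; rewrite natrM.
Qed.

Lemma value_ample : (T <= g)%N -> policy_value I (plan_policy R N plans c) = total_profit.
Proof.
move=> Tg; rewrite value_stocking -sum_inc mulr_sumr; apply: eq_bigr => i _.
rewrite mulr_sumr; apply: eq_bigr => l _; rewrite stock_value_ample //.
by apply: leq_trans Tg _; rewrite /stocking leq_addl.
Qed.

Lemma value_safe : (2 <= g)%N ->
  (1 - (4 * (g%:R - 1))^-1) * total_profit <= policy_value I (plan_policy R N plans c).
Proof.
move=> g2; rewrite value_stocking -sum_inc mulrA !mulr_sumr; apply: ler_sum => i _.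
rewrite mulr_sumr; apply: ler_sum => l _.
have g2R : 2 <= g%:R :> R by rewrite (ler_nat R 2).
have cM := stocking_margin i l.
have /andP[d0 d1] := dem_bounds i l.
(* With the margin between stock and mean demand as [de], the square in the bound on lost sales
   vanishes and only the variance remains, which is at most the mean. *)
pose de := (c i l)%:R - T%:R * dem i l.
have de1 : g%:R - 1 <= de by rewrite /de; lra.
have de0 : 0 < de by lra.
have rho0 : 0 <= inc i l / dem i l by rewrite divr_ge0 ?inc_ge0.
apply: le_trans (stock_value_ge _ _ (dem_bounds i l) (inc_dem i l) rho0 de0).
have -> : T%:R * dem i l - (c i l)%:R + de = 0 by rewrite /de; lra.
rewrite expr0n addr0 {1}inc_dem.
rewrite (_ : (1 - (4 * (g%:R - 1))^-1) * T%:R * (inc i l / dem i l * dem i l) =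
  inc i l / dem i l * ((1 - (4 * (g%:R - 1))^-1) * T%:R * dem i l)); last by ring.
rewrite ler_wpM2l //.
have Td : 0 <= T%:R * dem i l by rewrite mulr_ge0.
have h1 : T%:R * dem i l * (1 - dem i l) / (4 * de) <= T%:R * dem i l * (4 * (g%:R - 1))^-1.
  have h : (1 - dem i l) * (4 * de)^-1 <= 1 * (4 * (g%:R - 1))^-1.
    apply: ler_pM; rewrite ?invr_ge0; try lra.
    by rewrite lef_pV2 ?posrE; lra.
  by rewrite -mulrA ler_wpM2l // (le_trans h) ?mul1r.
by lra.
Qed.

Lemma OPT_ge0 : 0 <= OPT R I.
Proof.
apply: (@sup_ge0 _ _ (J1star R I c)).
  by exists c => //; apply: (stocking_feasible R Iv IO).
apply: sup_ge0 value_ge0; exists (plan_policy R N plans c) => //.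
by apply: plan_policyP; apply: rounds_gt0.
Qed.

Local Notation d0 := (offer I O 1 0 (@price0 n L)).
Local Notation Den := ((common_den I)%:~R : R).
Local Notation bden := ((base_den I O)%:~R : R).
Local Notation V := (((G * weight n L T)%:Z * base_den I O)%:~R : R).
Local Notation U := ((price_den I O)%:~R : R).

Let Den0 : 0 < Den.
Proof. by rewrite ltr0z common_den_gt0. Qed.

Let weight0 : 0 < (weight n L T)%:R :> R.
Proof. by rewrite ltr0n /weight addn1. Qed.

Let G0 : 0 < G%:R :> R.
Proof. by rewrite ltr0n (grid_gt0 Iv). Qed.

Let VE : V = G%:R * (weight n L T)%:R * bden.
Proof. by rewrite intrM -pmulrn natrM. Qed.

Let V0 : 0 < V.
Proof. by rewrite VE !mulr_gt0 // ltr0z base_den_gt0. Qed.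

Lemma OPT_le_base : OPT R I <= T%:R * rprofit R I d0.
Proof.
have := @OPT_dual R n m L T I O Iv Is IO 1 0 (@price0 n L) isT isT (fun=> isT) (fun=> isT)
  (fun _ _ => erefl).
by rewrite mul0r add0r sum_gainE // mul0r subr0 mul1r mulrCA ler_pM2l.
Qed.

Lemma total_profitE : total_profit * N%:R = T%:R * \sum_(k < N) rprofit R I (plans k).
Proof. by rewrite /total_profit divfK // gt_eqF. Qed.

(** All queues are 0, so every round maximizes profit at price 0 and attains the dual bound
    exactly. *)
Lemma idle_guarantee : g = T.+1 -> OPT R I <= total_profit.
Proof.
move=> gT; have n0 := n_gt0 Iv; have L0 := L_gt0 Iv.
have a0 k l : (queue I O k).1 l = 0.
  apply: (queue1_idle R) => //; rewrite /warehouse_cap.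
  by have := stock_capacity I l; rewrite gT; nia.
have b0 k i : (queue I O k).2 i = 0.
  apply: (queue2_idle R) => //; rewrite /product_cap; case E : (supply I i) => [C|//].
  by have := stock_supply E; rewrite gT; nia.
rewrite -(ler_pM2r N0) total_profitE mulr_sumr.
have -> : OPT R I * N%:R = \sum_(k < N) OPT R I by rewrite sumr_const card_ord mulr_natr.
apply: ler_sum => k _.
have VD : 0 < V * Den by rewrite mulr_gt0.
rewrite -(ler_pM2l VD).
have p0 := price_den_gt0 R O Iv.
have v0 : 0 < (G * weight n L T)%:Z * base_den I O by rewrite -(ltr0z R).
have [a0' b0'] := queue_ge0 I O k.
apply: le_trans (@OPT_dual R n m L T I O Iv Is IO _ _ (queue I O k) v0 (ltW p0) a0' b0' _) _ => /=.
- by move=> i _; rewrite b0.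
- rewrite [X in _ * (X + _)]big1 ?[X in _ * (_ + X)]big1 => [|i _|l _]; rewrite ?a0 ?b0 ?mul0r //.
  rewrite addr0 mulr0 add0r sum_gainE [X in _ - _ * X]big1 => [|i _].
    by rewrite mulr0 subr0 mulrCA.
  by rewrite big1 // => l _; rewrite /queue_price a0 b0 addr0 mul0r.
Qed.

(** * Losses from the reserve and from the finite number of rounds *)

Section Tight.
Variable eps : R.
Hypotheses (eps_ge0 : 0 <= eps) (eps_le1 : eps <= 1).
Hypothesis eps_capacity : forall l, n%:R <= eps ^+ 2 * (capacity I l)%:R.
Hypothesis eps_supply : forall i C, supply I i = Some C -> L%:R <= eps ^+ 2 * C%:R.

(** Compare squares: [(a g)^2 = a (a g^2) <= a k <= (eps k)^2]. *)
Lemma reserve_le (a k : nat) : (a * (g * g) <= k)%N -> a%:R <= eps ^+ 2 * k%:R ->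
  (a * g)%:R <= eps * k%:R :> R.
Proof.
rewrite -(ler_nat R) => h1 h2.
have e0 : 0 <= eps * k%:R by rewrite mulr_ge0.
rewrite -(ler_pXn2r (n := 2)) ?nnegrE //.
have := ler_wpM2l (ler0n R a) h1; have := ler_wpM2r (ler0n R k) h2.
rewrite !natrM !expr2; nra.
Qed.

Lemma warehouse_cap_ge l :
  (1 - eps) * (capacity I l)%:R <= (warehouse_cap I l)%:~R :> R.
Proof.
have := reserve_le (stock_capacity I l) (eps_capacity l).
rewrite /warehouse_cap intrB -[(capacity I l)%:Z%:~R]/((capacity I l)%:R).
by rewrite -[(n * g)%:Z%:~R]/((n * g)%:R); lra.
Qed.

Lemma product_cap_ge i : supply I i <> None ->
  (1 - eps) * supply_cap R I i <= (product_cap I i)%:~R :> R.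
Proof.
rewrite /supply_cap /product_cap; case E : (supply I i) => [C|//] _.
have := reserve_le (stock_supply E) (eps_supply E).
rewrite intrB -[C%:Z%:~R]/(C%:R : R) -[(L * g)%:Z%:~R]/((L * g)%:R).
by lra.
Qed.

Lemma cap_value_ge k :
  (1 - eps) * (\sum_l ((queue I O k).1 l)%:~R * (capacity I l)%:R +
    \sum_i ((queue I O k).2 i)%:~R * supply_cap R I i) <= (cap_value I O k)%:~R.
Proof.
have [a0 b0] := queue_ge0 I O k.
rewrite /cap_value intrD !rmorph_sum mulrDr !mulr_sumr /=; apply: lerD; apply: ler_sum => x _.
  by rewrite mulrCA intrM ler_wpM2l ?ler0z // warehouse_cap_ge.
rewrite mulrCA intrM; case E : (supply I x) => [C|].
  by rewrite ler_wpM2l ?ler0z // product_cap_ge ?E.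
by rewrite (queue2_unlimited R) // !mul0r.
Qed.

(** The one-period profit of [d0] enters the target because the error of the scheme is a multiple of
    it. The dual value covers it too: the load of one period is at most 1 and hence fits every
    capacity and supply. *)
Lemma target_le k : (0 < T)%N ->
  V * Den * ((1 - eps) * Num.max (OPT R I) (rprofit R I d0)) <=
  T%:R * plan_gain R I O k + U * (cap_value I O k)%:~R.
Proof.
move=> T0; have e1 : 0 <= 1 - eps by rewrite subr_ge0.
have [a0 b0] := queue_ge0 I O k.
have p0 := price_den_gt0 R O Iv; have U0 : 0 <= U by rewrite ler0z ltW.
have g0 := plan_gain_ge0 R O Iv k.
have T1 : 1 <= T%:R :> R by rewrite (ler_nat R 1).
pose A : R := \sum_l ((queue I O k).1 l)%:~R * (capacity I l)%:R.
pose B : R := \sum_i ((queue I O k).2 i)%:~R * supply_cap R I i.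
suff h : V * Den * Num.max (OPT R I) (rprofit R I d0) <= T%:R * plan_gain R I O k + U * (A + B).
  rewrite mulrCA; apply: le_trans (ler_wpM2l e1 h) _; rewrite mulrDr lerD //.
    by rewrite ler_piMl ?mulr_ge0 // lerBlDr lerDl.
  by rewrite mulrCA ler_wpM2l // cap_value_ge.
rewrite maxr_pMr; last by rewrite mulr_ge0 ?ltW.
rewrite ge_max; apply/andP; split.
  have v0 : 0 < (G * weight n L T)%:Z * base_den I O by rewrite -(ltr0z R).
  rewrite addrC; apply: (OPT_dual R Iv Is IO v0 (ltW p0) a0 b0).
  by move=> i; apply: (queue2_unlimited R O Iv).
have := sum_gain_opt R Iv IO ((G * weight n L T)%:Z * base_den I O) (price_den I O)
  (queue I O k) d0.
rewrite -/(plan_gain R I O k) sum_queue_price lerBlDr => h; apply: le_trans h _.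
apply: lerD; first by rewrite ler_peMl.
rewrite ler_wpM2l //; apply: lerD; apply: ler_sum => x _.
  rewrite ler_wpM2l ?ler0z //; apply: le_trans (sum_rload_warehouse R Iv _ _) _.
  by case: Iv => -[_ _ K0 _] _ _ _; rewrite (ler_nat R 1).
case E : (supply I x) => [C|]; last by rewrite (queue2_unlimited R) // !mul0r.
rewrite ler_wpM2l ?ler0z //; apply: le_trans (sum_rload_product R Iv _ _) _.
by case: Iv => -[_ _ _ C0] _ _ _; rewrite /supply_cap E (ler_nat R 1) (C0 x).
Qed.

(** As the potential is nonnegative, the average profit misses the target by at most
    [W sqwidth / (2 weight)], which is at most [W / (4 (T + 1))] by the choice of [weight]. *)
Lemma total_profit_ge : (0 < T)%N ->
  (1 - eps - (4 * T.+1%:R)^-1) * Num.max (OPT R I) (rprofit R I d0) <= total_profit.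
Proof.
move=> T0; set D := Num.max _ _.
have D0 : 0 <= D by rewrite le_max OPT_ge0.
have := potential_le Iv N (fun k => target_le k T0); rewrite -/D.
have : 0 <= (potential I O N)%:~R :> R.
  by rewrite ler0z addr_ge0 // sumr_ge0 // => x _; apply: sqr_ge0.
have p0 := price_den_gt0 R O Iv; have U0 : 0 <= U by rewrite ler0z ltW.
move=> /(mulr_ge0 U0) h1 /(le_trans h1) {h1}.
pose X := (1 - eps) * D; rewrite -/X.
have -> : \sum_(k < N) (T%:R * rprofit R I (plans k) - X) = N%:R * (total_profit - X).
  rewrite sumrB -mulr_sumr -total_profitE sumr_const card_ord -[X *+ N]mulr_natl.
  by rewrite mulrBr [total_profit * _]mulrC.
set W := rprofit R I d0.
have W0 : 0 <= W.
  rewrite -(pmulr_rge0 _ Den0) -(@pmulr_rge0 _ bden) ?ltr0z ?base_den_gt0 //.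
  by rewrite -base_num_offer ler0z (base_num_ge0 R).
have bD : 0 < bden * Den by rewrite mulr_gt0 // ltr0z base_den_gt0.
(* If nothing can be earned in one period, the target is 0. *)
have [bn|bn] := eqVneq (base_num I O) 0.
  move=> _; have WE : W = 0.
    apply/eqP; have := base_num_offer R I O; rewrite bn => /esym/eqP.
    by rewrite mulrA mulf_eq0 gt_eqF.
  have DE : D = 0.
    have := OPT_le_base; rewrite -/W WE mulr0 => o0.
    by rewrite /D -/W WE; apply/max_idPr.
  rewrite DE mulr0 -sum_inc mulr_ge0 //; do 2![apply: sumr_ge0 => ? _]; exact: inc_ge0.
have UE : U = bden * Den * W.
  by rewrite /price_den (negPf bn) -mulrA -base_num_offer.
rewrite UE VE => h.
have {}h : 0 <= (G%:R * G%:R * N%:R * (bden * Den)) *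
    (2 * (weight n L T)%:R * (total_profit - X) + W * (sqwidth n L T)%:R).
  have e1 : (N * (n + L))%:R = N%:R * (n + L)%:R :> R := natrM _ _ _.
  have e2 : (G * T)%:R = G%:R * T%:R :> R := natrM _ _ _.
  have e4 : (sqwidth n L T)%:R = (n + L)%:R * (T%:R * T%:R) :> R.
    by rewrite -!natrM.
  apply: le_trans h _; rewrite e1 e2 e4 le_eqVlt; apply/orP; left; apply/eqP; ring.
have {}h : 0 <= 2 * (weight n L T)%:R * (total_profit - X) + W * (sqwidth n L T)%:R.
  by move: h; rewrite pmulr_rge0 //; do !apply: mulr_gt0 => //.
have wE : (weight n L T)%:R = 2 * T.+1%:R * (sqwidth n L T)%:R + 1 :> R.
  by rewrite /weight; move: (sqwidth n L T) => w; rewrite natrD !natrM.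
have WD : W <= D by rewrite le_max lexx orbT.
have t0 : 0 < T.+1%:R :> R by rewrite ltr0n.
have s0 : 0 <= (sqwidth n L T)%:R :> R by [].
rewrite mulrBl -/X lerBlDr -lerBlDl -(ler_pM2l (x := 4 * T.+1%:R)) ?mulr_gt0 //.
rewrite [leRHS]mulrA divff ?mul1r; last by rewrite gt_eqF ?mulr_gt0.
apply: le_trans WD; rewrite -(ler_pM2l weight0) -subr_ge0.
have hT := mulr_ge0 (ltW t0) h.
rewrite (_ : _ - _ = 2 * (T.+1%:R * (2 * (weight n L T)%:R * (total_profit - X) +
  W * (sqwidth n L T)%:R)) + W); first by rewrite addr_ge0 ?mulr_ge0.
by rewrite !wE; ring.
Qed.

End Tight.

Lemma guarantee : beta R I * OPT R I <= policy_value I (plan_policy R N plans c).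
Proof.
have O0 := OPT_ge0; have v0 := value_ge0.
have le_sqrt0 x : 0 <= Num.sqrt x :> R by apply: sqrtr_ge0.
pose eps := Num.max (Num.sqrt (oratio R n (Kmin I))) (Num.sqrt (oratio R L (Cmin I))).
have eps0 : 0 <= eps by rewrite le_max le_sqrt0.
have -> : beta R I = 1 - 2 * eps by [].
(* A nonpositive factor asks only for a nonnegative profit. *)
have [b0|b0] := leP (1 - 2 * eps) 0.
  by apply: le_trans v0; rewrite mulr_le0_ge0.
have eps1 : eps <= 1 by lra.
have small x : x <= Num.sqrt (oratio R n (Kmin I)) ^+ 2 \/
    x <= Num.sqrt (oratio R L (Cmin I)) ^+ 2 -> x <= eps ^+ 2.
  case=> h; apply: le_trans h _; rewrite lerXn2r ?nnegrE // le_max lexx ?orbT //.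
have oratio_le a k k' : (0 < k <= k')%N -> a%:R / k'%:R <= a%:R / k%:R :> R.
  move=> /andP[k0 kk]; rewrite ler_wpM2l // lef_pV2 ?posrE ?ltr0n ?ler_nat //.
  exact: leq_trans kk.
case: (Iv) => -[_ _ K0 C0] _ _ _.
have epsK l : n%:R <= eps ^+ 2 * (capacity I l)%:R.
  have [|k kE kl] := @big_omin _ (fun l => Some (capacity I l)) l (capacity I l) _ erefl.
    by move=> l' x [<-].
  rewrite -ler_pdivrMr ?ltr0n //; apply: small; left; rewrite /Kmin kE /=.
  by rewrite sqr_sqrtr ?divr_ge0 // oratio_le.
have epsC i C : supply I i = Some C -> L%:R <= eps ^+ 2 * C%:R.
  move=> iC; have [k kE kl] := @big_omin _ (supply I) i C C0 iC.
  rewrite -ler_pdivrMr ?ltr0n ?(C0 i) //; apply: small; right; rewrite /Cmin kE /=.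
  by rewrite sqr_sqrtr ?divr_ge0 // oratio_le.
clearbody eps; have [roomy_g maxg] := largest_roomyP I T.+1; rewrite -/g in roomy_g maxg.
have gT1 : (g <= T.+1)%N.
  by rewrite /stock; elim: T.+1 => //= k IH; case: ifP => // _; apply: leqW.
move: gT1; rewrite leq_eqVlt => /orP[/eqP gT|]; last rewrite ltnS => gT.
  rewrite value_ample ?gT ?leqnSn //; apply: le_trans (idle_guarantee gT).
  by rewrite ler_piMl //; lra.
(* As [g + 1] is not roomy, some capacity is below [n (g + 1)^2] or some supply below
   [L (g + 1)^2]. *)
have big_eps : 1 < eps * g.+1%:R.
  suff h : 1 < eps ^+ 2 * (g.+1 * g.+1)%:R.
    rewrite ltNge; apply/negP => y1; have y0 : 0 <= eps * g.+1%:R by rewrite mulr_ge0.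
    by have := exprn_ile1 2 y0 y1; rewrite exprMn expr2 -[g.+1%:R ^+ 2]natrX leNgt h.
  have : ~~ roomy I g.+1 by apply: maxg; rewrite leqnn ltnS.
  rewrite negb_and !negb_forall => /orP[] /existsP[x].
    rewrite -ltnNge -(ltr_nat R) natrM => h.
    have := epsK x; have n1 : 0 < n%:R :> R by rewrite ltr0n (n_gt0 Iv).
    have : 0 < eps ^+ 2.
      by rewrite -(pmulr_lgt0 _ (x := (capacity I x)%:R)) ?ltr0n //; apply: lt_le_trans (epsK x).
    by move: (eps ^+ 2) h => e2; nra.
  case E : (supply I x) => [C|//]; rewrite -ltnNge -(ltr_nat R) natrM => h.
  have := epsC x C E; have n1 : 0 < L%:R :> R by rewrite ltr0n (L_gt0 Iv).
  have : 0 < eps ^+ 2.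
    by rewrite -(pmulr_lgt0 _ (x := C%:R)) ?ltr0n ?(C0 x) //; apply: lt_le_trans (epsC x C E).
  by move: (eps ^+ 2) h => e2; nra.
(* Here [eps < 1/2], so [eps (g + 1) > 1] forces [g + 1 > 2]. *)
have g2 : (2 <= g)%N.
  rewrite ltnNge; apply/negP; rewrite -(ler_nat R) => g1.
  by move: big_eps; rewrite -natr1; have : 0 <= g%:R :> R by []; nra.
have g2R : 2 <= g%:R :> R by rewrite (ler_nat R 2).
have T0 : (0 < T)%N by lia.
have h1 := total_profit_ge eps0 eps1 epsK epsC T0.
have h2 := value_safe g2.
set D := Num.max _ _ in h1.
have D0 : 0 <= D by rewrite le_max O0.
have OD : OPT R I <= D by rewrite le_max lexx.
apply: le_trans (ler_wpM2l (ltW b0) OD) _; apply: le_trans h2.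
have gTR : g%:R + 1 <= T.+1%:R :> R by rewrite natr1 ler_nat ltnS.
have T1 : 0 < T.+1%:R :> R by rewrite ltr0n.
rewrite -natr1 in big_eps.
have e1 : (4 * T.+1%:R)^-1 <= eps / 4.
  have hT : eps * (g%:R + 1) <= eps * T.+1%:R by apply: ler_wpM2l.
  by rewrite -[leLHS]mul1r ler_pdivrMr; [lra | rewrite mulr_gt0].
(* From [g >= 2] follows [g + 1 <= 3 (g - 1)], hence [3 eps (g - 1) > 1]. *)
have e2 : (4 * (g%:R - 1))^-1 <= 3 / 4 * eps.
  have hg : eps * 2 <= eps * g%:R by apply: ler_wpM2l.
  by rewrite -[leLHS]mul1r ler_pdivrMr; lra.
have h3 : (1 - 5 / 4 * eps) * D <= total_profit.
  by apply: le_trans h1; rewrite ler_wpM2r //; move: e1; set z := _^-1; lra.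
move: e2; set z := (4 * (g%:R - 1))^-1 => e2; have h4 : 0 <= 1 - z by lra.
apply: le_trans (ler_wpM2l h4 h3); rewrite mulrA ler_wpM2r //.
nra.
Qed.

End Guarantee.

Local Open Scope nat_scope.

(** * The algorithm runs in polynomial time *)

(** Situations range over all instances and oracles at once, so that programs and exponents are
    uniform. Validity and the specification of the oracle are what bounds the lengths of its
    answers. *)
Record setting := Setting {
  sn : nat; sm : nat; sL : nat; sT : nat;
  sI : instance sn sm sL sT;
  sO : data -> data;
  s_valid : valid sI;
  s_oracle : oracle_for sI sO
}.

Definition has_input (C : context) (s : situation C -> setting) : Prop :=
  [/\ forall a, oracle a = sO (s a), forall a, input_size (sI (s a)) <= measure a
    & ptime (fun a => enc_instance (sI (s a)))].

Lemma has_input_refines C C' h s :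
  @refines C' C h -> has_input s -> has_input (fun x => s (h x)).
Proof.
move=> hC [Ho Hm Hp]; have [ho hm _ _] := hC; split=> [x|x|].
- by rewrite ho Ho.
- by rewrite hm Hm.
- exact: (ptime_refines hC Hp).
Qed.

Lemma ptime_component k C x : @ptime C x -> @ptime C (fun a => data_nth (x a) k).
Proof.
elim: k x => [|k IH] x px; first exact: ptime_fst.
apply: eq_ptime (IH _ (ptime_snd px)) => a.
by rewrite /data_nth iterSr.
Qed.

Lemma enc_rat_int (z : int) : enc_rat (z%:~R)%R = DPair (DInt z) (DInt 1).
Proof. by rewrite /enc_rat numq_int denq_int. Qed.

(** * Access to the instance and to the oracle *)

Section Input.
Variables (C : context) (s : situation C -> setting).
Hypothesis H : has_input s.

Local Notation nn := (fun a => sn (s a)).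
Local Notation mm := (fun a => sm (s a)).
Local Notation LL := (fun a => sL (s a)).
Local Notation TT := (fun a => sT (s a)).

Lemma bound_input (f : situation C -> nat) :
  (forall a, f a <= input_size (sI (s a))) -> polybound (@measure C) f.
Proof.
move=> fi; have [_ Hm _] := H.
apply: polybound_leq (polybound_id _) => a; exact: leq_trans (fi a) (Hm a).
Qed.

Lemma bound_n : polybound (@measure C) nn.
Proof. by apply: bound_input => a; rewrite /input_size; lia. Qed.
Lemma bound_m : polybound (@measure C) mm.
Proof. by apply: bound_input => a; rewrite /input_size; lia. Qed.
Lemma bound_L : polybound (@measure C) LL.
Proof. by apply: bound_input => a; rewrite /input_size; lia. Qed.
Lemma bound_T : polybound (@measure C) TT.
Proof. by apply: bound_input => a; rewrite /input_size; lia. Qed.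
Lemma bound_bits : polybound (@measure C) (fun a => choice_bits (sI (s a))).
Proof. by apply: bound_input => a; rewrite /input_size; lia. Qed.

Let pI : ptime (fun a => enc_instance (sI (s a))).
Proof. by case: H. Qed.

Lemma ptime_n : ptime (fun a => enc_nat (sn (s a))).
Proof. exact: (ptime_component 0 pI). Qed.
Lemma ptime_m : ptime (fun a => enc_nat (sm (s a))).
Proof. exact: (ptime_component 1 pI). Qed.
Lemma ptime_L : ptime (fun a => enc_nat (sL (s a))).
Proof. exact: (ptime_component 2 pI). Qed.
Lemma ptime_T : ptime (fun a => enc_nat (sT (s a))).
Proof. exact: (ptime_component 3 pI). Qed.

Variables (i : forall a, 'I_(sn (s a))) (j : forall a, 'I_(sm (s a)))
  (l : forall a, 'I_(sL (s a))).

Lemma ptime_capacity : ptime (fun a => enc_ord (l a)) ->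
  ptime (fun a => enc_nat (capacity (sI (s a)) (l a))).
Proof.
exact: (ptime_enc_fun_app bound_L (enc := fun=> enc_nat) (f := fun a => capacity (sI (s a)))
  (ptime_component 6 pI)).
Qed.

Lemma ptime_supply : ptime (fun a => enc_ord (i a)) ->
  ptime (fun a => enc_option enc_nat (supply (sI (s a)) (i a))).
Proof.
exact: (ptime_enc_fun_app bound_n (enc := fun=> enc_option enc_nat)
  (f := fun a => supply (sI (s a))) (ptime_component 7 pI)).
Qed.

Lemma ptime_profit : ptime (fun a => enc_ord (i a)) -> ptime (fun a => enc_ord (j a)) ->
  ptime (fun a => enc_ord (l a)) ->
  ptime (fun a => enc_rat (profit (sI (s a)) (i a) (j a) (l a))).
Proof.
move=> pi pj pl.
have p1 := ptime_enc_fun_app bound_n (enc := fun a => enc_fun (enc_fun enc_rat))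
  (f := fun a => profit (sI (s a))) (ptime_component 5 pI) pi.
have p2 := ptime_enc_fun_app bound_m (enc := fun a => enc_fun enc_rat)
  (f := fun a => profit (sI (s a)) (i a)) p1 pj.
exact: (ptime_enc_fun_app bound_L (enc := fun=> enc_rat)
  (f := fun a => profit (sI (s a)) (i a) (j a)) p2 pl).
Qed.

Lemma ptime_rate : ptime (fun a => enc_ord (j a)) ->
  ptime (fun a => enc_rat (rate (sI (s a)) (j a))).
Proof.
move=> pj; have p1 := ptime_enc_fun_app bound_m (enc := fun a => enc_fun enc_rat)
  (f := fun a => arrival (sI (s a))) (ptime_component 4 pI) pj.
(* If [T = 0], the row of arrival rates is empty and the default rate 0 is taken. *)
apply: eq_ptime (ptime_if (ptime_is_pair p1) (ptime_fst p1)
  (ptime_pair (ptime_lit C 0) (ptime_lit C 1))) => a /=.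
rewrite /rate; case: insubP => [t _ t0|].
  have -> : forall x, (if is_pair x then fst_data x else enc_rat 0) =
      if is_pair x then data_nth x 0 else enc_rat 0 by [].
  rewrite -t0 data_nth_enc_fun; case E : (enc_fun _ _) => [z|//].
  have := congr1 is_pair (data_nth_enc_fun enc_rat (arrival (sI (s a)) (j a)) t).
  by rewrite E t0.
rewrite -leqNgt leqn0 => /eqP T0; rewrite ifN //.
by rewrite /enc_fun [enum _]size0nil ?size_enum_ord.
Qed.

(** The choice model is not part of the encoded instance; it is read by an evaluation query, whose
    answer has at most [n] entries of [choice_bits] each. *)
Lemma ptime_phi (S : forall a, {set 'I_(sn (s a))}) :
  ptime (fun a => enc_set (S a)) ->
  ptime (fun a => enc_ord (i a)) -> ptime (fun a => enc_ord (j a)) ->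
  ptime (fun a => enc_rat (choice_prob (sI (s a)) (i a) (j a) (S a))).
Proof.
move=> pS pi pj; have [Ho _ _] := H.
pose Q a := enc_seq [:: enc_nat 0; enc_ord (j a); enc_set (S a)].
have pQ : ptime Q.
  exact: ptime_pair (ptime_nat C 0) (ptime_pair pj (ptime_pair pS (ptime_lit C 0))).
have ansE a : oracle a (Q a) =
    enc_fun enc_rat (fun i => choice_prob (sI (s a)) i (j a) (S a)).
  by rewrite Ho; case: (s_oracle (s a)) => h _; apply: h.
have pA : ptime (fun a => enc_fun enc_rat (fun i => choice_prob (sI (s a)) i (j a) (S a))).
  apply: (eq_ptime ansE (ptime_ask pQ _)).
  apply: (@polybound_leq _ _ _ (fun a => sn (s a) * (choice_bits (sI (s a)) + 1) + 2)).
    move=> a; rewrite ansE; apply: leq_trans (@enc_seq_size _ (choice_bits (sI (s a))) _) _.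
      have [_ _ _ cb] := s_valid (s a).
      by elim: (enum _) => //= i' r IH x [<-|/IH].
    by rewrite size_map size_enum_ord addn1.
  apply: polyboundD; last exact: polybound_cst.
  apply: polyboundM; first exact: bound_n.
  exact: polyboundD bound_bits (polybound_cst _ _).
exact: (ptime_enc_fun_app bound_n (enc := fun=> enc_rat) (f := fun a i =>
  choice_prob (sI (s a)) i (j a) (S a)) pA pi).
Qed.

Variable R : realType.

Lemma ptime_best (rho : forall a, 'I_(sn (s a)) -> int) :
  @ptime_family C nn (fun a i => DInt (rho a i)) -> ptime (fun a => enc_ord (j a)) ->
  ptime (fun a => enc_set (best (sI (s a)) (sO (s a)) (j a) (rho a))).
Proof.
move=> pr pj; have [Ho _ _] := H.
have pQ : ptime (fun a => query (j a) (rho a)).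
  apply: (ptime_pair (ptime_nat C 1) (ptime_pair pj (ptime_pair _ (ptime_lit C 0)))).
  apply: (ptime_enc_fun ptime_n bound_n (enc := fun=> enc_rat)) => C' h k hC pk.
  apply: eq_ptime (ptime_pair (pr C' h k hC pk) (ptime_lit C' 1)) => x.
  by rewrite enc_rat_int.
have ansE a : oracle a (query (j a) (rho a)) =
    enc_set (best (sI (s a)) (sO (s a)) (j a) (rho a)).
  by rewrite Ho; have [] := bestP R (s_valid (s a)) (s_oracle (s a)) (j a) (rho a).
apply: (eq_ptime ansE (ptime_ask pQ _)).
apply: (@polybound_leq _ _ _ (fun a => sn (s a) * 3 + 2)).
  move=> a; rewrite ansE; apply: leq_trans (@enc_seq_size _ 2 _) _.
    by elim: (enum _) => //= i' r IH x [<-|/IH//]; case: (i' \in _).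
  by rewrite size_map size_enum_ord.
apply: polyboundD; last exact: polybound_cst.
by apply: polyboundM; [exact: bound_n | exact: polybound_cst].
Qed.

End Input.

Definition enc_source L (x : int * option 'I_L) : data :=
  DPair (DInt x.1) (enc_option (@enc_ord L) x.2).

Definition enc_prices n L (q : prices n L) : data :=
  DPair (enc_fun DInt q.1) (enc_fun DInt q.2).

(** The running maximum is always 0 or one of the given values, so its size does not accumulate. *)
Lemma ptime_source C (L : situation C -> nat) (val : forall a, 'I_(L a) -> int) :
  @ptime C (fun a => enc_nat (L a)) -> polybound (@measure C) L ->
  @ptime_family C L (fun a l => DInt (val a l)) ->
  @ptime C (fun a => enc_source (source (val a))).
Proof.
move=> pL bL pv; have [t tp tP] := family_size bL pv.
pose F a (x : int * option 'I_(L a)) (l : 'I_(L a)) :=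
  if (x.1 < val a l)%R then (val a l, Some l) else x.
apply: (@ptime_enum _ _ pL bL (fun a r => enc_source (foldl (@F a) (0%R, None) r))).
- exact: ptime_pair (ptime_lit C 0) (ptime_lit C 0).
- exists (fun a => t a + L a + 10).
    by do !(apply: polyboundD => //); apply: polybound_cst.
  move=> a r _; suff : foldl (@F a) (0%R, None) r = (0%R, None) \/
      exists l, foldl (@F a) (0%R, None) r = (val a l, Some l).
    case=> [->|[l ->]]; first by apply: (@leq_trans 5) => //; lia.
    have -> : data_size (enc_source (val a l, Some l)) =
      (data_size (DInt (val a l)) + (data_size (enc_nat l) + 2).+1).+1 by [].
    by have := tP a l; have := data_size_nat l; have := ltn_ord l; lia.
  elim/last_ind: r => [|r l IH]; first by left.
  by rewrite foldl_rcons {1 3}/F; case: ifP => _ //; right; exists l.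
- move=> C' h l r hC pl pr.
  have pvl := pv C' h l hC pl.
  pose st x := foldl (@F (h x)) (0%R, None) (r x).
  have p1 : ptime (fun x => DInt (st x).1) by exact: (ptime_fst pr).
  have lt x : ~~ (val (h x) (l x) <= (st x).1)%R = ((st x).1 < val (h x) (l x))%R.
    by rewrite -ltNge.
  apply: (eq_ptime _ (ptime_if (ptime_neg (ptime_leqz pvl p1))
    (ptime_pair pvl (ptime_pair pl (ptime_lit C' 0))) pr)) => x.
  by rewrite lt foldl_rcons -/(st x) /F; case: ifP.
Qed.

Lemma ptime_num_den C f : @ptime C (fun a => enc_rat (f a)) ->
  @ptime C (fun a => DInt (numq (f a))) /\ @ptime C (fun a => DInt (denq (f a))).
Proof. by move=> pf; split; [apply: (ptime_fst pf) | apply: (ptime_snd pf)]. Qed.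

Section Offers.
Variables (C : context) (s : situation C -> setting).
Hypothesis H : has_input s.

Lemma ptime_common_den : ptime (fun a => DInt (common_den (sI (s a)))).
Proof.
apply: (ptime_prodz (ptime_n H) (bound_n H)) => C1 h1 i hC1 pi.
have H1 := has_input_refines hC1 H.
apply: (ptime_prodz (ptime_m H1) (bound_m H1)) => C2 h2 j hC2 pj.
have H2 := has_input_refines hC2 H1.
apply: (ptime_prodz (ptime_L H2) (bound_L H2)) => C3 h3 l hC3 pl.
have H3 := has_input_refines hC3 H2.
have pi' := ptime_refines hC3 (ptime_refines hC2 pi).
by have [] := ptime_num_den (ptime_profit H3 pi' (ptime_refines hC3 pj) pl).
Qed.

Variables (q : forall a, prices (sn (s a)) (sL (s a))) (i : forall a, 'I_(sn (s a))).
Hypothesis pq : ptime (fun a => enc_prices (q a)).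

Lemma ptime_price1 (l : forall a, 'I_(sL (s a))) :
  ptime (fun a => enc_ord (l a)) -> ptime (fun a => DInt ((q a).1 (l a))).
Proof.
exact: (ptime_enc_fun_app (bound_L H) (enc := fun=> DInt) (f := fun a => (q a).1) (ptime_fst pq)).
Qed.

Lemma ptime_price2 : ptime (fun a => enc_ord (i a)) ->
  ptime (fun a => DInt ((q a).2 (i a))).
Proof.
exact: (ptime_enc_fun_app (bound_n H) (enc := fun=> DInt) (f := fun a => (q a).2) (ptime_snd pq)).
Qed.

End Offers.

Lemma ptime_net C (s : situation C -> setting) v p
    (q : forall a, prices (sn (s a)) (sL (s a))) j i l : has_input s ->
  @ptime C (fun a => DInt (v a)) -> @ptime C (fun a => DInt (p a)) ->
  @ptime C (fun a => enc_prices (q a)) -> @ptime C (fun a => enc_ord (j a)) ->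
  @ptime C (fun a => enc_ord (i a)) -> @ptime C (fun a => enc_ord (l a)) ->
  @ptime C (fun a => DInt (net (sI (s a)) (v a) (p a) (q a) (j a) (i a) (l a))).
Proof.
move=> H pv pp pq pj pi pl.
have [pn pd] := ptime_num_den (ptime_profit H pi pj pl).
apply: ptime_subz.
  apply: (ptime_mulz pv); apply: (ptime_mulz pn).
  exact: ptime_divz (ptime_common_den H) pd.
apply: (ptime_mulz pp).
exact: ptime_addz (ptime_price1 H pq pl) (ptime_price2 H pq pi).
Qed.

Lemma ptime_sourcing C (s : situation C -> setting) v p
    (q : forall a, prices (sn (s a)) (sL (s a))) j i : has_input s ->
  @ptime C (fun a => DInt (v a)) -> @ptime C (fun a => DInt (p a)) ->
  @ptime C (fun a => enc_prices (q a)) -> @ptime C (fun a => enc_ord (j a)) ->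
  @ptime C (fun a => enc_ord (i a)) ->
  @ptime C (fun a => enc_source (source (net (sI (s a)) (v a) (p a) (q a) (j a) (i a)))).
Proof.
move=> H pv pp pq pj pi; apply: (ptime_source (ptime_L H) (bound_L H)) => C' h l hC pl.
exact: (ptime_net (has_input_refines hC H) (ptime_refines hC pv) (ptime_refines hC pp)
  (ptime_refines hC pq) (ptime_refines hC pj) (ptime_refines hC pi) pl).
Qed.

Lemma ptime_reward C (s : situation C -> setting) v p
    (q : forall a, prices (sn (s a)) (sL (s a))) j i : has_input s ->
  @ptime C (fun a => DInt (v a)) -> @ptime C (fun a => DInt (p a)) ->
  @ptime C (fun a => enc_prices (q a)) -> @ptime C (fun a => enc_ord (j a)) ->
  @ptime C (fun a => enc_ord (i a)) ->
  @ptime C (fun a => DInt (reward (sI (s a)) (v a) (p a) (q a) (j a) (i a))).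
Proof.
by move=> H pv pp pq pj pi; exact: (ptime_fst (ptime_sourcing H pv pp pq pj pi)).
Qed.

Section Rounds.
Variable R : realType.

Lemma ptime_assortment C (s : situation C -> setting) v p
    (q : forall a, prices (sn (s a)) (sL (s a))) j : has_input s ->
  @ptime C (fun a => DInt (v a)) -> @ptime C (fun a => DInt (p a)) ->
  @ptime C (fun a => enc_prices (q a)) -> @ptime C (fun a => enc_ord (j a)) ->
  @ptime C (fun a => enc_set (best (sI (s a)) (sO (s a)) (j a)
    (reward (sI (s a)) (v a) (p a) (q a) (j a)))).
Proof.
move=> H pv pp pq pj; apply: (ptime_best H R _ pj) => C' h i hC pi.
exact: (ptime_reward (has_input_refines hC H) (ptime_refines hC pv) (ptime_refines hC pp)
  (ptime_refines hC pq) (ptime_refines hC pj) pi).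
Qed.

Lemma ptime_price0 C (s : situation C -> setting) : has_input s ->
  @ptime C (fun a => enc_prices (@price0 (sn (s a)) (sL (s a)))).
Proof.
move=> H; apply: ptime_pair.
  by apply: (ptime_enc_fun (ptime_L H) (bound_L H) (enc := fun=> DInt)) => C' *; apply: ptime_lit.
by apply: (ptime_enc_fun (ptime_n H) (bound_n H) (enc := fun=> DInt)) => C' *; apply: ptime_lit.
Qed.

Lemma ptime_base_phi C (s : situation C -> setting) i j : has_input s ->
  @ptime C (fun a => enc_ord (i a)) -> @ptime C (fun a => enc_ord (j a)) ->
  @ptime C (fun a => enc_rat (choice_prob (sI (s a)) (i a) (j a)
    (base (sI (s a)) (sO (s a)) (j a)))).
Proof.
move=> H pi pj; apply: (ptime_phi H _ pi pj).
exact: (ptime_assortment H (ptime_lit C 1) (ptime_lit C 0) (ptime_price0 H) pj).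
Qed.

Lemma ptime_base_den C (s : situation C -> setting) : has_input s ->
  @ptime C (fun a => DInt (base_den (sI (s a)) (sO (s a)))).
Proof.
move=> H; apply: (ptime_prodz (ptime_m H) (bound_m H)) => C1 h1 j hC1 pj.
have H1 := has_input_refines hC1 H; apply: ptime_mulz.
  by have [] := ptime_num_den (ptime_rate H1 pj).
apply: (ptime_prodz (ptime_n H1) (bound_n H1)) => C2 h2 i hC2 pi.
have H2 := has_input_refines hC2 H1.
by have [] := ptime_num_den (ptime_base_phi H2 pi (ptime_refines hC2 pj)).
Qed.

Lemma ptime_price_den C (s : situation C -> setting) : has_input s ->
  @ptime C (fun a => DInt (price_den (sI (s a)) (sO (s a)))).
Proof.
move=> H; have pu : ptime (fun a => DInt (base_num (sI (s a)) (sO (s a)))).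
  apply: (ptime_sumz (ptime_m H) (bound_m H)) => C1 h1 j hC1 pj.
  have H1 := has_input_refines hC1 H.
  apply: (ptime_sumz (ptime_n H1) (bound_n H1)) => C2 h2 i hC2 pi.
  have H2 := has_input_refines hC2 H1; have pj2 := ptime_refines hC2 pj.
  have [rn rd] := ptime_num_den (ptime_rate H2 pj2).
  have [fn fd] := ptime_num_den (ptime_base_phi H2 pi pj2).
  have pw := ptime_reward H2 (ptime_lit C2 1) (ptime_lit C2 0) (ptime_price0 H2) pj2 pi.
  exact: ptime_mulz (ptime_mulz (ptime_mulz rn fn) pw)
    (ptime_divz (ptime_base_den H2) (ptime_mulz rd fd)).
apply: (eq_ptime _ (ptime_if (ptime_eqz pu (ptime_lit C 0)) (ptime_lit C 1) pu)) => a.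
by rewrite /price_den; case: ifP.
Qed.

Lemma ptime_sqwidth C (s : situation C -> setting) : has_input s ->
  @ptime C (fun a => enc_nat (sqwidth (sn (s a)) (sL (s a)) (sT (s a)))).
Proof.
move=> H; have pT := ptime_T H.
exact: ptime_muln (ptime_addn (ptime_n H) (ptime_L H)) (ptime_muln pT pT).
Qed.

Lemma ptime_weight C (s : situation C -> setting) : has_input s ->
  @ptime C (fun a => enc_nat (weight (sn (s a)) (sL (s a)) (sT (s a)))).
Proof.
move=> H; apply: eq_ptime (ptime_addn (ptime_muln (ptime_muln (ptime_nat C 2)
  (ptime_addn (ptime_T H) (ptime_nat C 1))) (ptime_sqwidth H)) (ptime_nat C 1)) => a.
by rewrite /weight !addn1.
Qed.

Lemma ptime_grid C (s : situation C -> setting) : has_input s ->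
  @ptime C (fun a => enc_nat (grid (sn (s a)) (sm (s a)) (sL (s a)))).
Proof.
move=> H; apply: eq_ptime (ptime_muln (ptime_muln (ptime_nat C 2)
  (ptime_addn (ptime_m H) (ptime_nat C 1))) (ptime_addn (ptime_n H) (ptime_L H))) => a.
by rewrite /grid addn1.
Qed.

Lemma ptime_rounds C (s : situation C -> setting) : has_input s ->
  @ptime C (fun a => enc_nat (rounds (sn (s a)) (sL (s a)) (sT (s a)))).
Proof.
move=> H; apply: ptime_addn; last exact: (ptime_nat C 1).
apply: (ptime_addn (ptime_muln (ptime_muln (ptime_nat C 8) (ptime_weight H)) (ptime_T H))).
exact: (ptime_muln (ptime_nat C 4) (ptime_sqwidth H)).
Qed.

Lemma bound_grid C (s : situation C -> setting) : has_input s ->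
  polybound (@measure C) (fun a => grid (sn (s a)) (sm (s a)) (sL (s a))).
Proof.
move=> H; apply: polyboundM; last exact: (polyboundD (bound_n H) (bound_L H)).
apply: polyboundM; first exact: polybound_cst.
apply: polybound_leq (polyboundD (bound_m H) (polybound_cst _ 1)) => a.
by rewrite addn1.
Qed.

Lemma bound_rounds C (s : situation C -> setting) : has_input s ->
  polybound (@measure C) (fun a => rounds (sn (s a)) (sL (s a)) (sT (s a))).
Proof.
move=> H; have bT := bound_T H; have b1 := polybound_cst (@measure C).
have bs : polybound (@measure C) (fun a => sqwidth (sn (s a)) (sL (s a)) (sT (s a))).
  exact: polyboundM (polyboundD (bound_n H) (bound_L H)) (polyboundM bT bT).
have bw : polybound (@measure C) (fun a => weight (sn (s a)) (sL (s a)) (sT (s a))).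
  apply: polyboundD; last exact: (b1 1).
  apply: polyboundM; last exact: bs.
  apply: polyboundM; first exact: (b1 2).
  by apply: polybound_leq (polyboundD bT (b1 1)) => a; rewrite addn1.
apply: polyboundD; last exact: (b1 1).
exact: (polyboundD (polyboundM (polyboundM (b1 8) bw) bT) (polyboundM (b1 4) bs)).
Qed.

End Rounds.

Definition has_index (x : data) (k : nat) : bool :=
  is_pair x && (int_of_data (fst_data x) == k%:Z)%R.

Lemma has_indexE p (o : option 'I_p) (k : 'I_p) :
  has_index (enc_option (@enc_ord p) o) k = (o == Some k).
Proof. by case: o. Qed.

Lemma ptime_has_index C x k : @ptime C x -> @ptime C (fun a => enc_nat (k a)) ->
  @ptime C (fun a => enc_nat (has_index (x a) (k a))).
Proof.
move=> px pk; apply: ptime_and (ptime_is_pair px) _.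
exact: (ptime_eqz (ptime_int_of_data (ptime_fst px)) pk).
Qed.

Lemma ptime_eq_some C p (o : forall a, option 'I_(p a)) (k : forall a, 'I_(p a)) :
  @ptime C (fun a => enc_option (@enc_ord (p a)) (o a)) ->
  @ptime C (fun a => enc_ord (k a)) -> @ptime C (fun a => enc_nat (o a == Some (k a))).
Proof.
by move=> po pk; apply: eq_ptime (ptime_has_index po pk) => a; rewrite has_indexE.
Qed.

Lemma ptime_option_nat C (o : situation C -> option nat) :
  @ptime C (fun a => enc_option enc_nat (o a)) ->
  @ptime C (fun a => enc_nat (isSome (o a))) /\ @ptime C (fun a => enc_nat (odflt 0 (o a))).
Proof.
move=> po; split; first by apply: eq_ptime (ptime_is_pair po) => a; case: (o a).
by apply: eq_ptime (ptime_fst po) => a; case: (o a).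
Qed.

Lemma ptime_roomy C (s : situation C -> setting) g : has_input s ->
  @ptime C (fun a => enc_nat (g a)) -> @ptime C (fun a => enc_nat (roomy (sI (s a)) (g a))).
Proof.
move=> H pg; apply: ptime_and.
  apply: (ptime_forall (ptime_L H) (bound_L H)) => C' h l hC pl.
  have H' := has_input_refines hC H; have pg' := ptime_refines hC pg.
  exact: (ptime_leq (ptime_muln (ptime_n H') (ptime_muln pg' pg')) (ptime_capacity H' pl)).
apply: (ptime_forall (ptime_n H) (bound_n H)) => C' h i hC pi.
have H' := has_input_refines hC H; have pg' := ptime_refines hC pg.
have [ps pc] := ptime_option_nat (ptime_supply H' pi).
apply: (eq_ptime _ (ptime_if ps
  (ptime_leq (ptime_muln (ptime_L H') (ptime_muln pg' pg')) pc) (ptime_nat C' 1))) => x.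
by case: (supply _ _).
Qed.

Lemma ptime_stock C (s : situation C -> setting) : has_input s ->
  @ptime C (fun a => enc_nat (stock (sI (s a)))).
Proof.
move=> H; apply: (@ptime_iter C (fun a => (sT (s a)).+1)
  (fun a i => enc_nat (largest_roomy (sI (s a)) i))).
- by apply: eq_ptime (ptime_addn (ptime_T H) (ptime_nat C 1)) => a; rewrite addn1.
- by apply: polybound_leq (polyboundD (bound_T H) (polybound_cst _ 1)) => a; rewrite addn1.
- exact: (ptime_nat C 0).
- exists (fun a => sT (s a) + 3) => [|a k kT].
    by apply: polyboundD; [exact: bound_T | exact: polybound_cst].
  apply: leq_trans (data_size_nat _) _.
  have : largest_roomy (sI (s a)) k <= k by elim: {kT} k => //= k IH; case: ifP => // _; apply: leqW.
  by lia.
- move=> C' h i hC _ pi pst; have H' := has_input_refines hC H.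
  have pi1 : ptime (fun x => enc_nat (i x).+1).
    by apply: eq_ptime (ptime_addn pi (ptime_nat C' 1)) => x; rewrite addn1.
  apply: (eq_ptime _ (ptime_if (ptime_roomy H' pi1) pi1 pst)) => x /=.
  by case: ifP.
Qed.

Lemma ptime_warehouse_cap C (s : situation C -> setting) l : has_input s ->
  @ptime C (fun a => enc_ord (l a)) -> @ptime C (fun a => DInt (warehouse_cap (sI (s a)) (l a))).
Proof.
move=> H pl; exact: (ptime_subz (ptime_capacity H pl) (ptime_muln (ptime_n H) (ptime_stock H))).
Qed.

Lemma ptime_product_cap C (s : situation C -> setting) i : has_input s ->
  @ptime C (fun a => enc_ord (i a)) -> @ptime C (fun a => DInt (product_cap (sI (s a)) (i a))).
Proof.
move=> H pi; have [ps pc] := ptime_option_nat (ptime_supply H pi).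
apply: (eq_ptime _ (ptime_if ps
  (ptime_subz pc (ptime_muln (ptime_L H) (ptime_stock H))) (ptime_T H))) => a.
by rewrite /product_cap; case: (supply _ _).
Qed.

(** * Computing the queues, the placement and the decisions *)

Section Queues.
Variable R : realType.

Lemma ptime_plan_value C (s : situation C -> setting) : has_input s ->
  @ptime C (fun a => DInt ((grid (sn (s a)) (sm (s a)) (sL (s a)) *
    weight (sn (s a)) (sL (s a)) (sT (s a)))%:Z * base_den (sI (s a)) (sO (s a)))%R).
Proof.
move=> H; exact: (ptime_mulz (ptime_muln (ptime_grid H) (ptime_weight H)) (ptime_base_den R H)).
Qed.

Lemma ptime_plan_set C (s : situation C -> setting) q j : has_input s ->
  @ptime C (fun a => enc_prices (q a)) -> @ptime C (fun a => enc_ord (j a)) ->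
  @ptime C (fun a => enc_set (plan (sI (s a)) (sO (s a)) (q a) (j a)).1).
Proof.
move=> H pq pj.
exact: (ptime_assortment R H (ptime_plan_value H) (ptime_price_den R H) pq pj).
Qed.

Lemma ptime_plan_route C (s : situation C -> setting) q j i : has_input s ->
  @ptime C (fun a => enc_prices (q a)) -> @ptime C (fun a => enc_ord (j a)) ->
  @ptime C (fun a => enc_ord (i a)) ->
  @ptime C (fun a => enc_option (@enc_ord (sL (s a)))
    ((plan (sI (s a)) (sO (s a)) (q a) (j a)).2 (i a))).
Proof.
move=> H pq pj pi; apply: eq_ptime (ptime_snd
  (ptime_sourcing H (ptime_plan_value H) (ptime_price_den R H) pq pj pi)) => a.
by rewrite /= ffunE.
Qed.

Lemma ptime_load C (s : situation C -> setting) q i l : has_input s ->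
  @ptime C (fun a => enc_prices (q a)) -> @ptime C (fun a => enc_ord (i a)) ->
  @ptime C (fun a => enc_ord (l a)) ->
  @ptime C (fun a => DInt (load (sI (s a)) (plan (sI (s a)) (sO (s a)) (q a)) (i a) (l a))).
Proof.
move=> H pq pi pl; apply: (ptime_sumz (ptime_m H) (bound_m H)) => C' h j hC pj.
have H' := has_input_refines hC H; have pq' := ptime_refines hC pq.
have pi' := ptime_refines hC pi; have pl' := ptime_refines hC pl.
have [rn rd] := ptime_num_den (ptime_rate H' pj).
have [fn fd] := ptime_num_den (ptime_phi H' (ptime_plan_set H' pq' pj) pi' pj).
have pe := ptime_eq_some (ptime_plan_route H' pq' pj pi') pl'.
have pg := ptime_muln (ptime_grid H') (ptime_T H').
apply: (eq_ptime _ (ptime_if pe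
  (ptime_divz (ptime_mulz pg (ptime_mulz rn fn)) (ptime_mulz rd fd)) (ptime_lit C' 0))) => x.
by case: ifP.
Qed.

Lemma ptime_step C (s : situation C -> setting) q : has_input s ->
  @ptime C (fun a => enc_prices (q a)) ->
  @ptime C (fun a => enc_prices (step (sI (s a)) (sO (s a)) (q a))).
Proof.
move=> H pq; apply: ptime_pair.
  apply: (ptime_enc_fun (ptime_L H) (bound_L H) (enc := fun=> DInt)) => C1 h1 l hC1 pl.
  have H1 := has_input_refines hC1 H; have pq1 := ptime_refines hC1 pq.
  apply: (ptime_maxz (ptime_lit C1 0)); apply: (ptime_addz (ptime_price1 H1 pq1 pl)).
  apply: ptime_subz; last exact: (ptime_mulz (ptime_grid H1) (ptime_warehouse_cap H1 pl)).
  apply: (ptime_sumz (ptime_n H1) (bound_n H1)) => C2 h2 i hC2 pi.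
  exact: (ptime_load (has_input_refines hC2 H1) (ptime_refines hC2 pq1) pi (ptime_refines hC2 pl)).
apply: (ptime_enc_fun (ptime_n H) (bound_n H) (enc := fun=> DInt)) => C1 h1 i hC1 pi.
have H1 := has_input_refines hC1 H; have pq1 := ptime_refines hC1 pq.
apply: (ptime_maxz (ptime_lit C1 0)); apply: (ptime_addz (ptime_price2 H1 pq1 pi)).
apply: ptime_subz; last exact: (ptime_mulz (ptime_grid H1) (ptime_product_cap H1 pi)).
apply: (ptime_sumz (ptime_L H1) (bound_L H1)) => C2 h2 l hC2 pl.
exact: (ptime_load (has_input_refines hC2 H1) (ptime_refines hC2 pq1) (ptime_refines hC2 pi) pl).
Qed.

(** Capacities are nonnegative, so a round adds at most the largest load [grid * T]. Queue lengths
    thus stay polynomial, as the iteration requires. *)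
Lemma queue_bound n m L T (I : instance n m L T) O k : valid I ->
  (forall l, `|(queue I O k).1 l|%N <= k * (grid n m L * T)) /\
  (forall i, `|(queue I O k).2 i|%N <= k * (grid n m L * T)).
Proof.
move=> Iv; elim: k => [//|k [IH1 IH2]]; rewrite queueS /step mulSn; split=> x /=.
  have /andP[_] := sum_load_warehouse R Iv (plan I O (queue I O k)) x.
  have : (0 <= (grid n m L)%:Z * warehouse_cap I x)%R by rewrite mulr_ge0 ?warehouse_cap_ge0.
  have := IH1 x; set Y := (_%:Z * _)%R; set S := (\sum_i _)%R.
  by set g := grid n m L * T; set k' := k * g; rewrite maxEle; case: ifP; lia.
have /andP[_] := sum_load_product R Iv (plan I O (queue I O k)) x.
have : (0 <= (grid n m L)%:Z * product_cap I x)%R by rewrite mulr_ge0 ?product_cap_ge0.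
have := IH2 x; set Y := (_%:Z * _)%R; set S := (\sum_l _)%R.
by set g := grid n m L * T; set k' := k * g; rewrite maxEle; case: ifP; lia.
Qed.

Lemma data_size_enc_fun p (A : Type) (enc : A -> data) (f : 'I_p -> A) t :
  (forall i, data_size (enc (f i)) <= t) -> data_size (enc_fun enc f) <= p * t.+1 + 2.
Proof.
move=> ft; have := @enc_seq_size [seq enc (f i) | i <- enum 'I_p] t.
rewrite size_map size_enum_ord; apply.
by elim: (enum _) => //= i r IH x [<-|/IH].
Qed.

Lemma ptime_queue C (s : situation C -> setting) k : has_input s ->
  @ptime C (fun a => enc_nat (k a)) -> polybound (@measure C) k ->
  @ptime C (fun a => enc_prices (queue (sI (s a)) (sO (s a)) (k a))).
Proof.
move=> H pk bk.
apply: (@ptime_iter C k (fun a i => enc_prices (queue (sI (s a)) (sO (s a)) i))) => //.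
- exact: ptime_price0.
- exists (fun a => (sL (s a) + sn (s a)) *
    (k a * (grid (sn (s a)) (sm (s a)) (sL (s a)) * sT (s a)) + 3) + 5).
    apply: polyboundD; last exact: polybound_cst.
    apply: polyboundM (polyboundD (bound_L H) (bound_n H)) _.
    apply: polyboundD; last exact: polybound_cst.
    by apply: (polyboundM bk); apply: (polyboundM (bound_grid H) (bound_T H)).
  move=> a i ik; set B := _ * (grid _ _ _ * _).
  have size_le z : `|z|%N <= B -> data_size (DInt z) <= B + 2.
    move=> zB; rewrite addn2; apply: data_size_DInt.
    by apply: leq_ltn_trans zB _; apply: ltn_expl.
  have [h1 h2] := queue_bound (sO (s a)) i (s_valid (s a)).
  have le1 x : x <= i * (grid (sn (s a)) (sm (s a)) (sL (s a)) * sT (s a)) -> x <= B.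
    by move=> h; apply: leq_trans h _; rewrite leq_mul2r ik orbT.
  have := data_size_enc_fun (enc := DInt) (fun l => size_le _ (le1 _ (h1 l))).
  have := data_size_enc_fun (enc := DInt) (fun i => size_le _ (le1 _ (h2 i))).
  by rewrite /enc_prices [data_size (DPair _ _)]/= mulnDl; lia.
- move=> C' h i hC _ _ pst.
  exact: (ptime_step (has_input_refines hC H) pst).
Qed.

Lemma bound_lt_rounds C (s : situation C -> setting) u : has_input s ->
  (forall a, u a < rounds (sn (s a)) (sL (s a)) (sT (s a))) -> polybound (@measure C) u.
Proof. by move=> H ur; apply: polybound_leq (bound_rounds H) => a; apply: ltnW. Qed.

Lemma ptime_stocking C (s : situation C -> setting) i l : has_input s ->
  @ptime C (fun a => enc_ord (i a)) -> @ptime C (fun a => enc_ord (l a)) ->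
  @ptime C (fun a => enc_nat (stocking (sI (s a)) (sO (s a)) (i a) (l a))).
Proof.
move=> H pi pl.
apply: (eq_ptime (fun a => esym (congr1 DInt (stockingE R (sO (s a)) (s_valid (s a)) (i a) (l a))))).
have pr := ptime_rounds H.
apply: ptime_addz (ptime_stock H); apply: (ptime_divz _ (ptime_muln pr (ptime_grid H))).
apply: (ptime_addz (ptime_muln (ptime_m H) pr)).
apply: (ptime_sumz pr (bound_rounds H)) => C' h k hC pk; have H' := has_input_refines hC H.
apply: (ptime_load H' _ (ptime_refines hC pi) (ptime_refines hC pl)).
by apply: (ptime_queue H' pk); apply: (bound_lt_rounds H') => x.
Qed.

Lemma ptime_placement C (s : situation C -> setting) : has_input s ->
  @ptime C (fun a => enc_placement (stocking (sI (s a)) (sO (s a)))).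
Proof.
move=> H; apply: (ptime_enc_fun (ptime_n H) (bound_n H)
  (enc := fun a => enc_fun enc_nat)) => C1 h1 i hC1 pi.
have H1 := has_input_refines hC1 H.
apply: (ptime_enc_fun (ptime_L H1) (bound_L H1) (enc := fun=> enc_nat)) => C2 h2 l hC2 pl.
exact: (ptime_stocking (has_input_refines hC2 H1) (ptime_refines hC2 pi) pl).
Qed.

Lemma data_nth_enc_history n m L (h : history n m L) t :
  data_nth (enc_history h) t = enc_event (nth None h t).
Proof.
rewrite data_nth_enc_seq; have [lt|ge] := ltnP t (size h).
  by rewrite (nth_map None).
by rewrite !nth_default ?size_map.
Qed.

Lemma sells_data n m L (i : 'I_n) (l : 'I_L) (e : event n m L) :
  sells i l e = has_index (data_nth (fst_data (enc_event e)) 2) i &&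
    has_index (data_nth (snd_data (data_nth (fst_data (enc_event e)) 1)) i) l.
Proof.
case: e => [[[j d] o]|//].
rewrite [data_nth _ 2]/(enc_option (@enc_ord n) o) [snd_data _]/(enc_fun _ d.2).
by rewrite data_nth_enc_fun !has_indexE; case: o.
Qed.

(** The count runs over all [T] periods; past the end of the history it meets the default event
    [None], which sells nothing. *)
Lemma ptime_sold C (s : situation C -> setting)
    (h : forall a, history (sn (s a)) (sm (s a)) (sL (s a))) i l :
  has_input s -> (forall a, size (h a) < sT (s a)) ->
  @ptime C (fun a => enc_history (h a)) ->
  @ptime C (fun a => enc_ord (i a)) -> @ptime C (fun a => enc_ord (l a)) ->
  @ptime C (fun a => enc_nat (sold (h a) (i a) (l a))).
Proof.
move=> H hT ph pi pl.
have soldE a : \sum_(t < sT (s a)) sells (i a) (l a) (nth None (h a) t) =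
    sold (h a) (i a) (l a).
  rewrite /sold -sumn_count -(big_mkord xpredT (fun t => sells (i a) (l a) (nth None (h a) t) : nat)).
  rewrite (big_cat_nat (leq0n (size (h a))) (ltnW (hT a))) /= [X in _ + X]big_nat_cond.
  rewrite [X in _ + X]big1 ?addn0 => [|t /andP[/andP[ht _] _]]; last first.
    by rewrite nth_default.
  by rewrite sumnE big_map (big_nth None).
apply: (eq_ptime (fun a => congr1 enc_nat (soldE a))).
apply: (ptime_sumn (ptime_T H) (bound_T H)) => C' r t hC pt.
have H' := has_input_refines hC H; have pi' := ptime_refines hC pi.
have pe := ptime_data_nth (ptime_refines hC ph) pt.
have {}pe : ptime (fun x => enc_event (nth None (h (r x)) (t x))).
  apply: eq_ptime (pe _) => [x|]; first by rewrite data_nth_enc_history.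
  by apply: polybound_leq (bound_T H') => x; apply: ltnW.
have p1 := ptime_fst pe.
apply: (eq_ptime (fun x => esym (congr1 (fun b : bool => enc_nat b) (sells_data _ _ _)))).
apply: ptime_and; first exact: (ptime_has_index (ptime_component 2 p1) pi').
apply: ptime_has_index (ptime_refines hC pl).
apply: (ptime_data_nth (ptime_snd (ptime_component 1 p1)) pi').
by apply: polybound_leq (bound_n H') => x; apply: ltnW.
Qed.

(** Queues and placement are recomputed from the instance at each decision, so the advice can be
    empty. *)
Lemma ptime_decide C (s : situation C -> setting)
    (h : forall a, history (sn (s a)) (sm (s a)) (sL (s a))) j u :
  has_input s -> (forall a, size (h a) < sT (s a)) ->
  (forall a, u a < rounds (sn (s a)) (sL (s a)) (sT (s a))) ->
  @ptime C (fun a => enc_history (h a)) -> @ptime C (fun a => enc_ord (j a)) ->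
  @ptime C (fun a => enc_nat (u a)) ->
  @ptime C (fun a => enc_decision (decide_rule (sI (s a)) (sO (s a)) (h a) (j a) (u a))).
Proof.
move=> H hT ur ph pj pu.
have pq := ptime_queue H pu (bound_lt_rounds H ur).
apply: ptime_pair; first exact: (ptime_plan_set H pq pj).
apply: (ptime_enc_fun (ptime_n H) (bound_n H)
  (enc := fun a => enc_option (@enc_ord (sL (s a))))) => C1 r i hC pi.
have H1 := has_input_refines hC H.
have pr := ptime_plan_route H1 (ptime_refines hC pq) (ptime_refines hC pj) pi.
apply: (@eq_ptime _ (fun x => if [exists l, ((plan (sI (s (r x))) (sO (s (r x)))
      (queue (sI (s (r x))) (sO (s (r x))) (u (r x))) (j (r x))).2 (i x) == Some l) &&
    (sold (h (r x)) (i x) l < stocking (sI (s (r x))) (sO (s (r x))) (i x) l)]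
  then enc_option (@enc_ord (sL (s (r x)))) ((plan (sI (s (r x))) (sO (s (r x)))
      (queue (sI (s (r x))) (sO (s (r x))) (u (r x))) (j (r x))).2 (i x)) else dnil)).
  by move=> x; rewrite /decide_rule /restrict [in RHS]ffunE /in_stock; case: ifP.
apply: (ptime_if _ pr (ptime_lit C1 0)).
apply: (ptime_exists (ptime_L H1) (bound_L H1)) => C2 r2 l hC2 pl.
have H2 := has_input_refines hC2 H1; have pi2 := ptime_refines hC2 pi.
apply: ptime_and; first exact: (ptime_eq_some (ptime_refines hC2 pr) pl).
apply: (eq_ptime _ (ptime_leq (ptime_addn
  (ptime_sold H2 (fun x => hT (r (r2 x))) (ptime_refines hC2 (ptime_refines hC ph)) pi2 pl)
  (ptime_nat C2 1)) (ptime_stocking H2 pi2 pl))) => x.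
by rewrite addn1.
Qed.

End Queues.

(** * The theorem *)

Definition input_context (A : Type) (s : A -> setting) (inp : A -> data) : context.
Proof.
refine (@Context A (fun a => sO (s a)) (fun a => input_size (sI (s a))) 1
  (fun a st => st 0 = inp a) _).
by move=> a st st' e <-; apply: e.
Defined.

Section InputContext.
Variables (A : Type) (s : A -> setting) (inp : A -> data).
Local Notation C := (input_context s inp).
Hypothesis inpb : polybound (fun a => input_size (sI (s a))) (fun a => data_size (inp a)).

Lemma ptime_input : @ptime C inp.
Proof. exact: (@ptime_var C 0). Qed.

Lemma ptime_program out : @ptime C out -> exists p d, forall a,
  computes_within (sO (s a)) p (inp a) (out a) ((input_size (sI (s a)) + 2) ^ d).
Proof.
move=> [so /(_ 1 (leqnn 1)) [p [t tp pP]]].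
have [d dP] : polybound (fun a => input_size (sI (s a))) (fun a => t a + (data_size (out a) + 2)).
  by apply: polyboundD => //; apply: polyboundD => //; apply: polybound_cst.
exists (Seq p (Assign 0 (EVar 1))), d => a.
have [k [st [pr st1 _ kt]]] := pP a (update (fun=> dnil) 0 (inp a)) erefl.
exists (k + (eval_cost st (EVar 1)).+1).+1, (update st 0 (st 1)); split.
- by apply: RunSeq pr _; apply: RunAssign.
- by rewrite /update eqxx.
- by apply: leq_trans (dP a); rewrite /= st1; lia.
Qed.

End InputContext.

(** The inputs of the policy programs, with the bound on the history that keeps their encoding
    polynomial. *)
Record arrival_setting := Arrival {
  a_setting : setting;
  a_history : history (sn a_setting) (sm a_setting) (sL a_setting);
  a_type : 'I_(sm a_setting);
  a_lt : size a_history < sT a_setting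
}.

Record draw_setting := Draw {
  d_arrival : arrival_setting;
  d_draw : nat;
  d_lt : d_draw < rounds (sn (a_setting d_arrival)) (sL (a_setting d_arrival))
    (sT (a_setting d_arrival))
}.

Lemma data_size_ord p (i : 'I_p) : data_size (enc_ord i) <= p + 2.
Proof. by apply: leq_trans (data_size_nat i) _; have := ltn_ord i; lia. Qed.

Lemma data_size_opt p (o : option 'I_p) : data_size (enc_option (@enc_ord p) o) <= p + 5.
Proof. by case: o => [i|] /=; [have := data_size_ord i | ]; rewrite ?trunc_log0 //=; lia. Qed.

Lemma data_size_event n m L (e : event n m L) :
  data_size (enc_event e) <= m + n * 3 + n * (L + 6) + n + 30.
Proof.
case: e => [[[j d] o]|]; last by rewrite /= trunc_log0; lia.
have -> : data_size (enc_event (Some (j, d, o))) =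
  ((data_size (enc_ord j) + (data_size (enc_decision d) +
    (data_size (enc_option (@enc_ord n) o) + 2).+1).+1).+1 + 2).+1 by [].
have -> : data_size (enc_decision d) =
  (data_size (enc_set d.1) + data_size (enc_fun (enc_option (@enc_ord L)) d.2)).+1 by [].
have := data_size_ord j; have := data_size_opt o.
have h1 : data_size (enc_set d.1) <= n * 3 + 2.
  by apply: data_size_enc_fun => i; case: (i \in d.1).
have h2 : data_size (enc_fun (enc_option (@enc_ord L)) d.2) <= n * (L + 6) + 2.
  apply: leq_trans (data_size_enc_fun (t := L + 5) _) _ => [i|].
    exact: data_size_opt.
  by rewrite -addnS.
by lia.
Qed.

Section Programs.
Variable R : realType.

Let a_stocking (a : arrival_setting) := stocking (sI (a_setting a)) (sO (a_setting a)).
Let a_input (a : arrival_setting) : data :=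
  policy_input (sI (a_setting a)) (@a_stocking a) dnil (@a_history a) (a_type a).
Let d_input (x : draw_setting) : data :=
  DPair (a_input (d_arrival x)) (enc_nat (d_draw x)).
Let size_of (a : arrival_setting) := input_size (sI (a_setting a)).

Lemma enc_instance_bound :
  polybound (fun s => input_size (sI s)) (fun s => data_size (enc_instance (sI s))).
Proof. by exists 1 => s; rewrite expn1 /input_size; lia. Qed.

Let place_context := input_context id (fun s => enc_instance (sI s)).

Lemma place_has_input : @has_input place_context id.
Proof. by split=> //; apply: ptime_input enc_instance_bound. Qed.

(** Time is measured against the instance alone, so the other inputs must be polynomially long: the
    placement because it is the output of a polynomial-time program, the history because it has
    fewer than [T] events. *)
Lemma a_input_bound : polybound size_of (fun a => data_size (a_input a)).
Proof.
have [d dP] := ptime_size (ptime_placement R place_has_input).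
have bI : polybound size_of size_of := polybound_id _.
pose E (a : arrival_setting) := size_of a * (size_of a * 11 + size_of a * (size_of a + 6) + 31).
have bE : polybound size_of E.
  apply: (polyboundM bI); apply: polyboundD; last exact: polybound_cst.
  apply: polyboundD; apply: (polyboundM bI); first exact: polybound_cst.
  exact: (polyboundD bI (polybound_cst _ _)).
apply: (@polybound_leq _ _ _ (fun a => size_of a + ((size_of a + 2) ^ d + (E a + size_of a + 20)))).
  move=> a; have -> : data_size (a_input a) =
    (data_size (enc_instance (sI (a_setting a))) + (data_size (enc_placement (@a_stocking a)) +
     (2 + (data_size (enc_history (@a_history a)) +
        (data_size (enc_ord (a_type a)) + 2).+1).+1).+1).+1).+1 by [].
  have hP : data_size (enc_placement (@a_stocking a)) <= (size_of a + 2) ^ d := dP (a_setting a).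
  have := data_size_ord (a_type a).
  have hE : data_size (enc_history (@a_history a)) <= E a + 2.
    apply: leq_trans (@enc_seq_size _ (size_of a * 11 + size_of a * (size_of a + 6) + 30) _) _.
      rewrite -/(enc_history _); elim: (@a_history a) => //= e r IH x [<-|/IH//].
      apply: leq_trans (data_size_event e) _.
      have [hn hm hL] : [/\ sn (a_setting a) <= size_of a, sm (a_setting a) <= size_of a
          & sL (a_setting a) <= size_of a] by rewrite /size_of /input_size; split; lia.
      by have := leq_mul hn (leq_add hL (leqnn 6)); lia.
    rewrite size_map /E leq_add2r -addnS; apply: leq_mul => //.
    apply: leq_trans (ltnW (a_lt a)) _.
    by rewrite /size_of /input_size; lia.
  have : sm (a_setting a) <= size_of a by rewrite /size_of /input_size; lia.
  have : data_size (enc_instance (sI (a_setting a))) <= size_of a.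
    by rewrite /size_of /input_size; lia.
  by lia.
apply: (polyboundD bI); apply: polyboundD; first by exists d.
by apply: polyboundD; [exact: (polyboundD bE bI) | exact: polybound_cst].
Qed.

Lemma d_input_bound :
  polybound (fun x => size_of (d_arrival x)) (fun x => data_size (d_input x)).
Proof.
have bA := @polybound_comp _ _ _ (fun x => size_of (d_arrival x)) d_arrival _
  (fun _ => erefl) a_input_bound.
have br : polybound (fun s => input_size (sI s)) (fun s => rounds (sn s) (sL s) (sT s)).
  exact: bound_rounds place_has_input.
have {}br := @polybound_comp _ _ _ (fun x => size_of (d_arrival x))
  (fun x => a_setting (d_arrival x)) _ (fun _ => erefl) br.
apply: polybound_leq (polyboundD bA (polyboundD br (polybound_cst _ 3))) => x.
have -> : data_size (d_input x) =
  (data_size (a_input (d_arrival x)) + data_size (enc_nat (d_draw x))).+1 by [].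
by have := data_size_nat (d_draw x); have := d_lt x; rewrite /=; lia.
Qed.

Lemma place_program : exists p d, forall s : setting,
  computes_within (sO s) p (enc_instance (sI s))
    (DPair (enc_placement (stocking (sI s) (sO s))) dnil) ((input_size (sI s) + 2) ^ d).
Proof.
apply: (@ptime_program _ id (fun s => enc_instance (sI s))).
exact: (ptime_pair (ptime_placement R place_has_input) (ptime_lit _ 0)).
Qed.

Lemma range_program : exists p d, forall a : arrival_setting,
  computes_within (sO (a_setting a)) p (a_input a)
    (enc_nat (rounds (sn (a_setting a)) (sL (a_setting a)) (sT (a_setting a))))
    ((size_of a + 2) ^ d).
Proof.
apply: (@ptime_program _ a_setting a_input).
apply: ptime_rounds; split=> //.
exact: (ptime_component 0 (ptime_input a_input_bound)).
Qed.

Lemma decide_program : exists p d, forall x : draw_setting,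
  let a := d_arrival x in let s := a_setting a in
  computes_within (sO s) p (d_input x)
    (enc_decision (decide_rule (sI s) (sO s) (@a_history a) (a_type a) (d_draw x)))
    ((size_of a + 2) ^ d).
Proof.
apply: (@ptime_program _ (fun x => a_setting (d_arrival x)) d_input).
have pi := ptime_input d_input_bound; have pa := ptime_fst pi.
apply: (@ptime_decide R (input_context (fun x => a_setting (d_arrival x)) d_input)
  (fun x => a_setting (d_arrival x)) (fun x => @a_history (d_arrival x))
  (fun x => a_type (d_arrival x)) d_draw).
- by split=> //; exact: (ptime_component 0 pa).
- by move=> x; apply: a_lt.
- exact: d_lt.
- exact: (ptime_component 3 pa).
- exact: (ptime_component 4 pa).
- exact: (ptime_snd pi).
Qed.

End Programs.

Lemma exprn_nat (x k : nat) : (x ^+ k)%R = x ^ k.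
Proof. by elim: k => // k IH; rewrite exprS expnS IH. Qed.

Local Open Scope ring_scope.

Theorem theorem4p1 (R : realType) :
  exists (place range decide : prog) (time : {poly nat}),
  forall (n m L T : nat) (I : instance n m L T) (O : data -> data),
    valid I -> stationary I -> oracle_for I O ->
    let b := time.[input_size I] in
    exists (c : placement n L) (advice : data)
      (N : history n m L -> 'I_m -> nat)
      (D : history n m L -> 'I_m -> nat -> decision n L),
      [/\ place_spec I O place b c advice,
          range_spec I O range b c advice N &
          decide_spec I O decide b c advice N D] /\
      [/\ feasible I c,
          is_policy T c (sampled_policy R N D) &
          beta R I * OPT R I <= policy_value I (sampled_policy R N D)].
Proof.
have [p1 [d1 place_ok]] := place_program R.
have [p2 [d2 range_ok]] := range_program R.
have [p3 [d3 decide_ok]] := decide_program R.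
(* Adding the exponents gives one polynomial above all three time bounds, since the base is at least
   2. *)
exists p1, p2, p3, (('X + 2%:P) ^+ (d1 + d2 + d3)) => n m L T I O Iv Is IO.
rewrite horner_exp hornerD hornerX hornerC exprn_nat.
set b := expn _ _ => /=.
have within k p x y : (k <= d1 + d2 + d3)%N ->
    computes_within O p x y ((input_size I + 2) ^ k) -> computes_within O p x y b.
  move=> kd [c [s [pr sy cb]]]; exists c, s; split=> //.
  by apply: leq_trans cb _; rewrite leq_exp2l // addn2.
pose s := Setting Iv IO.
exists (stocking I O), dnil, (fun _ _ => rounds n L T), (decide_rule I O); split; split.
- by apply: within (place_ok s); lia.
- move=> h j hT; split; first exact: rounds_gt0.
  by apply: within (range_ok (@Arrival s h j hT)); lia.
- move=> h j u hT ur.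
  by apply: within (decide_ok (@Draw (@Arrival s h j hT) u ur)); lia.
- exact: stocking_feasible R _ _ _ _ _ _ Iv IO.
(* The sampled policy is [plan_policy] by conversion. *)
- exact: (plan_policyP R (fun u => plan I O (queue I O u)) (stocking I O) (rounds_gt0 n L T)).
- exact: (guarantee R Iv Is IO).
Qed.
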